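(* Let $2<p\le\infty$ and $g\in H(\mathbb{D})$. Then $I_g:H^p(\mathbb{D})\to\mathcal{L}^{2,1-\frac{2}{p}}(\mathbb{D})$ is bounded if and only if $g\in H^\infty(\mathbb{D})$. Moreover $\|I_g\|\approx\|g\|_\infty$, where $\|g\|_\infty=\sup_{z\in\mathbb{D}}|g(z)|$.
   Context: $\mathbb{D}$ is the open unit disc, $H(\mathbb{D})$ the analytic functions on $\mathbb{D}$, $dA=\frac{1}{\pi}dx\,dy$. For $0<p<\infty$, $H^p(\mathbb{D})$ is the Hardy space with $\|f\|_{H^p}^p=\sup_{0<r<1}\frac{1}{2\pi}\int_0^{2\pi}|f(re^{i\theta})|^pd\theta$; $H^\infty(\mathbb{D})$ is the space of bounded analytic functions with the sup norm. For $g\in H(\mathbb{D})$, $I_gf(z)=\int_0^z f'(w)g(w)\,dw$. For an arc $I\subset\partial\mathbb{D}$, $|I|=\frac{1}{2\pi}\int_I|d\zeta|$, $f_I=\frac{1}{|I|}\int_I f(\zeta)\frac{|d\zeta|}{2\pi}$, $S(I)=\{z\in\mathbb{D}:1-|I|\le |z|<1,\ z/|z|\in I\}$. For $0<\lambda\le1$, $\mathcal{L}^{2,\lambda}(\mathbb{D})$ is the set of $f\in H^2(\mathbb{D})$ with $\sup_{I}\big(|I|^{-\lambda}\int_I|f(\zeta)-f_I|^2\frac{|d\zeta|}{2\pi}\big)^{1/2}<\infty$, normed by $\|f\|_{\mathcal{L}^{2,\lambda}}=|f(0)|+\sup_{I}\big(|I|^{-\lambda}\int_{S(I)}|f'(z)|^2(1-|z|^2)dA(z)\big)^{1/2}$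 (for $p=\infty$, $\lambda=1$). $A\approx B$ means $A\lesssim B\lesssim A$ with constants depending only on $p$. *)

(* Defs.v *)
From HB Require Import structures.
From mathcomp Require Import all_boot all_order all_algebra.
From mathcomp Require Import all_classical all_reals all_analysis.
From mathcomp Require Import complex.
Set Implicit Arguments. Unset Strict Implicit. Unset Printing Implicit Defensive.
Import Order.TTheory GRing.Theory Num.Theory numFieldNormedType.Exports.
Local Open Scope classical_set_scope.
Local Open Scope ring_scope.
Local Open Scope complex_scope.

Section HardyMorrey.
Variable R : realType.
Local Notation C := R[i].

Definition cabs (z : C) : R := complex.Re `|z|.

Definition disc : set C := [set z | cabs z < 1].

Definition cexpi (t : R) : C := cos t +i* sin t.

Definition has_cderiv (f : C -> C) (z l : C) : Prop :=
  forall e : R, 0 < e -> exists2 d : R, 0 < d &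
    forall h : C, 0 < cabs h < d -> cabs ((f (z + h) - f z) / h - l) < e.

Definition holo (f : C -> C) : Prop :=
  forall z, disc z -> exists l, has_cderiv f z l.

(* the complex derivative f' (meaningful where f is differentiable) *)
Definition cderiv (f : C -> C) (z : C) : C := xget 0 [set l | has_cderiv f z l].

Definition rint (a b : R) (h : R -> R) : R :=
  fine (\int[@lebesgue_measure R]_(t in `[a, b]) (h t)%:E)%E.

Definition cint (a b : R) (h : R -> C) : C :=
  rint a b (fun t => complex.Re (h t)) +i* rint a b (fun t => complex.Im (h t)).

Definition hmean (q : R) (f : C -> C) (r : R) : \bar R :=
  (((2 * pi)^-1)%R%:E *
   \int[@lebesgue_measure R]_(t in `[0%R, (2 * pi)%R]) ((cabs (f (r%:C * cexpi t))) `^ q)%:E)%E.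

Definition sup_norm (g : C -> C) : \bar R :=
  ereal_sup [set (cabs (g z))%:E | z in disc].

Definition hnorm (p : \bar R) (f : C -> C) : \bar R :=
  match p with
  | q%:E => poweR (ereal_sup [set hmean q f r | r in `]0, 1[]) q^-1
  | +oo%E => sup_norm f
  | -oo%E => 0%E
  end.

Definition in_Hp (p : \bar R) (f : C -> C) : Prop := holo f /\ (hnorm p f < +oo)%E.

Record arc := Arc { arc_start : R; arc_len : R;
                    arc_len_gt0 : 0 < arc_len; arc_len_le : arc_len <= 2 * pi }.

Definition arc_set (I : arc) : set C :=
  [set cexpi t | t in `[arc_start I, arc_start I + arc_len I]].

Definition arc_size (I : arc) : R := arc_len I / (2 * pi).

Definition arc_cint (I : arc) (h : C -> C) : C :=
  ((2 * pi)^-1)%:C * cint (arc_start I) (arc_start I + arc_len I) (fun t => h (cexpi t)).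
Definition arc_rint (I : arc) (h : C -> R) : \bar R :=
  (((2 * pi)^-1)%R%:E *
   \int[@lebesgue_measure R]_(t in `[(arc_start I)%R, (arc_start I + arc_len I)%R]) (h (cexpi t))%:E)%E.

Definition bval (f : C -> C) (zeta : C) : C :=
  lim ((fun r : R => complex.Re (f (r%:C * zeta))) @ at_left 1) +i*
  lim ((fun r : R => complex.Im (f (r%:C * zeta))) @ at_left 1).

Definition arc_avg (I : arc) (f : C -> C) : C :=
  (arc_size I)^-1%:C * arc_cint I (bval f).

Definition carleson_box (I : arc) : set C :=
  [set z | 1 - arc_size I <= cabs z < 1 /\ arc_set I (z / `|z|)].

Definition area_int (A : set C) (F : C -> R) : \bar R :=
  ((pi^-1)%R%:E *
   \int[(@lebesgue_measure R \x @lebesgue_measure R)%E]_(xy in [set xy : R * R | A (xy.1 +i* xy.2)])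
     (F (xy.1 +i* xy.2))%:E)%E.

Definition in_Morrey (lam : R) (f : C -> C) : Prop :=
  in_Hp 2%:E f /\
  (ereal_sup [set poweR (((arc_size I) `^ (- lam))%R%:E *
                   arc_rint I (fun zeta => (cabs (bval f zeta - arc_avg I f)) ^+ 2)%R) 2^-1
             | I in [set: arc]] < +oo)%E.

Definition morrey_norm (lam : R) (f : C -> C) : \bar R :=
  ((cabs (f 0))%:E +
   ereal_sup [set poweR (((arc_size I) `^ (- lam))%R%:E *
                 area_int (carleson_box I)
                   (fun z => (cabs (cderiv f z)) ^+ 2 * (1 - (cabs z) ^+ 2))%R) 2^-1
             | I in [set: arc]])%E.

(* I_g f (z) = int_0^z f'(w) g(w) dw, integrated along the segment [0, z] *)
Definition Ig (g f : C -> C) (z : C) : C :=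
  z * cint 0 1 (fun t => cderiv f (t%:C * z) * g (t%:C * z)).

Definition lam_of (p : \bar R) : R :=
  match p with q%:E => 1 - 2 / q | _ => 1 end.

Definition Ig_bound (p : \bar R) (g : C -> C) (M : R) : Prop :=
  forall f, in_Hp p f ->
    in_Morrey (lam_of p) (Ig g f) /\
    (morrey_norm (lam_of p) (Ig g f) <= M%:E * hnorm p f)%E.

Definition Ig_bounded (p : \bar R) (g : C -> C) : Prop := exists M : R, Ig_bound p g M.

End HardyMorrey.

(* Main.v *)
Require Import Defs.
From HB Require Import structures.
From mathcomp Require Import all_boot all_order all_algebra.
From mathcomp Require Import all_classical all_reals all_analysis.
From mathcomp Require Import measurable_realfun.
From mathcomp Require Import complex ring lra.
Set Implicit Arguments. Unset Strict Implicit. Unset Printing Implicit Defensive.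
Import Order.TTheory GRing.Theory Num.Theory numFieldNormedType.Exports.
Local Open Scope classical_set_scope.
Local Open Scope ring_scope.
Local Open Scope complex_scope.

(* Upper bound.  Write F = I_g f, so F' = f' g and |F'| <= G |f'| with G = |g|_oo.
   From x^2 <= s^2 + s^(2-p) x^p one gets the weighted estimate
   mean |f|^2 / |1 - conj(b) e^(it)|^2 <= 2 N^2 d^(lam-2) for |b| <= 1 - d, where
   N > |f|_(H^p) and lam = 1 - 2/p.  For an arc of size d and a = (1-d) e^(i alpha)
   with alpha its endpoint, |1 - conj(a) z| = O(d) on the Carleson box, so the box
   integral of |f'|^2 (1 - |z|^2) is O(d^2) times that of |f' / (1 - conj(a) z)|^2,
   which the Littlewood-Paley identity for h = f / (1 - conj(a) z) controls by the
   weighted estimate.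

   Membership in the Morrey space.  Composing the dilates of F and f with the
   Moebius involution at a and comparing Littlewood-Paley integrals bounds the mean
   oscillation of F(r .) around F(r a) on the arc, uniformly in r < 1.  Radial limits
   of F exist almost everywhere: the Poisson integral is dominated by the
   Hardy-Littlewood maximal function, applied to the tails of the Taylor series.
   Fatou's lemma then passes to the limit r -> 1.

   Lower bound.  For 1/2 <= |a| < 1 test on f = 1 / (1 - conj(a) z): the box of an
   arc of size 2 (1 - |a|) centred at a/|a| contains the disc of radius (1 - |a|)/2
   around a, and the sub-mean value property of |F'|^2 there gives |g(a)| <= 32 M.
   Smaller |a| follow from a mean over the circle of radius 3/4.

   Analytic functions are handled through their Taylor series, obtained from
   Goursat's lemma for h o exp on rectangles. *)

(** * Complex modulus, continuity and complex derivatives *)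

(** The upper bound uses f only through [wbound], so all p > 2 are treated at once; the exponent lam
    - 2 is what Hoelder's inequality would give. Dividing f by 1 - conj(a) z before applying
    Littlewood-Paley localizes the identity to the box, at the price of one product rule term, which
    the width d of the annulus compensates. Two obstacles shape the rest. Values of f outside the
    open disc are arbitrary and [bval] is built from limits that need not exist everywhere, so
    neither [bval] nor the box comes with measurability: integrals of nonnegative functions are
    compared by monotonicity, and measurability is asked at most of the majorant. Circle means at
    radius 1 require holomorphy across the circle, so dilates are used and every estimate is uniform
    in the dilation. In the lower bound the test kernel has norm at most d^(-(1 + lam)/2), with d =
    1 - |a|; this makes all powers of d cancel for every p, and both constants of the equivalence
    come out absolute. *)

Section ComplexBasics.
Variable R : realType.
Local Notation C := R[i].
Local Notation cj := (@conjc R).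
Implicit Types (z w : C) (x y t : R) (f g : C -> C).

Lemma cabsE z : `|z| = (cabs z)%:C.
Proof. by rewrite /cabs normc_def. Qed.

Lemma cabs_sqrt z : cabs z = Num.sqrt (complex.Re z ^+ 2 + complex.Im z ^+ 2).
Proof. by rewrite /cabs normc_def. Qed.

Lemma cabs_ge0 z : 0 <= cabs z.
Proof. by rewrite cabs_sqrt sqrtr_ge0. Qed.
Hint Resolve cabs_ge0 : core.

Lemma sqr_cabs z : cabs z ^+ 2 = complex.Re z ^+ 2 + complex.Im z ^+ 2.
Proof. by rewrite cabs_sqrt sqr_sqrtr// addr_ge0 ?sqr_ge0. Qed.

Lemma cabsM z w : cabs (z * w) = cabs z * cabs w.
Proof. by apply: complexI; rewrite rmorphM/= -!cabsE normrM. Qed.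

Lemma cabsD z w : cabs (z + w) <= cabs z + cabs w.
Proof. by rewrite -lecR rmorphD/= -!cabsE ler_normD. Qed.

Lemma cabsN z : cabs (- z) = cabs z.
Proof. by apply: complexI; rewrite -!cabsE normrN. Qed.

Lemma cabsB z w : cabs (z - w) = cabs (w - z).
Proof. by rewrite -cabsN opprB. Qed.

Lemma cabs0 : cabs (0 : C) = 0.
Proof. by apply: complexI; rewrite -cabsE normr0. Qed.

Lemma cabs1 : cabs (1 : C) = 1.
Proof. by apply: complexI; rewrite -cabsE normr1. Qed.

Lemma cabs_eq0 z : (cabs z == 0) = (z == 0).
Proof. by rewrite -(inj_eq (@complexI R)) -cabsE normr_eq0. Qed.

Lemma cabs_gt0 z : (0 < cabs z) = (z != 0).
Proof. by rewrite lt_def cabs_ge0 cabs_eq0 andbT. Qed.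

Lemma cabsX z n : cabs (z ^+ n) = cabs z ^+ n.
Proof. by apply: complexI; rewrite rmorphXn/= -!cabsE normrX. Qed.

Lemma cabsV z : cabs z^-1 = (cabs z)^-1.
Proof. by apply: complexI; rewrite fmorphV/= -!cabsE normfV. Qed.

Lemma cabsR x : cabs x%:C = `|x|.
Proof. by rewrite cabs_sqrt/= expr0n/= addr0 sqrtr_sqr. Qed.

Lemma cabs_nat n : cabs (n%:R : C) = n%:R.
Proof. by rewrite -(rmorph_nat (real_complex R)) cabsR normr_nat. Qed.

Lemma cabs_conj z : cabs (cj z) = cabs z.
Proof. by rewrite !cabs_sqrt; case: z => a b /=; rewrite sqrrN. Qed.

Lemma mul_conj z : z * (cj z) = (cabs z ^+ 2)%:C.
Proof.
rewrite sqr_cabs; case: z => a b; rewrite /=; apply/eqP; rewrite eq_complex /=.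
by apply/andP; split; apply/eqP; ring.
Qed.

Lemma Re_le_cabs z : `|complex.Re z| <= cabs z.
Proof.
by rewrite cabs_sqrt -sqrtr_sqr ler_sqrt ?lerDl ?sqr_ge0// addr_ge0 ?sqr_ge0.
Qed.

Lemma Im_le_cabs z : `|complex.Im z| <= cabs z.
Proof.
by rewrite cabs_sqrt -sqrtr_sqr ler_sqrt ?lerDr ?sqr_ge0// addr_ge0 ?sqr_ge0.
Qed.

Lemma cabs_le_ReIm z : cabs z <= `|complex.Re z| + `|complex.Im z|.
Proof.
rewrite -(@ler_pXn2r _ 2)// ?nnegrE ?addr_ge0//.
rewrite sqr_cabs sqrrD !real_normK ?num_real// -addrA lerD2l lerDr.
by rewrite mulrn_wge0 ?mulr_ge0.
Qed.

Lemma cabs_sum (I : Type) (r : seq I) (P : pred I) (F : I -> C) :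
  cabs (\sum_(i <- r | P i) F i) <= \sum_(i <- r | P i) cabs (F i).
Proof.
elim/big_ind2 : _ => //; first by rewrite cabs0.
by move=> a b c d ab cd; rewrite (le_trans (cabsD _ _))// lerD.
Qed.

Lemma cabs_triB z w : cabs z - cabs w <= cabs (z - w).
Proof. by rewrite lerBlDr (le_trans _ (cabsD _ _))// subrK. Qed.

Lemma cabs_ltr_dist z w : `|cabs z - cabs w| <= cabs (z - w).
Proof.
by rewrite ler_norml cabs_triB andbT lerNl opprB (le_trans (cabs_triB _ _))// cabsB.
Qed.

Lemma cexpi0 : cexpi 0 = 1 :> C.
Proof. by rewrite /cexpi cos0 sin0. Qed.

Lemma cabs_cexpi t : cabs (cexpi t) = 1.
Proof. by rewrite cabs_sqrt /= cos2Dsin2 sqrtr1. Qed.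

Lemma cexpiD x y : cexpi (x + y) = cexpi x * cexpi y.
Proof.
rewrite /cexpi; apply/eqP; rewrite eq_complex /= cosD sinD.
by apply/andP; split; apply/eqP; ring.
Qed.

Lemma cexpiN x : cexpi (- x) = (cj (cexpi x)).
Proof. by rewrite /cexpi cosN sinN. Qed.

Lemma cexpi_neq0 x : cexpi x != 0.
Proof. by rewrite -cabs_gt0 cabs_cexpi. Qed.

Lemma cexpi_conjV x : (cj (cexpi x)) = (cexpi x)^-1.
Proof.
apply: (mulfI (cexpi_neq0 x)); rewrite mul_conj cabs_cexpi expr1n.
by rewrite divff ?cexpi_neq0.
Qed.

Lemma cexpiX x n : cexpi x ^+ n = cexpi (n%:R * x).
Proof.
elim: n => [|n IH]; first by rewrite mul0r cexpi0.
by rewrite exprS IH -cexpiD -{1}(mul1r x) -mulrDl nat1r.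
Qed.

Lemma cexpi_2pi x : cexpi (x + 2 * pi) = cexpi x.
Proof.
by rewrite mulr_natl /cexpi cosD2pi sinD2pi.
Qed.

Lemma conj_continuous_dist z w : cabs ((cj z) - (cj w)) = cabs (z - w).
Proof. by rewrite -rmorphB cabs_conj. Qed.

(** Continuity in the same epsilon-delta form as [has_cderiv], so that the two combine without
    passing through the topology of [R[i]]. *)
Definition ccont f z := forall e : R, 0 < e -> exists2 d : R, 0 < d &
  forall w, cabs (w - z) < d -> cabs (f w - f z) < e.

Lemma ccont_cst (c : C) z : ccont (fun=> c) z.
Proof. by move=> e e0; exists 1 => // w _; rewrite subrr cabs0. Qed.

Lemma ccont_id z : ccont id z.
Proof. by move=> e e0; exists e. Qed.

Lemma ccontD f g z : ccont f z -> ccont g z -> ccont (fun w => f w + g w) z.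
Proof.
move=> cf cg e e0; have e2 : 0 < e / 2 by rewrite divr_gt0.
have [d d0 Hd] := cf _ e2; have [d' d'0 Hd'] := cg _ e2.
exists (Num.min d d') => [|w]; first by rewrite lt_min d0.
rewrite lt_min => /andP[/Hd H1 /Hd' H2].
rewrite (_ : _ - _ = (f w - f z) + (g w - g z)); last by ring.
by rewrite (le_lt_trans (cabsD _ _))// (splitr e) ltrD.
Qed.

Lemma ccontM f g z : ccont f z -> ccont g z -> ccont (fun w => f w * g w) z.
Proof.
move=> cf cg e e0.
pose M := cabs (f z) + cabs (g z) + 1.
have M1 : 1 <= M by rewrite lerDr addr_ge0.
have M0 : 0 < M by rewrite (lt_le_trans _ M1).
have e2 : 0 < Num.min 1 (e / M / 2) by rewrite lt_min ltr01/= !divr_gt0.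
have [d d0 Hd] := cf _ e2; have [d' d'0 Hd'] := cg _ e2.
exists (Num.min d d') => [|w]; first by rewrite lt_min d0.
rewrite lt_min => /andP[/Hd + /Hd'].
rewrite !lt_min => /andP[_ H1] /andP[H2 H3].
rewrite (_ : _ - _ = (f w - f z) * g w + f z * (g w - g z)); last by ring.
have gM : cabs (g w) <= M.
  rewrite -(subrK (g z) (g w)) (le_trans (cabsD _ _))// addrC /M.
  have := cabs_ge0 (f z); move: (cabs_ge0 (g z)) H2; lra.
have fM : cabs (f z) <= M by rewrite /M -addrA lerDl addr_ge0.
rewrite (le_lt_trans (cabsD _ _))// !cabsM.
have -> : e = e / M / 2 * M + M * (e / M / 2) by field; rewrite gt_eqF.
apply: ler_ltD; first by rewrite ler_pM// ltW.
by rewrite (le_lt_trans (ler_wpM2r _ fM))// ltr_pM2l.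
Qed.

Lemma ccontN f z : ccont f z -> ccont (fun w => - f w) z.
Proof.
move=> cf e /cf[d d0 Hd]; exists d => // w /Hd.
by rewrite -opprD cabsN.
Qed.

Lemma ccontB f g z : ccont f z -> ccont g z -> ccont (fun w => f w - g w) z.
Proof. by move=> cf /ccontN; exact: ccontD. Qed.

Lemma ccontV f z : f z != 0 -> ccont f z -> ccont (fun w => (f w)^-1) z.
Proof.
move=> fz0 cf e e0.
have c0 : 0 < cabs (f z) by rewrite cabs_gt0.
have e1 : 0 < Num.min (cabs (f z) / 2) (e * (cabs (f z) ^+ 2 / 2)).
  by rewrite lt_min !divr_gt0// mulr_gt0// divr_gt0// exprn_gt0.
have [d d0 Hd] := cf _ e1; exists d => // w /Hd.
rewrite lt_min => /andP[H1 H2].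
have fw : cabs (f z) / 2 < cabs (f w).
  have := le_lt_trans (cabs_triB (f z) (f w)); rewrite cabsB => /(_ _ H1).
  by lra.
have fw0 : f w != 0 by rewrite -cabs_gt0 (lt_trans _ fw)// divr_gt0.
rewrite (_ : _ - _ = (f z - f w) / (f w * f z)); last first.
  by field; rewrite fz0.
rewrite cabsM cabsV cabsM cabsB ltr_pdivrMr ?mulr_gt0 ?cabs_gt0//.
rewrite (lt_le_trans H2)// ler_pM2l// expr2 -mulrA [_ * (_ / 2)]mulrC ler_pM2r//.
exact: ltW.
Qed.

Lemma ccont_comp f g z : ccont f z -> ccont g (f z) -> ccont (fun w => g (f w)) z.
Proof.
move=> cf cg e /cg[d /cf[d' d'0 Hd'] Hd]; exists d' => // w /Hd'; exact: Hd.
Qed.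

Lemma ccont_conj z : ccont (fun w => (cj w)) z.
Proof. by move=> e e0; exists e => // w; rewrite conj_continuous_dist. Qed.

(** Componentwise, because [cint] integrates real and imaginary parts separately, and on the whole
    line, so that integrability on every segment is immediate. *)
Definition rcont (h : R -> C) :=
  continuous (fun t => complex.Re (h t)) /\ continuous (fun t => complex.Im (h t)).

Lemma rcontP (h : R -> C) : rcont h <-> forall t (e : R), 0 < e ->
  \forall s \near t, cabs (h s - h t) < e.
Proof.
split=> [[c1 c2] t e e0|H].
  have e2 : 0 < e / 2 by rewrite divr_gt0.
  have /cvgrPdist_lt/(_ _ e2) H1 := c1 t.
  have /cvgrPdist_lt/(_ _ e2) H2 := c2 t.
  apply: filterS2 H1 H2 => s H1 H2.
  rewrite cabsB (le_lt_trans (cabs_le_ReIm _))// (splitr e) !raddfB.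
  exact: ltrD.
split=> t; apply/cvgrPdist_lt => e e0; apply: filterS (H t _ e0) => s;
  rewrite cabsB; apply: le_lt_trans; rewrite -raddfB.
  exact: Re_le_cabs.
exact: Im_le_cabs.
Qed.

Lemma rcont_comp (h : R -> C) f : rcont h -> (forall t, ccont f (h t)) ->
  rcont (fun t => f (h t)).
Proof.
move=> /rcontP ch cf; apply/rcontP => t e /(cf t)[d d0 Hd].
by apply: filterS (ch t _ d0) => s; exact: Hd.
Qed.

Lemma rcont_cabs (h : R -> C) : rcont h -> continuous (fun t => cabs (h t)).
Proof.
move=> /rcontP ch t; apply/cvgrPdist_lt => e e0.
apply: filterS (ch t _ e0) => s; rewrite cabsB; apply: le_lt_trans.
exact: cabs_ltr_dist.
Qed.

Lemma rcont_cst (c : C) : rcont (fun=> c).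
Proof. by split=> t; exact: cvg_cst. Qed.

Lemma rcont_real (h : R -> R) : continuous h -> rcont (fun t => (h t)%:C).
Proof. by move=> ch; split=> // t; exact: cvg_cst. Qed.

Lemma rcont_cexpi : rcont (@cexpi R).
Proof. by split; [exact: continuous_cos|exact: continuous_sin]. Qed.

Lemma rcontD (h k : R -> C) : rcont h -> rcont k -> rcont (fun t => h t + k t).
Proof.
move=> [h1 h2] [k1 k2]; split.
  by under eq_fun do rewrite raddfD; move=> t; apply: cvgD; [exact: h1|exact: k1].
by under eq_fun do rewrite raddfD; move=> t; apply: cvgD; [exact: h2|exact: k2].
Qed.

Lemma cReM z w : complex.Re (z * w) =
  complex.Re z * complex.Re w - complex.Im z * complex.Im w.
Proof. by case: z => a b; case: w. Qed.

Lemma cImM z w : complex.Im (z * w) =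
  complex.Re z * complex.Im w + complex.Im z * complex.Re w.
Proof. by case: z => a b; case: w. Qed.

Lemma rcontM (h k : R -> C) : rcont h -> rcont k -> rcont (fun t => h t * k t).
Proof.
move=> [h1 h2] [k1 k2]; split.
  under eq_fun do rewrite cReM; move=> t.
  by apply: cvgB; apply: cvgM; [exact: h1|exact: k1|exact: h2|exact: k2].
under eq_fun do rewrite cImM; move=> t.
by apply: cvgD; apply: cvgM; [exact: h1|exact: k2|exact: h2|exact: k1].
Qed.

Lemma rcont_re (h : R -> C) (k : R -> R) : rcont h -> continuous k ->
  rcont (fun t => h (k t)).
Proof.
move=> /rcontP ch ck; apply/rcontP => t e e0.
exact: (ck t _ (ch (k t) e e0)).
Qed.

End ComplexBasics.
#[global] Hint Extern 0 (is_true (@Order.le _ _ _ (cabs _))) => exact: cabs_ge0 : core.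

Section ComplexDerivative.
Variable R : realType.
Local Notation C := R[i].
Local Notation cj := (@conjc R).
Implicit Types (z w l : C) (x y t : R) (f g : C -> C).

(** Caratheodory's form of the derivative: the slope is a function continuous at z. The product,
    quotient and chain rules become algebra, with no case of a vanishing increment. *)
Lemma has_cderiv_slope f z l : has_cderiv f z l <->
  exists phi : C -> C, [/\ ccont phi z, phi z = l &
    forall w, f w = f z + phi w * (w - z)].
Proof.
split=> [H|[phi [cphi <- fE]] e e0]; last first.
  have [d d0 Hd] := cphi e e0.
  exists d => // h /andP[h0 hd]; rewrite fE [f z + _]addrC addrK addrAC subrr add0r.
  rewrite mulfK ?Hd//; last by rewrite -cabs_gt0.
  by rewrite addrAC subrr add0r.
pose phi w := if w == z then l else (f w - f z) / (w - z).
have phiz : phi z = l by rewrite /phi eqxx.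
exists phi; split=> // [|w]; last first.
  rewrite /phi; case: eqP => [->|/eqP wz]; first by rewrite subrr mulr0 addr0.
  by rewrite divfK ?subr_eq0// addrC subrK.
move=> e e0; have [d d0 Hd] := H e e0.
exists d => // w wz; rewrite phiz /phi; case: eqP => [_|/eqP wnz].
  by rewrite subrr cabs0.
have := Hd (w - z); rewrite wz cabs_gt0 subr_eq0 wnz => /(_ isT).
by rewrite [z + _]addrC subrK.
Qed.

Lemma has_cderiv_continuous f z l : has_cderiv f z l -> ccont f z.
Proof.
move=> /has_cderiv_slope[phi [cphi _ /funext ->]].
apply: ccontD; first exact: ccont_cst.
by apply: ccontM => //; apply: ccontB; [exact: ccont_id|exact: ccont_cst].
Qed.

Lemma has_cderiv_unique f z l l' : has_cderiv f z l -> has_cderiv f z l' -> l = l'.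
Proof.
move=> fl fl'; apply/eqP; rewrite -subr_eq0 -cabs_eq0 eq_le cabs_ge0 andbT.
apply/ler_addgt0Pl => e e0; rewrite addr0.
have e2 : 0 < e / 2 by rewrite divr_gt0.
have [d d0 Hd] := fl _ e2; have [d' d'0 Hd'] := fl' _ e2.
pose h := (Num.min d d' / 2)%:C : C.
have m0 : 0 < Num.min d d' by rewrite lt_min d0.
have hE : cabs h = Num.min d d' / 2 by rewrite cabsR ger0_norm// divr_ge0// ltW.
have h0 : 0 < cabs h by rewrite hE divr_gt0.
have hm : cabs h < Num.min d d' by rewrite hE ltr_pdivrMr// ltr_pMr// ltr1n.
move: (hm); rewrite lt_min => /andP[hd hd'].
have := Hd h; rewrite h0 hd => /(_ isT); set q := (_ / h) => H1.
have := Hd' h; rewrite h0 hd' => /(_ isT); rewrite -/q => H2.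
have -> : l - l' = (q - l') - (q - l) by ring.
by rewrite (le_trans (cabsD _ _))// cabsN (splitr e) lerD// ltW.
Qed.

Lemma cderivE f z l : has_cderiv f z l -> cderiv f z = l.
Proof. by move=> fl; apply: xget_subset1 => // a b; exact: has_cderiv_unique. Qed.

Lemma cderivP f z : (exists l, has_cderiv f z l) -> has_cderiv f z (cderiv f z).
Proof. by move=> [l fl]; rewrite (cderivE fl). Qed.

Lemma has_cderiv_near f g z l : (exists2 d : R, 0 < d & forall w, cabs (w - z) < d -> f w = g w) ->
  has_cderiv f z l -> has_cderiv g z l.
Proof.
move=> [d d0 fg] H e e0; have [d' d'0 Hd'] := H e e0.
exists (Num.min d d'); first by rewrite lt_min d0 d'0.
move=> h; rewrite lt_min => /and3P[h0 hd hd'].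
have <- : f (z + h) = g (z + h) by apply: fg; rewrite addrC addKr.
have <- : f z = g z by apply: fg; rewrite subrr cabs0.
by rewrite Hd'// h0.
Qed.

Lemma has_cderiv_ext f g z l : f =1 g -> has_cderiv f z l -> has_cderiv g z l.
Proof. by move=> /funext ->. Qed.

Lemma has_cderiv_cst (c : C) z : has_cderiv (fun=> c) z 0.
Proof.
apply/has_cderiv_slope; exists (fun=> 0); split => // [|w].
  exact: ccont_cst.
by rewrite mul0r addr0.
Qed.

Lemma has_cderiv_id z : has_cderiv id z 1.
Proof.
apply/has_cderiv_slope; exists (fun=> 1); split => // [|w].
  exact: ccont_cst.
by rewrite mul1r addrC subrK.
Qed.

Lemma has_cderivD f g z l m : has_cderiv f z l -> has_cderiv g z m ->
  has_cderiv (fun w => f w + g w) z (l + m).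
Proof.
move=> /has_cderiv_slope[p [cp <- pE]] /has_cderiv_slope[q [cq <- qE]].
apply/has_cderiv_slope; exists (fun w => p w + q w); split => // [|w].
  exact: ccontD.
by rewrite (pE w) (qE w); ring.
Qed.

Lemma has_cderivM f g z l m : has_cderiv f z l -> has_cderiv g z m ->
  has_cderiv (fun w => f w * g w) z (l * g z + f z * m).
Proof.
move=> /[dup] /has_cderiv_continuous cf /has_cderiv_slope[p [cp <- pE]].
move=> /[dup] /has_cderiv_continuous cg /has_cderiv_slope[q [cq <- qE]].
apply/has_cderiv_slope; exists (fun w => p w * g w + f z * q w); split => // [|w].
  by apply: ccontD; apply: ccontM => //; exact: ccont_cst.
by rewrite (pE w) (qE w); ring.
Qed.

Lemma has_cderivZ (c : C) f z l : has_cderiv f z l -> has_cderiv (fun w => c * f w) z (c * l).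
Proof.
by move=> fl; have := has_cderivM (has_cderiv_cst c z) fl; rewrite mul0r add0r.
Qed.

Lemma has_cderivX f z l n : has_cderiv f z l ->
  has_cderiv (fun w => f w ^+ n) z (n%:R * f z ^+ n.-1 * l).
Proof.
move=> fl; elim: n => [|n IH].
  by rewrite mul0r mul0r; exact: has_cderiv_cst.
have -> : n.+1%:R * f z ^+ n.+1.-1 * l = l * f z ^+ n + f z * (n%:R * f z ^+ n.-1 * l).
  by case: n {IH} => [|n] /=; rewrite ?exprS; [ring|rewrite -(natr1 n.+1); ring].
by apply: (has_cderiv_ext _ (has_cderivM fl IH)) => w; rewrite exprS.
Qed.

Lemma has_cderivN f z l : has_cderiv f z l -> has_cderiv (fun w => - f w) z (- l).
Proof.
move=> fl; rewrite -mulN1r.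
by apply: (has_cderiv_ext _ (has_cderivZ _ fl)) => w; rewrite mulN1r.
Qed.

Lemma has_cderivB f g z l m : has_cderiv f z l -> has_cderiv g z m ->
  has_cderiv (fun w => f w - g w) z (l - m).
Proof. by move=> fl /has_cderivN gm; exact: has_cderivD. Qed.

Lemma has_cderivV_nz f z l : (forall w, f w != 0) -> has_cderiv f z l ->
  has_cderiv (fun w => (f w)^-1) z (- (f z) ^- 2 * l).
Proof.
move=> f0 /[dup] /has_cderiv_continuous cf /has_cderiv_slope[p [cp <- pE]].
apply/has_cderiv_slope; exists (fun w => - (f z)^-1 * (f w)^-1 * p w).
split => // [||w].
- apply: ccontM => //; apply: ccontM; first exact: ccont_cst.
  exact: ccontV.
- by rewrite expr2 invfM mulNr.
- rewrite -[_ * p w * _]mulrA (_ : p w * (w - z) = f w - f z); last first.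
    by rewrite (pE w) [f z + _]addrC addrK.
  by field; rewrite !f0.
Qed.

Lemma has_cderivV f z l : f z != 0 -> has_cderiv f z l ->
  has_cderiv (fun w => (f w)^-1) z (- (f z) ^- 2 * l).
Proof.
move=> fz0 fl; pose g w : C := if f w == 0 then 1 else f w.
have gz : g z = f z by rewrite /g (negbTE fz0).
have [d d0 Hd] : exists2 d : R, 0 < d & forall w, cabs (w - z) < d -> f w = g w.
  have fz1 : 0 < cabs (f z) by rewrite cabs_gt0.
  have [d d0 Hd] := has_cderiv_continuous fl fz1; exists d => // w /Hd.
  by rewrite /g; case: eqP => // ->; rewrite sub0r cabsN ltxx.
have gl : has_cderiv g z l by apply: has_cderiv_near fl; exists d.
rewrite -gz; apply: (has_cderiv_near _ (has_cderivV_nz _ gl)).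
  by exists d => // w /Hd ->.
by move=> w; rewrite /g; case: (eqVneq (f w) 0) => // _; exact: oner_neq0.
Qed.

Lemma has_cderiv_comp f g z l m : has_cderiv f z l -> has_cderiv g (f z) m ->
  has_cderiv (fun w => g (f w)) z (m * l).
Proof.
move=> /[dup] /has_cderiv_continuous cf /has_cderiv_slope[p [cp <- pE]].
move=> /has_cderiv_slope[q [cq <- qE]].
apply/has_cderiv_slope; exists (fun w => q (f w) * p w); split => // [|w].
  by apply: ccontM => //; exact: ccont_comp.
by rewrite (qE (f w)) (pE w) [f z + _]addrC addrK mulrA.
Qed.

(** [holoD 1] unfolds to [holo]; radii above 1 occur for dilates and for kernels with |a| < 1. *)
Definition holoD (rho : R) f := forall z, cabs z < rho -> exists l, has_cderiv f z l.

Lemma holoD_cderiv rho f z : holoD rho f -> cabs z < rho -> has_cderiv f z (cderiv f z).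
Proof. by move=> hf zr; apply: cderivP; exact: hf. Qed.

Lemma holoD_continuous rho f z : holoD rho f -> cabs z < rho -> ccont f z.
Proof. by move=> hf /(holoD_cderiv hf) /has_cderiv_continuous. Qed.

Lemma holoDS rho rho' f : rho' <= rho -> holoD rho f -> holoD rho' f.
Proof. by move=> rr hf z zr; apply: hf; exact: lt_le_trans rr. Qed.

Lemma holoDM rho f g : holoD rho f -> holoD rho g -> holoD rho (fun z => f z * g z).
Proof.
by move=> hf hg z zr; have [l fl] := hf z zr; have [m gm] := hg z zr;
  eexists; exact: (has_cderivM fl gm).
Qed.

Lemma holoDB rho f g : holoD rho f -> holoD rho g -> holoD rho (fun z => f z - g z).
Proof.
by move=> hf hg z zr; have [l fl] := hf z zr; have [m gm] := hg z zr;
  eexists; exact: (has_cderivB fl gm).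
Qed.

Lemma holoD_cst rho (c : C) : holoD rho (fun=> c).
Proof. by move=> z _; exists 0; exact: has_cderiv_cst. Qed.

Lemma holoD_dilate rho f (c : C) s : holoD rho f -> cabs c * s <= rho ->
  holoD s (fun z => f (c * z)).
Proof.
move=> hf cs z zs.
have [c0|c0] := eqVneq c 0.
  exists 0; apply: (has_cderiv_ext _ (has_cderiv_cst (f 0) z)) => w.
  by rewrite c0 mul0r.
have czr : cabs (c * z) < rho.
  by rewrite cabsM (lt_le_trans _ cs)// ltr_pM2l ?cabs_gt0.
have [l fl] := hf _ czr; exists (l * (c * 1)).
exact: (has_cderiv_comp (has_cderivZ c (has_cderiv_id z)) fl).
Qed.

Lemma cderiv_dilate rho f (c : C) z : holoD rho f -> cabs (c * z) < rho ->
  cderiv (fun z => f (c * z)) z = c * cderiv f (c * z).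
Proof.
move=> hf czr; apply: cderivE; rewrite -[c in c * cderiv _ _]mulr1 mulrC.
exact: (has_cderiv_comp (has_cderivZ c (has_cderiv_id z)) (holoD_cderiv hf czr)).
Qed.

End ComplexDerivative.

(** * Integrals of continuous functions over segments *)

Section RealIntegral.
Variable R : realType.
Local Notation C := R[i].
Local Notation cj := (@conjc R).
Local Notation mu := (@lebesgue_measure R).
Implicit Types (a b c : R) (h k : R -> R).

Lemma cont_integrable a b h : continuous h -> mu.-integrable `[a, b] (EFin \o h).
Proof.
move=> ch; apply: continuous_compact_integrable; first exact: segment_compact.
by apply: continuous_subspaceT.
Qed.
Hint Resolve cont_integrable : core.

Lemma integral_rint a b h : continuous h ->
  (\int[mu]_(t in `[a, b]) (h t)%:E)%E = (rint a b h)%:E.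
Proof. by move=> ch; rewrite /rint fineK//; exact: integrable_fin_num (cont_integrable _ _ ch). Qed.

Lemma eq_rint a b h k : (forall t, a <= t <= b -> h t = k t) -> rint a b h = rint a b k.
Proof.
move=> hk; congr fine; apply: eq_integral => t; rewrite inE/= in_itv/= => /hk ->//.
Qed.

Lemma rintD a b h k : continuous h -> continuous k ->
  rint a b (fun t => h t + k t) = rint a b h + rint a b k.
Proof. by move=> ch ck; apply: RintegralD => //; exact: cont_integrable. Qed.

Lemma rintB a b h k : continuous h -> continuous k ->
  rint a b (fun t => h t - k t) = rint a b h - rint a b k.
Proof. by move=> ch ck; apply: RintegralB => //; exact: cont_integrable. Qed.

Lemma rintZ a b c h : continuous h ->
  rint a b (fun t => c * h t) = c * rint a b h.
Proof. by move=> ch; apply: RintegralZl => //; exact: cont_integrable. Qed.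

Lemma rint_le a b h k : continuous h -> continuous k ->
  (forall t, a <= t <= b -> h t <= k t) -> rint a b h <= rint a b k.
Proof.
move=> ch ck hk; apply: le_Rintegral; try exact: cont_integrable; first by [].
by move=> t; rewrite /= in_itv/=; exact: hk.
Qed.

Lemma rint_ge0 a b h : (forall t, a <= t <= b -> 0 <= h t) -> 0 <= rint a b h.
Proof. by move=> hk; apply: Rintegral_ge0 => t; rewrite /= in_itv/=; exact: hk. Qed.

Lemma rint_abs a b h : continuous h -> `|rint a b h| <= rint a b (fun t => `|h t|).
Proof. by move=> ch; apply: le_normr_Rintegral => //; exact: cont_integrable. Qed.

Lemma rint_cst a b c : a <= b -> rint a b (fun=> c) = c * (b - a).
Proof.
move=> ab; rewrite /rint [LHS]Rintegral_cst//= lebesgue_measure_itv/= lte_fin.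
by case: ltP => //= ba; rewrite (@le_anti _ _ a b) ?ab// subrr.
Qed.

Lemma rint_degenerate a b h : b <= a -> rint a b h = 0.
Proof.
rewrite le_eqVlt => /predU1P[->|ba]; first by rewrite /rint set_itv1 integral_set1.
by rewrite /rint set_itv_ge ?integral_set0// -leNgt bnd_simp.
Qed.

Lemma rint_split a b c h : continuous h -> a <= b -> b <= c ->
  rint a c h = rint a b h + rint b c h.
Proof.
move=> ch ab bc.
have := @Rintegral_itvB _ h (BLeft a) (BRight c) b (cont_integrable _ _ ch).
rewrite !bnd_simp => /(_ ab bc).
rewrite Rintegral_itv_obnd_cbnd; last first.
  apply: integrableS (cont_integrable b c ch) => //.
  by apply: subset_itvr; rewrite bnd_simp.
by rewrite /rint -![fine _]/(Rintegral _ _ _) => <-; rewrite addrC subrK.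
Qed.

(** In [H] one of the two integrals is over an empty or one-point segment and vanishes, so [H] is
    the signed integral from 0, valid on the whole line. Its derivative at x is computed with base
    point x - 1, which changes [H] by a constant. *)
Lemma antiderivative h : continuous h ->
  exists2 H : R -> R, (forall x : R, is_derive x 1 H (h x)) &
    forall a b, a <= b -> rint a b h = H b - H a.
Proof.
move=> ch; pose H x := rint 0 x h - rint x 0 h.
have HE a b : a <= b -> rint a b h = H b - H a.
  move=> ab; rewrite /H; have [a0|a0] := leP 0 a.
    rewrite (rint_degenerate _ a0) (rint_degenerate _ (le_trans a0 ab)) !subr0.
    by rewrite (rint_split ch a0 ab) addrC addKr.
  have a0' := ltW a0.
  rewrite (rint_degenerate _ a0') sub0r opprK.
  have [b0|b0] := leP 0 b.
    by rewrite (rint_degenerate _ b0) subr0 (rint_split ch a0' b0) addrC.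
  have b0' := ltW b0.
  by rewrite (rint_degenerate _ b0') sub0r (rint_split ch ab b0') addrCA addNr addr0.
exists H => // x; pose a := x - 1.
have ax : a < x by rewrite ltrBlDr ltrDl.
pose G y := rint a y h.
have xx1 : x < x + 1 by rewrite ltrDl.
have [dG GE] := @continuous_FTC1_closed R h a x (x + 1) xx1
  (cont_integrable _ _ ch) ax (ch x).
have dG' : is_derive x 1 G (h x).
  by split; [exact: dG|rewrite -GE derive1E].
have dGc : is_derive x 1 (fun y => G y + H a) (h x).
  by apply: is_derive_eq; rewrite addr0.
apply: near_eq_is_derive dGc.
near=> y.
have ay : a <= y by rewrite ltW//; near: y; exact: lt_nbhsr.
by rewrite /G (HE _ _ ay) subrK.
Unshelve. all: by end_near. Qed.

Lemma rint_FTC a b h (H : R -> R) : continuous h ->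
  (forall x : R, is_derive x 1 H (h x)) -> a <= b -> rint a b h = H b - H a.
Proof.
move=> ch dH ab; have [G dG GE] := antiderivative ch; rewrite GE//.
have d0 (x : R) : is_derive x 1 (fun y => H y - G y) 0.
  by apply: is_derive_eq; rewrite subrr.
have := is_derive_0_is_cst (b) (a) d0.
by move=> /=; lra.
Qed.

(** For an antiderivative G, the derivative of G(y + T) - G(y) is zero by periodicity. *)
Lemma rint_period a (T : R) h : continuous h -> 0 <= T -> (forall x, h (x + T) = h x) ->
  rint a (a + T) h = rint 0 T h.
Proof.
move=> ch T0 hT; have [G dG GE] := antiderivative ch.
rewrite !GE ?lerDl//.
have d0 (x : R) : is_derive x 1 (fun y => G (y + T) - G y) 0.
  have : is_derive x 1 (fun y => G (y + T)) (h x).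
    have dxT : is_derive x 1 (fun y : R => y + T) (1 + 0).
      exact: is_deriveD.
    have := @is_derive1_comp _ G (fun y : R => y + T) x _ _ (dG (x + T)) dxT.
    by rewrite addr0 mulr1 hT.
  by move=> ?; apply: is_derive_eq; rewrite subrr.
have := is_derive_0_is_cst a 0 d0.
by rewrite /= add0r.
Qed.

End RealIntegral.
#[global] Hint Resolve cont_integrable : core.

Section ComplexIntegral.
Variable R : realType.
Local Notation C := R[i].
Local Notation cj := (@conjc R).
Implicit Types (a b : R) (h k : R -> C) (c : C).

Lemma complex_eq (z w : C) : complex.Re z = complex.Re w ->
  complex.Im z = complex.Im w -> z = w.
Proof. by case: z => ? ?; case: w => ? ? /= -> ->. Qed.

Lemma eq_cint a b h k : (forall t, a <= t <= b -> h t = k t) -> cint a b h = cint a b k.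
Proof.
by move=> hk; apply: complex_eq => /=; apply: eq_rint => t /hk ->.
Qed.

Lemma cintD a b h k : rcont h -> rcont k ->
  cint a b (fun t => h t + k t) = cint a b h + cint a b k.
Proof.
move=> [h1 h2] [k1 k2]; apply: complex_eq; rewrite raddfD/= -rintD//;
by apply: eq_rint => t _; rewrite raddfD.
Qed.

Lemma cintZ a b c h : rcont h -> cint a b (fun t => c * h t) = c * cint a b h.
Proof.
move=> [h1 h2]; apply: complex_eq.
  rewrite cReM/= -!rintZ// -rintB//; first by apply: eq_rint => t _; rewrite cReM.
  - by move=> t; apply: cvgM; [exact: cvg_cst|exact: h1].
  - by move=> t; apply: cvgM; [exact: cvg_cst|exact: h2].
rewrite cImM/= -!rintZ// -rintD//; first by apply: eq_rint => t _; rewrite cImM.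
- by move=> t; apply: cvgM; [exact: cvg_cst|exact: h2].
- by move=> t; apply: cvgM; [exact: cvg_cst|exact: h1].
Qed.

Lemma rcontZ c h : rcont h -> rcont (fun t => c * h t).
Proof. by move=> ch; apply: rcontM => //; exact: rcont_cst. Qed.

Lemma rcontN h : rcont h -> rcont (fun t => - h t).
Proof.
move=> /(rcontZ (-1)); rewrite (_ : (fun t => _) = (fun t => - h t))//.
by apply/funext => t; rewrite mulN1r.
Qed.

Lemma rcontB h k : rcont h -> rcont k -> rcont (fun t => h t - k t).
Proof. by move=> ch /rcontN; exact: rcontD. Qed.

Lemma rcont_conj h : rcont h -> rcont (fun t => (cj (h t))).
Proof. by move=> ch; apply: (rcont_comp ch) => t; exact: ccont_conj. Qed.

Lemma rcontX h n : rcont h -> rcont (fun t => h t ^+ n).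
Proof.
move=> ch; elim: n => [|n IH]; first exact: rcont_cst.
rewrite (_ : (fun t => _) = (fun t => h t * h t ^+ n)); first exact: rcontM.
by apply/funext => t; rewrite exprS.
Qed.

Lemma rcont_sum (I : Type) (r : seq I) (P : pred I) (F : I -> R -> C) :
  (forall i, rcont (F i)) -> rcont (fun t => \sum_(i <- r | P i) F i t).
Proof.
move=> cF; elim: r => [|i r IH].
  by under eq_fun do rewrite big_nil; exact: rcont_cst.
under eq_fun do rewrite big_cons; case: (P i) => //.
exact: rcontD.
Qed.

Lemma cintB a b h k : rcont h -> rcont k ->
  cint a b (fun t => h t - k t) = cint a b h - cint a b k.
Proof.
move=> ch ck; rewrite -mulN1r -cintZ// -cintD//; last exact: rcontZ.
by apply: eq_cint => t _; rewrite mulN1r.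
Qed.

Lemma cint0 a b : cint a b (fun=> 0) = 0.
Proof.
rewrite -[RHS](mul0r (cint a b (fun=> 1))) -cintZ; last exact: rcont_cst.
by apply: eq_cint => t _; rewrite mul0r.
Qed.

Lemma cint_sum (I : Type) (r : seq I) (P : pred I) (F : I -> R -> C) a b :
  (forall i, rcont (F i)) ->
  cint a b (fun t => \sum_(i <- r | P i) F i t) = \sum_(i <- r | P i) cint a b (F i).
Proof.
move=> cF; elim: r => [|i r IH].
  by under eq_fun do rewrite big_nil; rewrite big_nil cint0.
rewrite big_cons -IH; under eq_fun do rewrite big_cons; case: (P i) => //.
by rewrite cintD//; exact: rcont_sum.
Qed.

Lemma cint_real a b (h : R -> R) : cint a b (fun t => (h t)%:C) = (rint a b h)%:C.
Proof.
apply: complex_eq => //=.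
by have /(congr1 (@complex.Im R)) := cint0 a b.
Qed.

Lemma cint_cst a b c : a <= b -> cint a b (fun=> c) = (b - a)%:C * c.
Proof.
move=> ab; rewrite mulrC -[b - a]mul1r -rint_cst// -cint_real -cintZ; last exact: rcont_cst.
by apply: eq_cint => t _; rewrite mulr1.
Qed.

(* Rotating the integral onto the positive axis reduces to the real bound. *)
Lemma cabs_cint a b h : rcont h -> cabs (cint a b h) <= rint a b (fun t => cabs (h t)).
Proof.
move=> ch; have cah := rcont_cabs ch.
set w := cint a b h; have [w0|w0] := eqVneq w 0.
  by rewrite w0 cabs0; apply: rint_ge0.
have c0 : 0 < cabs w by rewrite cabs_gt0.
rewrite -(ler_pM2l c0) -expr2 -rintZ//.
have -> : cabs w ^+ 2 = complex.Re ((cj w) * w) by rewrite mulrC mul_conj.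
rewrite {2}/w -cintZ//; move: (cj w) (cabs_conj w) => cw cwE; apply: rint_le.
- by case: (rcontZ cw ch).
- by move=> t; apply: cvgM; [exact: cvg_cst|exact: cah].
move=> t _; rewrite (le_trans (ler_norm _))// (le_trans (Re_le_cabs _))//.
by rewrite cabsM cwE.
Qed.

Lemma cabs_cint_le a b h (M : R) : a <= b -> rcont h ->
  (forall t, a <= t <= b -> cabs (h t) <= M) -> cabs (cint a b h) <= M * (b - a).
Proof.
move=> ab ch hM; rewrite (le_trans (cabs_cint a b ch))// -rint_cst//.
apply: rint_le => //; first exact: rcont_cabs.
by move=> t; exact: cvg_cst.
Qed.

Lemma cint_split a b (c : R) h : rcont h -> a <= b -> b <= c ->
  cint a c h = cint a b h + cint b c h.
Proof. by move=> [h1 h2] ab bc; apply: complex_eq; rewrite raddfD/=; exact: rint_split. Qed.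

Lemma cint_expi (k : int) :
  cint 0 (2 * pi) (fun t => cexpi (k%:~R * t)) =
  (if k == 0 then (2 * pi)%:C else 0) :> C.
Proof.
have pi0 : 0 <= 2 * pi :> R by rewrite mulr_ge0// pi_ge0.
case: eqP => [->|/eqP k0].
  rewrite -[RHS]mulr1 -[in RHS](subr0 (2 * pi)) -cint_cst//.
  by apply: eq_cint => t _; rewrite mul0r cexpi0.
set K : R := k%:~R; have K0 : K != 0 by rewrite intr_eq0.
have dKx (x : R) : is_derive x 1 (fun x : R => K * x) K.
  by have := is_deriveZ K (is_derive_id x (1 : R)); rewrite /GRing.scale/= mulr1.
have E : cexpi (K * (2 * pi)) = 1 :> C.
  have X (n : nat) : cexpi (n%:R * (2 * pi)) = 1 :> C.
    by rewrite -cexpiX -[2 * pi]add0r cexpi_2pi cexpi0 expr1n.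
  rewrite /K; case: k {K K0 k0 dKx} => n; first exact: X.
  by rewrite NegzE mulrNz mulNr cexpiN X conjc1.
have cK : continuous (fun x : R => K * x).
  by move=> x; apply: cvgM; [exact: cvg_cst|exact: cvg_id].
have /= [cc cs] := rcont_re (@rcont_cexpi R) cK.
move: E => [E1 E2].
apply: complex_eq => /=.
  have dH (x : R) : is_derive x 1 (fun x => K^-1 * sin (K * x)) (cos (K * x)).
    have := @is_derive1_comp _ (@sin R) (fun x : R => K * x) x _ _ (is_derive_sin _) (dKx x).
    move=> /(is_deriveZ K^-1); rewrite /GRing.scale/= (mulrCA K^-1) mulVf// mulr1.
    exact.
  by rewrite (rint_FTC cc dH)// E2 !(mulr0, sin0) subr0.
have dH (x : R) : is_derive x 1 (fun x => - K^-1 * cos (K * x)) (sin (K * x)).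
  have := @is_derive1_comp _ (@cos R) (fun x : R => K * x) x _ _ (is_derive_cos _) (dKx x).
  move=> /(is_deriveZ (- K^-1)) H.
  by rewrite -[sin (K * x)](_ : - K^-1 *: (- sin (K * x) * K) = _)// /GRing.scale/=; field.
by rewrite (rint_FTC cs dH)// E1 mulr0 cos0 subrr.
Qed.

End ComplexIntegral.

(** * Goursat's lemma *)

Section Goursat.
Variable R : realType.
Local Notation C := R[i].
Variable H : R -> R -> C.
Hypothesis cH1 : forall t, rcont (fun s => H s t).
Hypothesis cH2 : forall s, rcont (H s).
Implicit Types x y w h : R.

(* The integral of [H] along the boundary of the rectangle with lower left
   corner (x, y), width w and height h, with opposite sides grouped. *)
Let J x y w h : C :=
  cint x (x + w) (fun s => H s y - H s (y + h)) +
  'i * cint y (y + h) (fun t => H (x + w) t - H x t).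

Let JE x y w h : J x y w h =
  cint x (x + w) (H^~ y) - cint x (x + w) (H^~ (y + h)) +
  'i * (cint y (y + h) (H (x + w)) - cint y (y + h) (H x)).
Proof. by rewrite /J !cintB. Qed.

Let half x : x / 2 + x / 2 = x. Proof. by rewrite -splitr. Qed.

Let J_split x y w h : 0 <= w -> 0 <= h ->
  J x y w h = J x y (w / 2) (h / 2) + J (x + w / 2) y (w / 2) (h / 2) +
   (J x (y + h / 2) (w / 2) (h / 2) + J (x + w / 2) (y + h / 2) (w / 2) (h / 2)).
Proof.
move=> w0 h0; rewrite !JE -!addrA !half.
have w2 : 0 <= w / 2 by rewrite divr_ge0.
have h2 : 0 <= h / 2 by rewrite divr_ge0.
have xs k : rcont k -> cint x (x + w) k = cint x (x + w / 2) k + cint (x + w / 2) (x + w) k.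
  by move=> ck; apply: cint_split; rewrite ?lerDl// lerD2l; lra.
have ys k : rcont k -> cint y (y + h) k = cint y (y + h / 2) k + cint (y + h / 2) (y + h) k.
  by move=> ck; apply: cint_split; rewrite ?lerDl// lerD2l; lra.
by rewrite !xs// !ys//; ring.
Qed.

Let J_quarter x y w h K : 0 <= w -> 0 <= h -> 4 * K <= cabs (J x y w h) ->
  exists xy : R * R, [/\ x <= xy.1, xy.1 + w / 2 <= x + w, y <= xy.2,
    xy.2 + h / 2 <= y + h & K <= cabs (J xy.1 xy.2 (w / 2) (h / 2))].
Proof.
move=> w0 h0 KJ; apply: contrapT => /forallNP N.
have n (a b : R) : x <= a -> a + w / 2 <= x + w -> y <= b -> b + h / 2 <= y + h ->
    cabs (J a b (w / 2) (h / 2)) < K.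
  by move=> *; rewrite ltNge; apply/negP => Ka; apply: (N (a, b)).
have n1 : cabs (J x y (w / 2) (h / 2)) < K by apply: n; clear N KJ; lra.
have n2 : cabs (J (x + w / 2) y (w / 2) (h / 2)) < K.
  by apply: n; clear N KJ n1; lra.
have n3 : cabs (J x (y + h / 2) (w / 2) (h / 2)) < K.
  by apply: n; clear N KJ n1 n2; lra.
have n4 : cabs (J (x + w / 2) (y + h / 2) (w / 2) (h / 2)) < K.
  by apply: n; clear N KJ n1 n2 n3; lra.
move: KJ; rewrite (J_split _ _ w0 h0).
apply/negP; rewrite -ltNge; apply: le_lt_trans (cabsD _ _) _.
apply: le_lt_trans (lerD (cabsD _ _) (cabsD _ _)) _.
have -> : 4 * K = (K + K) + (K + K) by ring.
by rewrite !ltrD.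
Qed.

Variables (x0 y0 w0 h0 : R).
Hypothesis w0_ge0 : 0 <= w0.
Hypothesis h0_ge0 : 0 <= h0.
(** Complex differentiability with increments confined to the closed rectangle: in the application
    the integrand is frozen beyond the right side and is differentiable there only from within. *)
Hypothesis dH : forall s0 t0, x0 <= s0 <= x0 + w0 -> y0 <= t0 <= y0 + h0 ->
  exists D : C, forall e : R, 0 < e -> exists2 d : R, 0 < d & forall s t,
    x0 <= s <= x0 + w0 -> y0 <= t <= y0 + h0 -> `|s - s0| < d -> `|t - t0| < d ->
    cabs (H s t - H s0 t0 - D * ((s - s0) +i* (t - t0))) <= e * (`|s - s0| + `|t - t0|).

(** Bisect and keep a quarter carrying at least a quarter of the boundary integral. *)
Let J_nested : exists xy : nat -> R * R, forall n,
  [/\ x0 <= (xy n).1, y0 <= (xy n).2,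
     (xy n).1 + w0 / 2 ^+ n <= x0 + w0 /\ (xy n).2 + h0 / 2 ^+ n <= y0 + h0,
     [/\ (xy n).1 <= (xy n.+1).1, (xy n.+1).1 + w0 / 2 ^+ n.+1 <= (xy n).1 + w0 / 2 ^+ n,
      (xy n).2 <= (xy n.+1).2 & (xy n.+1).2 + h0 / 2 ^+ n.+1 <= (xy n).2 + h0 / 2 ^+ n] &
     cabs (J x0 y0 w0 h0) / 4 ^+ n <= cabs (J (xy n).1 (xy n).2 (w0 / 2 ^+ n) (h0 / 2 ^+ n))].
Proof.
pose K n := cabs (J x0 y0 w0 h0) / 4 ^+ n.
pose good n (q : R * R) := K n <= cabs (J q.1 q.2 (w0 / 2 ^+ n) (h0 / 2 ^+ n)).
pose step n (q q' : R * R) := [/\ q.1 <= q'.1,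
  q'.1 + w0 / 2 ^+ n.+1 <= q.1 + w0 / 2 ^+ n, q.2 <= q'.2,
  q'.2 + h0 / 2 ^+ n.+1 <= q.2 + h0 / 2 ^+ n & good n.+1 q'].
have next n q : good n q -> exists q', step n q q'.
  rewrite /step /good => gq.
  have -> : w0 / 2 ^+ n.+1 = w0 / 2 ^+ n / 2 by rewrite exprSr invfM mulrA.
  have -> : h0 / 2 ^+ n.+1 = h0 / 2 ^+ n / 2 by rewrite exprSr invfM mulrA.
  apply: J_quarter; rewrite ?divr_ge0 ?exprn_ge0//.
  suff -> : 4 * K n.+1 = K n by [].
  by rewrite /K exprS; field; rewrite expf_neq0.
pose nx n q := xget q [set q' | step n q q'].
have nxP n q : good n q -> step n q (nx n q).
  by move=> /next[q' qq']; apply: (xgetPex q); exists q'.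
pose fix xy n := if n is m.+1 then nx m (xy m) else (x0, y0).
have gxy n : good n (xy n).
  elim: n => [|n IH]; first by rewrite /good /K /= !expr0 !divr1.
  by have [] := nxP _ _ IH.
exists xy; elim=> [|n [a b [c d] [s1 s2 s3 s4] _]].
  have [? ? ? ? _] := nxP _ _ (gxy 0).
  by split => //=; [rewrite !expr0 !divr1|exact: (gxy 0)].
have [? ? ? ? _] := nxP _ _ (gxy n.+1).
split; [exact: le_trans a s1|exact: le_trans b s3| |by split|exact: (gxy n.+1)].
by split; [exact: le_trans s2 c|exact: le_trans s4 d].
Qed.

Let nested_point (u l : nat -> R) : (forall n, 0 <= l n) ->
  (forall n, u n <= u n.+1 /\ u n.+1 + l n.+1 <= u n + l n) ->
  exists c, forall n, u n <= c <= u n + l n.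
Proof.
move=> l0 H1.
have mono n k : u n <= u (n + k)%N /\ u (n + k)%N + l (n + k)%N <= u n + l n.
  elim: k => [|k [a b]]; first by rewrite addn0.
  rewrite addnS; have [c d] := H1 (n + k)%N.
  by split; [exact: le_trans c|exact: le_trans b].
have ub m n : u n <= u m + l m.
  have [nm|mn] := leP n m.
    by have [+ _] := mono n (m - n)%N; rewrite subnKC// => /le_trans; apply; rewrite lerDl.
  have [_ mn'] := mono m (n - m)%N; apply: le_trans mn'.
  by rewrite subnKC ?lerDl// ltnW.
exists (sup (range u)) => n; apply/andP; split.
  by apply: ub_le_sup; [exists (u 0%N + l 0%N) => _ [m _ <-]; exact: ub|exists n].
by apply: ge_sup => [|_ [m _ <-]]; [exists (u 0%N), 0%N|exact: ub].
Qed.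

Lemma goursat_rectangle : J x0 y0 w0 h0 = 0.
Proof.
have [xy Hxy] := J_nested.
have p0 n : 0 < 2 ^+ n :> R by rewrite exprn_gt0.
have wn0 n : 0 <= w0 / 2 ^+ n by rewrite divr_ge0// ltW.
have hn0 n : 0 <= h0 / 2 ^+ n by rewrite divr_ge0// ltW.
have [s0 Hs0] := @nested_point (fun n => (xy n).1) _ wn0
  (fun n => let: And5 _ _ _ (And4 a b _ _) _ := Hxy n in conj a b).
have [t0 Ht0] := @nested_point (fun n => (xy n).2) _ hn0
  (fun n => let: And5 _ _ _ (And4 _ _ a b) _ := Hxy n in conj a b).
have inx n s : (xy n).1 <= s <= (xy n).1 + w0 / 2 ^+ n -> x0 <= s <= x0 + w0.
  by have [a _ [b _] _ _] := Hxy n => /andP[c d]; rewrite (le_trans a c) (le_trans d b).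
have iny n s : (xy n).2 <= s <= (xy n).2 + h0 / 2 ^+ n -> y0 <= s <= y0 + h0.
  by have [_ a [_ b] _ _] := Hxy n => /andP[c d]; rewrite (le_trans a c) (le_trans d b).
have [D HD] := dH (inx _ _ (Hs0 0%N)) (iny _ _ (Ht0 0%N)).
apply/eqP; rewrite -cabs_eq0 eq_le cabs_ge0 andbT; apply/ler_addgt0Pl => e' e'0.
rewrite addr0; pose S := w0 + h0 + 1; have S1 : 1 <= S by rewrite lerDr addr_ge0.
have S0 : 0 < S by rewrite (lt_le_trans _ S1).
(* Chosen so that 2 e S^2 = e'; the factor 4^n lost in the bisection is returned by (w + h)^2 = (w0
   + h0)^2 / 4^n. The 1 in [S] keeps it positive for a degenerate rectangle. *)
pose e := e' / (2 * S ^+ 2).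
have e0 : 0 < e by rewrite divr_gt0// mulr_gt0// exprn_gt0.
have [d d0 Hd] := HD e e0.
have [n Hn] : exists n, S / 2 ^+ n < d.
  have Sd0 : 0 <= S / d by rewrite divr_ge0// ltW.
  exists (Num.bound (S / d)); rewrite ltr_pdivrMr// mulrC -ltr_pdivrMr//.
  have := archi_boundP Sd0; move=> /lt_trans; apply.
  by rewrite -natrX ltr_nat ltn_expl.
set w := w0 / 2 ^+ n; set h := h0 / 2 ^+ n.
have [_ _ _ _] := Hxy n; rewrite -/w -/h.
have wd : w < d by rewrite (le_lt_trans _ Hn)// ler_pM2r ?invr_gt0// /S -addrA lerDl addr_ge0.
have hd : h < d.
  by rewrite (le_lt_trans _ Hn)// ler_pM2r ?invr_gt0// /S addrAC lerDr addr_ge0.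
have {}Hs0 := Hs0 n; have {}Ht0 := Ht0 n; have {}inx := inx n; have {}iny := iny n.
have w_ge0 : 0 <= w by exact: wn0.
have h_ge0 : 0 <= h by exact: hn0.
move: (xy n).1 (xy n).2 Hs0 Ht0 inx iny => x y; rewrite -/w -/h => Hs0 Ht0 inx iny.
have est s t : x <= s <= x + w -> y <= t <= y + h ->
    cabs (H s t - H s0 t0 - D * ((s - s0) +i* (t - t0))) <= e * (w + h).
  move=> xs yt; have ssw : `|s - s0| <= w by rewrite ler_norml; move: xs Hs0; lra.
  have tth : `|t - t0| <= h by rewrite ler_norml; move: yt Ht0; lra.
  rewrite (le_trans (Hd _ _ (inx _ xs) (iny _ yt) _ _))//.
  - exact: le_lt_trans wd.
  - exact: le_lt_trans hd.
  - by rewrite ler_pM2l// lerD.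
have diff s t s' t' : x <= s <= x + w -> y <= t <= y + h ->
    x <= s' <= x + w -> y <= t' <= y + h ->
    cabs (H s t - H s' t' - D * ((s - s') +i* (t - t'))) <= 2 * (e * (w + h)).
  move=> a b a' b'; have := est _ _ a b; have := est _ _ a' b'.
  set A := _ - _; set B := _ - _; rewrite (_ : _ - _ = B - A).
    by have := cabsD B (- A); rewrite cabsN; lra.
  rewrite /A /B.
  have -> : (s - s') +i* (t - t') = ((s - s0) +i* (t - t0)) - ((s' - s0) +i* (t' - t0)).
    by apply: complex_eq => /=; ring.
  by ring.
have JB : cabs (J x y w h) <= 2 * e * (w + h) ^+ 2.
  (* The linear part of H contributes - i h D to the horizontal integrand and w D to the vertical
     one. [k1] and [k2] remove it, and the two corrections cancel in [J] because w times i h D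
     equals i times h w D. *)
  pose k1 s := H s y - H s (y + h) + 'i * (h%:C * D).
  pose k2 t := H (x + w) t - H x t - w%:C * D.
  have ck1 : rcont k1 by apply: rcontD; [exact: rcontB|exact: rcont_cst].
  have ck2 : rcont k2 by apply: rcontB; [exact: rcontB|exact: rcont_cst].
  have -> : J x y w h = cint x (x + w) k1 + 'i * cint y (y + h) k2.
    rewrite /k1 /k2 (cintD _ _ (rcontB (cH1 y) (cH1 (y + h))) (rcont_cst _)).
    rewrite (cintB _ _ (rcontB (cH2 (x + w)) (cH2 x)) (rcont_cst _)) /J.
    rewrite !cint_cst ?lerDl// [x + w]addrC addrK [y + h]addrC addrK.
    by ring.
  have B1 : cabs (cint x (x + w) k1) <= 2 * (e * (w + h)) * (x + w - x).
    apply: cabs_cint_le => //; first by rewrite lerDl.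
    move=> s xs; have := @diff s y s (y + h) xs _ xs.
    have -> : D * ((s - s) +i* (y - (y + h))) = - ('i * (h%:C * D)).
      have -> : (s - s) +i* (y - (y + h)) = - ('i * h%:C).
        by apply: complex_eq => /=; ring.
      by ring.
    by rewrite opprK; apply; rewrite ?lexx ?lerDl ?h_ge0.
  have B2 : cabs (cint y (y + h) k2) <= 2 * (e * (w + h)) * (y + h - y).
    apply: cabs_cint_le => //; first by rewrite lerDl.
    move=> t yt; have := @diff (x + w) t x t _ yt _ yt.
    have -> : D * ((x + w - x) +i* (t - t)) = w%:C * D.
      have -> : (x + w - x) +i* (t - t) = w%:C by apply: complex_eq => /=; ring.
      by ring.
    by apply; rewrite ?lexx ?lerDl ?w_ge0.
  rewrite (le_trans (cabsD _ _))// cabsM.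
  have -> : cabs ('i : C) = 1 by rewrite cabs_sqrt/= expr0n/= add0r expr1n sqrtr1.
  rewrite mul1r; move: B1 B2; nra.
move=> /le_trans/(_ JB); rewrite ler_pdivrMr ?exprn_gt0// => /le_trans; apply.
have -> : (w + h) ^+ 2 = (w0 + h0) ^+ 2 / 4 ^+ n.
  rewrite /w /h -mulrDl expr_div_n -!exprM; congr (_ / _).
  by rewrite mulnC exprM; congr (_ ^+ _); ring.
rewrite mulrA divfK ?expf_neq0//.
have -> : e' = 2 * e * S ^+ 2 by rewrite /e; field; rewrite gt_eqF.
apply: ler_wpM2l; first by rewrite mulr_ge0// ltW.
apply: lerXn2r; rewrite ?nnegrE ?addr_ge0 ?(ltW S0)//.
by rewrite /S lerDl.
Qed.

End Goursat.

(** * The complex exponential and the independence of circle integrals from the radius *)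

Section CircleMeans.
Variable R : realType.
Local Notation C := R[i].
Implicit Types (f h : C -> C) (z w : C) (r s t : R).

Lemma derive0_bound (f : R -> R) (l : R) : is_derive (0 : R) (1 : R) f l ->
  forall e : R, 0 < e -> exists2 d : R, 0 < d &
    forall t, `|t| < d -> `|f t - f 0 - l * t| <= e * `|t|.
Proof.
move=> [df <-] e e0; move: df; rewrite /derivable => /cvgrPdist_lt/(_ _ e0).
move=> /nbhs_ballP[d /= d0 Hd]; exists d => // t td.
have [->|t0] := eqVneq t 0; first by rewrite mulr0 subr0 subrr normr0 mulr0.
have := Hd t; rewrite /ball/= sub0r normrN td => /(_ isT t0).
rewrite distrC /GRing.scale/= mulr1 addr0 => /ltW H1.
have tn : 0 < `|t| by rewrite normr_gt0.
rewrite -ler_pdivrMr// -[`|t|^-1]normfV -normrM.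
rewrite mulrBl mulfK// mulrC; exact: H1.
Qed.

Definition cexp w : C := (expR (complex.Re w))%:C * cexpi (complex.Im w).

Lemma cexpD z w : cexp (z + w) = cexp z * cexp w.
Proof.
by rewrite /cexp !raddfD/= expRD cexpiD rmorphM/=; ring.
Qed.

Lemma cabs_cexp w : cabs (cexp w) = expR (complex.Re w).
Proof. by rewrite /cexp cabsM cabs_cexpi cabsR mulr1 ger0_norm// expR_ge0. Qed.

Lemma cexp_at0 : forall e : R, 0 < e -> exists2 d : R, 0 < d &
  forall w, cabs w < d -> cabs (cexp w - 1 - w) <= e * cabs w.
Proof.
move=> e e0; pose e1 := Num.min (e / 8) 1.
have e1_gt0 : 0 < e1 by rewrite lt_min divr_gt0/=.
have [d1 d10 H1] := derive0_bound (is_derive_expR 0) e1_gt0.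
have [d2 d20 H2] := derive0_bound (is_derive_cos 0) e1_gt0.
have [d3 d30 H3] := derive0_bound (is_derive_sin 0) e1_gt0.
exists (Num.min (Num.min d1 d2) (Num.min d3 (Num.min 1 e1))).
  by rewrite 4!lt_min d10 d20 d30 ltr01 e1_gt0.
move=> [a b]; set w := a +i* b; rewrite 4!lt_min => /and4P[/andP[w1 w2] w3 w4 w5].
have aw : `|a| <= cabs w by exact: (Re_le_cabs w).
have bw : `|b| <= cabs w by exact: (Im_le_cabs w).
have {}H1 := H1 a (le_lt_trans aw w1); have {}H2 := H2 b (le_lt_trans bw w2).
have {}H3 := H3 b (le_lt_trans bw w3).
move: H1 H2 H3; rewrite expR0 cos0 sin0 oppr0 mul0r !(subr0, addr0) !mul1r => H1 H2 H3.
have e18 : e1 <= e / 8 by rewrite ge_min lexx.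
have e11 : e1 <= 1 by rewrite ge_min lexx orbT.
set N := cabs w in aw bw w1 w2 w3 w4 w5 *.
have N0 : 0 <= N by exact: cabs_ge0.
have E1 : `|expR a - 1 - a| <= e1 * N by rewrite (le_trans H1)// ler_wpM2l// ltW.
have E2 : `|cos b - 1| <= e1 * N by rewrite (le_trans H2)// ler_wpM2l// ltW.
have E3 : `|sin b - b| <= e1 * N by rewrite (le_trans H3)// ler_wpM2l// ltW.
have R1 : `|expR a * cos b - 1 - a| <= 3 * e1 * N.
  have -> : expR a * cos b - 1 - a = (expR a - 1 - a) * cos b + (1 + a) * (cos b - 1) by ring.
  rewrite (le_trans (ler_normD _ _))// !normrM.
  have c1 : `|cos b| <= 1 by exact: cos_max.
  have a2 : `|1 + a| <= 2.
    by rewrite (le_trans (ler_normD _ _))// normr1 -[leRHS]/(1 + 1) lerD2l (le_trans aw)// ltW.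
  have := ler_pM (normr_ge0 _) (normr_ge0 _) E1 c1.
  have := ler_pM (normr_ge0 _) (normr_ge0 _) a2 E2.
  rewrite mulr1; clear; lra.
have R2 : `|expR a * sin b - b| <= 5 * e1 * N.
  have -> : expR a * sin b - b = (expR a - 1) * sin b + (sin b - b) by ring.
  rewrite (le_trans (ler_normD _ _))// normrM.
  have s1 : `|sin b| <= 2 * N.
    have := ler_normD (sin b - b) b; rewrite subrK.
    have : e1 * N <= 1 * N by rewrite ler_wpM2r.
    move: E3 bw; clear; lra.
  have x1 : `|expR a - 1| <= 2 * e1.
    have := ler_normD (expR a - 1 - a) a; rewrite subrK.
    have : e1 * N <= e1 * 1 by rewrite ler_wpM2l// ltW.
    move: E1 aw w5; clear; lra.
  have := ler_pM (normr_ge0 _) (normr_ge0 _) x1 s1.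
  move: E3; clear; lra.
rewrite (le_trans (cabs_le_ReIm _))//.
have -> : complex.Re (cexp w - 1 - w) = expR a * cos b - 1 - a.
  by rewrite /w /cexp /= mul0r subr0.
have -> : complex.Im (cexp w - 1 - w) = expR a * sin b - b.
  by rewrite /w /cexp /= mul0r addr0 oppr0 addr0.
have : e1 * N <= e / 8 * N by rewrite ler_wpM2r.
move: R1 R2; clear; lra.
Qed.

Lemma has_cderiv_cexp w : has_cderiv cexp w (cexp w).
Proof.
move=> e e0; have c0 : 0 < cabs (cexp w) by rewrite cabs_cexp expR_gt0.
have e1 : 0 < e / cabs (cexp w) / 2 by rewrite !divr_gt0.
have [d d0 Hd] := cexp_at0 e1; exists d => // h /andP[h0 hd].
have hn0 : h != 0 by rewrite -cabs_gt0.
rewrite cexpD (_ : _ - _ = cexp w * (cexp h - 1 - h) / h); last by field.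
rewrite (cabsM (cexp w * _)) (cabsM (cexp w)) cabsV ltr_pdivrMr// mulrC -ltr_pdivlMr//.
apply: le_lt_trans (Hd _ hd) _.
have -> : e * cabs h / cabs (cexp w) = 2 * (e / cabs (cexp w) / 2 * cabs h).
  by field; rewrite gt_eqF.
by rewrite ltr_pMl ?ltr1n//; exact: mulr_gt0.
Qed.

(** In the coordinates z = e^(s + it) the two circles are the vertical sides of a rectangle whose
    horizontal sides cancel by periodicity. Differentiability is assumed off 0 only, so that f(z) /
    z^n is admissible. *)
Lemma circle_const (rho : R) h r1 r2 :
  (forall z, 0 < cabs z < rho -> exists l, has_cderiv h z l) ->
  0 < r1 -> r1 <= r2 -> r2 < rho ->
  cint 0 (2 * pi) (fun t => h (r1%:C * cexpi t)) =
  cint 0 (2 * pi) (fun t => h (r2%:C * cexpi t)).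
Proof.
move=> dh r10 r12 r2rho; have r20 : 0 < r2 by rewrite (lt_le_trans r10).
pose c := ln r2.
have cE : expR c = r2 by rewrite /c lnK.
(* Freezing s beyond c = ln r2 keeps every point in the punctured disc, so that the integrand is
   continuous for all s and t. *)
pose G s t := (expR (Num.min s c))%:C * cexpi t : C.
have Gabs s t : 0 < cabs (G s t) < rho.
  rewrite /G cabsM cabs_cexpi mulr1 cabsR ger0_norm ?expR_ge0// expR_gt0/=.
  by rewrite (le_lt_trans _ r2rho)// -cE ler_expR ge_min lexx orbT.
pose H s t := h (G s t).
have ch s t : ccont h (G s t).
  by have [l /has_cderiv_continuous] := dh _ (Gabs s t).
have cm : continuous (fun s : R => expR (Num.min s c)).
  move=> s; apply: continuous_comp; last exact: continuous_expR.
  by apply: (@continuous_min R R id (cst c)); [exact: cvg_id|exact: cvg_cst].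
have cH1 t : rcont (fun s => H s t).
  apply: (@rcont_comp R (fun s => G s t)) => [|s]; last exact: ch.
  by apply: rcontM; [exact: rcont_real|exact: rcont_cst].
have cH2 s : rcont (H s).
  apply: (@rcont_comp R (fun t => G s t)) => [|t]; last exact: ch.
  by apply: rcontM; [exact: rcont_cst|exact: rcont_cexpi].
have GE s t : s <= c -> G s t = cexp (s +i* t).
  by move=> sc; rewrite /G min_l.
have := @goursat_rectangle R H cH1 cH2 (ln r1) 0 (c - ln r1) (2 * pi).
have w0 : 0 <= c - ln r1 by rewrite subr_ge0 ler_ln// posrE.
have h0 : 0 <= 2 * pi :> R by rewrite mulr_ge0// pi_ge0.
move=> /(_ w0 h0); rewrite [ln r1 + _]addrC subrK add0r.
have -> : cint (ln r1) c (fun s => H s 0 - H s (2 * pi)) = 0.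
  rewrite -(cint0 (ln r1) c); apply: eq_cint => s _.
  by rewrite /H /G -(add0r (2 * pi)) cexpi_2pi subrr.
rewrite add0r => Hg.
have {Hg} : 'i * cint 0 (2 * pi) (fun t => H c t - H (ln r1) t) = 0 :> C.
  apply: Hg => s0 t0 /andP[_ s0c] _.
  have [D HD] : exists D, has_cderiv (fun w => h (cexp w)) (s0 +i* t0) D.
    have := Gabs s0 t0; rewrite GE// => /dh[l hl]; exists (l * cexp (s0 +i* t0)).
    exact: has_cderiv_comp (has_cderiv_cexp _) hl.
  exists D => e e0; have [d d0 Hd] := HD e e0.
  exists (d / 2) => [|s t /andP[_ sc] _ sd td]; first by rewrite divr_gt0.
  rewrite /H !GE//.
  pose k : C := (s - s0) +i* (t - t0).
  have kd : cabs k <= `|s - s0| + `|t - t0| by exact: cabs_le_ReIm.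
  have -> : s +i* t = (s0 +i* t0) + k by apply: complex_eq => /=; ring.
  rewrite -/k; have [->|k0] := eqVneq k 0.
    by rewrite mulr0 subr0 addr0 subrr cabs0 mulr_ge0 ?(ltW e0) ?addr_ge0.
  have kg : 0 < cabs k by rewrite cabs_gt0.
  have kd' : cabs k < d by rewrite (le_lt_trans kd)// (splitr d) ltrD.
  have := Hd k; rewrite kg kd' => /(_ isT).
  set X := h _ - h _; rewrite (_ : X / k - D = (X - D * k) / k); last by field.
  rewrite cabsM cabsV ltr_pdivrMr// => /ltW/le_trans; apply.
  by rewrite ler_wpM2l// ltW.
move=> /eqP; rewrite mulf_eq0 => /orP[/eqP/(congr1 (@complex.Im R))/= /eqP|/eqP].
  by rewrite oner_eq0.
rewrite cintB// => /eqP; rewrite subr_eq0 => /eqP E.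
have l1 : ln r1 <= c by rewrite ler_ln ?posrE.
have r1E : expR (ln r1) = r1 by rewrite lnK ?posrE.
have -> : (fun t => h (r1%:C * cexpi t)) = H (ln r1).
  by apply/funext => t; rewrite /H /G (min_l l1) r1E.
have -> : (fun t => h (r2%:C * cexpi t)) = H c.
  by apply/funext => t; rewrite /H /G (min_l (lexx c)) cE.
exact: esym E.
Qed.

End CircleMeans.

(** * Circle means and Fourier coefficients *)

Section FourierCoefficients.
Variable R : realType.
Local Notation C := R[i].
Local Notation cj := (@conjc R).
Implicit Types (h k : R -> C) (c : C) (m n : int).

Definition cmean h : C := ((2 * pi)^-1)%:C * cint 0 (2 * pi) h.
Definition rmean (h : R -> R) : R := (2 * pi)^-1 * rint 0 (2 * pi) h.
Definition ek (k : int) (t : R) : C := cexpi (k%:~R * t).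
Definition fcoef h n : C := cmean (fun t => h t * ek (- n) t).

Lemma cconjM (z w : C) : (cj (z * w)) = (cj z) * (cj w). Proof. exact: rmorphM. Qed.
Lemma cconj_sum (I : Type) (r : seq I) (P : pred I) (F : I -> C) :
  (cj (\sum_(i <- r | P i) F i)) = \sum_(i <- r | P i) (cj (F i)).
Proof. exact: rmorph_sum. Qed.
Lemma cconjB (z w : C) : (cj (z - w)) = (cj z) - (cj w). Proof. exact: rmorphB. Qed.

Lemma twopi_gt0 : 0 < 2 * pi :> R. Proof. by rewrite mulr_gt0// pi_gt0. Qed.
Hint Resolve twopi_gt0 : core.
Lemma twopi_ge0 : 0 <= 2 * pi :> R. Proof. exact: ltW. Qed.
Hint Resolve twopi_ge0 : core.

Lemma rcont_ek n : rcont (ek n).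
Proof.
apply: (@rcont_re _ (@cexpi R) (fun t => n%:~R * t)); first exact: rcont_cexpi.
by move=> t; apply: cvgM; [exact: cvg_cst|exact: cvg_id].
Qed.
Hint Resolve rcont_ek : core.

Lemma ekD m n t : ek (m + n) t = ek m t * ek n t.
Proof. by rewrite /ek intrD mulrDl cexpiD. Qed.

Lemma ekN n t : ek (- n) t = (cj (ek n t)).
Proof. by rewrite /ek mulrNz mulNr cexpiN. Qed.

Lemma ek0 t : ek 0 t = 1. Proof. by rewrite /ek mul0r cexpi0. Qed.

Lemma ek_nat (n : nat) t : ek n t = cexpi t ^+ n.
Proof. by rewrite /ek cexpiX. Qed.

Lemma cabs_ek n t : cabs (ek n t) = 1. Proof. exact: cabs_cexpi. Qed.

Lemma eq_cmean h k : h =1 k -> cmean h = cmean k.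
Proof. by move=> /funext ->. Qed.

Lemma cmeanD h k : rcont h -> rcont k -> cmean (fun t => h t + k t) = cmean h + cmean k.
Proof. by move=> ch ck; rewrite /cmean cintD// mulrDr. Qed.

Lemma cmeanB h k : rcont h -> rcont k -> cmean (fun t => h t - k t) = cmean h - cmean k.
Proof. by move=> ch ck; rewrite /cmean cintB// mulrBr. Qed.

Lemma cmeanZ c h : rcont h -> cmean (fun t => c * h t) = c * cmean h.
Proof. by move=> ch; rewrite /cmean cintZ// mulrCA. Qed.

Lemma cmean_sum (I : Type) (r : seq I) (P : pred I) (F : I -> R -> C) :
  (forall i, rcont (F i)) ->
  cmean (fun t => \sum_(i <- r | P i) F i t) = \sum_(i <- r | P i) cmean (F i).
Proof. by move=> cF; rewrite /cmean cint_sum// mulr_sumr. Qed.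

Lemma cmean_ek n : cmean (ek n) = (n == 0)%:R.
Proof.
rewrite /cmean /ek cint_expi; case: eqP => _; last by rewrite mulr0.
by rewrite -rmorphM/= mulVf// gt_eqF.
Qed.

Lemma cmean_real (h : R -> R) : cmean (fun t => (h t)%:C) = (rmean h)%:C.
Proof. by rewrite /cmean cint_real -rmorphM. Qed.

Lemma cmean_cst c : cmean (fun=> c) = c.
Proof.
rewrite /cmean cint_cst// subr0 mulrA -rmorphM/= mulVf ?gt_eqF//.
exact: mul1r.
Qed.

Lemma cmean_conj h : rcont h -> cmean (fun t => (cj (h t))) = (cj (cmean h)).
Proof.
move=> [h1 h2]; rewrite /cmean [RHS]rmorphM [X in _ = X * _]conjc_real; congr (_ * _).
apply: complex_eq => /=; first by apply: eq_rint => t _; case: (h t).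
rewrite -mulN1r -rintZ//; apply: eq_rint => t _; rewrite mulN1r.
by case: (h t).
Qed.

Lemma rmean_cst (x : R) : rmean (fun=> x) = x.
Proof. by rewrite /rmean rint_cst// subr0 mulrCA mulVf ?gt_eqF// mulr1. Qed.

Lemma rmean_ge0 (h : R -> R) : (forall t, 0 <= h t) -> 0 <= rmean h.
Proof.
by move=> h0; rewrite mulr_ge0 ?invr_ge0//; apply: rint_ge0 => t _.
Qed.

Lemma rmean_le (h k : R -> R) : continuous h -> continuous k ->
  (forall t, 0 <= t <= 2 * pi -> h t <= k t) -> rmean h <= rmean k.
Proof. by move=> ch ck hk; rewrite ler_pM2l ?invr_gt0//; exact: rint_le. Qed.

Lemma rmeanD (h k : R -> R) : continuous h -> continuous k ->
  rmean (fun t => h t + k t) = rmean h + rmean k.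
Proof. by move=> ch ck; rewrite /rmean rintD// mulrDr. Qed.

Lemma rmeanZ (x : R) (h : R -> R) : continuous h ->
  rmean (fun t => x * h t) = x * rmean h.
Proof. by move=> ch; rewrite /rmean rintZ// mulrCA. Qed.

Lemma cabs_cmean h (M : R) : rcont h -> (forall t, cabs (h t) <= M) -> cabs (cmean h) <= M.
Proof.
move=> ch hM; rewrite cabsM cabsR ger0_norm ?invr_ge0// mulrC ler_pdivrMr//.
by rewrite -[X in _ <= _ * X]subr0; apply: cabs_cint_le.
Qed.

Lemma sqr_cont (h : R -> R) : continuous h -> continuous (fun t => h t ^+ 2).
Proof. by move=> ch t; apply: cvgM; exact: ch. Qed.

(* Expanding the square: the coefficients [fcoef h (k n)] give the orthogonal
   projection of [h] on the span of the [ek (k n)]. *)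
Lemma bessel_eq h (k : nat -> int) N : rcont h -> injective k ->
  rmean (fun t => cabs (h t - \sum_(n < N) fcoef h (k n) * ek (k n) t) ^+ 2) =
  rmean (fun t => cabs (h t) ^+ 2) - \sum_(n < N) cabs (fcoef h (k n)) ^+ 2.
Proof.
move=> ch ik; pose d (n : 'I_N) := fcoef h (k n).
pose S t := \sum_(n < N) d n * ek (k n) t.
have cS : rcont S by apply: rcont_sum => n; exact: rcontZ.
pose cc := @rcont_conj R.
apply: complexI; rewrite -cmean_real.
rewrite (eq_cmean (k := fun t => h t * (cj (h t)) - h t * (cj (S t)) - (S t * (cj (h t)) - S t * (cj (S t))))); last first.
  by move=> t; rewrite -mul_conj cconjB -/(S t); ring.
have c1 : rcont (fun t => h t * (cj (h t))) by apply: rcontM => //; exact: cc.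
have c2 : rcont (fun t => h t * (cj (S t))) by apply: rcontM => //; exact: cc.
have c3 : rcont (fun t => S t * (cj (h t))) by apply: rcontM => //; exact: cc.
have c4 : rcont (fun t => S t * (cj (S t))) by apply: rcontM => //; exact: cc.
rewrite !cmeanB//; [|exact: rcontB|exact: rcontB].
have -> : cmean (fun t => h t * (cj (h t))) = (rmean (fun t => cabs (h t) ^+ 2))%:C.
  by rewrite -cmean_real; apply: eq_cmean => t; rewrite mul_conj.
have E2 : cmean (fun t => h t * (cj (S t))) = \sum_n d n * (cj (d n)).
  rewrite (eq_cmean (k := fun t => \sum_n (cj (d n)) * (h t * ek (- k n) t))); last first.
    move=> t; rewrite cconj_sum mulr_sumr; apply: eq_bigr => n _.
    by rewrite cconjM -ekN mulrCA.
  rewrite cmean_sum; last by move=> n; apply: rcontZ; exact: rcontM.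
  by apply: eq_bigr => n _; rewrite cmeanZ 1?mulrC//; exact: rcontM.
have E3 : cmean (fun t => S t * (cj (h t))) = \sum_n d n * (cj (d n)).
  rewrite (eq_cmean (k := fun t => (cj (h t * (cj (S t)))))); last first.
    by move=> t; rewrite cconjM conjcK mulrC.
  rewrite cmean_conj// E2 cconj_sum; apply: eq_bigr => n _.
  by rewrite cconjM conjcK mulrC.
have E4 : cmean (fun t => S t * (cj (S t))) = \sum_n d n * (cj (d n)).
  rewrite (eq_cmean (k := fun t => \sum_n d n * (ek (k n) t * (cj (S t))))); last first.
    by move=> t; rewrite mulr_suml; apply: eq_bigr => n _; rewrite mulrA.
  have c5 (n : 'I_N) : rcont (fun t => ek (k n) t * (cj (S t))) by apply: rcontM => //; exact: cc.
  rewrite cmean_sum; last by move=> n; exact: rcontZ.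
  apply: eq_bigr => n _; rewrite cmeanZ//; congr (_ * _).
  rewrite (eq_cmean (k := fun t => \sum_m (cj (d m)) * ek (k n - k m) t)); last first.
    move=> t; rewrite cconj_sum mulr_sumr; apply: eq_bigr => m _.
    by rewrite cconjM -ekN ekD mulrCA.
  rewrite cmean_sum; last by move=> m; exact: rcontZ.
  rewrite (bigD1 n)//= big1 ?addr0; last first.
    move=> m mn; rewrite cmeanZ// cmean_ek subr_eq0 (inj_eq ik).
    by rewrite (inj_eq val_inj) eq_sym (negbTE mn) mulr0.
  by rewrite cmeanZ// cmean_ek subrr eqxx mulr1.
rewrite E2 E3 E4 subrr subr0 rmorphB/= rmorph_sum/=; congr (_ - _).
by apply: eq_bigr => n _; rewrite mul_conj.
Qed.

Lemma bessel h (k : nat -> int) N : rcont h -> injective k ->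
  \sum_(n < N) cabs (fcoef h (k n)) ^+ 2 <= rmean (fun t => cabs (h t) ^+ 2).
Proof.
move=> ch ik; rewrite -subr_ge0 -bessel_eq//; apply: rmean_ge0 => t.
exact: sqr_ge0.
Qed.

(** Riemann-Lebesgue out of Bessel: the squares are the terms of a series with bounded partial sums.
    The injection [k] allows an approach to either end of the integers. *)
Lemma fcoef_cvg0 h (k : nat -> int) : rcont h -> injective k ->
  forall e : R, 0 < e -> exists N, forall n : nat, (N <= n)%N -> cabs (fcoef h (k n)) < e.
Proof.
move=> ch ik e e0; pose u (n : nat) := cabs (fcoef h (k n)) ^+ 2.
have cu : cvgn (series u).
  apply: nondecreasing_is_cvgn; first by apply: nondecreasing_series => n _ _; exact: sqr_ge0.
  exists (rmean (fun t => cabs (h t) ^+ 2)) => _ [n _ <-].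
  by rewrite /series/= big_mkord; exact: bessel.
have := cvg_series_cvg_0 cu => /cvgrPdist_lt/(_ (e ^+ 2)).
rewrite exprn_gt0// => /(_ isT)[N _ HN]; exists N => n Nn.
have := HN n Nn; rewrite sub0r normrN ger0_norm ?sqr_ge0//.
by rewrite /u ltr_pXn2r ?nnegrE ?cabs_ge0 ?(ltW e0).
Qed.

End FourierCoefficients.
#[global] Hint Resolve twopi_gt0 twopi_ge0 rcont_ek : core.

(** * Power series *)

Section PowerSeries.
Variable R : realType.
Local Notation C := R[i].
Local Notation cj := (@conjc R).
Implicit Types (a b : nat -> C) (f g : C -> C) (z w : C) (rho s q : R).

Definition csums a z N : C := \sum_(n < N) a n * z ^+ n.

(** Pointwise convergence only; [pser_geometric] supplies the geometric majorants from which all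
    uniform estimates are made. *)
Definition pser a f rho := forall z, cabs z < rho -> forall e : R, 0 < e ->
  exists N0, forall N, (N0 <= N)%N -> cabs (f z - csums a z N) < e.

Definition dcoef a (n : nat) : C := n.+1%:R * a n.+1.

Lemma pserS a f rho s : s <= rho -> pser a f rho -> pser a f s.
Proof. by move=> sr af z zs; apply: af; exact: lt_le_trans sr. Qed.

Lemma csumsS a z N : csums a z N.+1 = csums a z N + a N * z ^+ N.
Proof. by rewrite /csums big_ord_recr. Qed.

Lemma pser_bound a f rho s : pser a f rho -> 0 <= s -> s < rho ->
  exists2 M, 0 <= M & forall n, cabs (a n) * s ^+ n <= M.
Proof.
move=> af s0 sr; have sE : cabs (s%:C : C) = s by rewrite cabsR ger0_norm.
have [|N0 HN] := af s%:C _ 1 ltr01; first by rewrite sE.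
(* From N0 on a term is the difference of two remainders below 1, hence the 2; the sum covers the
   earlier terms. *)
exists (2 + \sum_(i < N0) cabs (a i) * s ^+ i).
  by rewrite addr_ge0// sumr_ge0// => i _; rewrite mulr_ge0// exprn_ge0.
move=> n; have [nN|nN] := ltnP n N0.
  rewrite (bigD1 (Ordinal nN))//= addrCA lerDl addr_ge0//.
  by rewrite sumr_ge0// => i _; rewrite mulr_ge0// exprn_ge0.
have -> : cabs (a n) * s ^+ n = cabs (a n * s%:C ^+ n).
  by rewrite cabsM cabsX sE.
have -> : a n * s%:C ^+ n = (f s%:C - csums a s%:C n) - (f s%:C - csums a s%:C n.+1).
  by rewrite csumsS; ring.
rewrite (le_trans (cabsD _ _))// cabsN.
have := HN n nN; have := HN n.+1 (leq_trans nN (leqnSn _)).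
have : 0 <= \sum_(i < N0) cabs (a i) * s ^+ i.
  by rewrite sumr_ge0// => i _; rewrite mulr_ge0// exprn_ge0.
by clear; lra.
Qed.

(** Bernoulli's inequality for x = t / s', with s' midway between s and t, bounds n + 1 by a
    multiple of x^n. *)
Lemma natmul_geometric s t : 0 <= s -> s < t ->
  exists2 K, 0 <= K & forall n : nat, n.+1%:R * s ^+ n <= K * t ^+ n.
Proof.
move=> s0 st; pose s' := (s + t) / 2.
have t0 : 0 < t by rewrite (le_lt_trans s0).
have ss' : s <= s' by rewrite /s'; move: st; clear; lra.
have s't : s' < t by rewrite /s'; move: st; clear; lra.
have s'0 : 0 < s' by rewrite /s'; move: s0 t0; clear; lra.
pose x := t / s'; have x1 : 0 < x - 1 by rewrite subr_gt0 /x ltr_pdivlMr// mul1r.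
have bern (n : nat) : 1 + n%:R * (x - 1) <= x ^+ n.
  elim: n => [|n IH]; first by rewrite mul0r addr0 expr0.
  have xg0 : 0 <= x by rewrite divr_ge0// ltW.
  rewrite exprS; apply: le_trans (ler_wpM2l xg0 IH).
  rewrite -natr1; have : 0 <= n%:R * (x - 1) * (x - 1) by rewrite !mulr_ge0// ltW.
  by clear; nra.
exists (1 + (x - 1)^-1); first by rewrite addr_ge0// invr_ge0 ltW.
move=> n; have -> : t ^+ n = x ^+ n * s' ^+ n by rewrite -exprMn /x divfK// gt_eqF.
rewrite mulrA ler_pM ?exprn_ge0// ?lerXn2r ?nnegrE// ?(ltW s'0)//.
have K0 : 0 <= 1 + (x - 1)^-1 by rewrite addr_ge0// invr_ge0 ltW.
apply: le_trans (ler_wpM2l K0 (bern n)).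
have -> : (1 + (x - 1)^-1) * (1 + n%:R * (x - 1)) = 1 + n%:R + (x - 1)^-1 + n%:R * (x - 1).
  by field; rewrite gt_eqF.
rewrite -nat1r; have := mulr_ge0 (ler0n R n) (ltW x1).
have : 0 <= (x - 1)^-1 by rewrite invr_ge0 ltW.
by clear; lra.
Qed.

(** Two intermediate radii s < s1 < s2 < rho: boundedness at s2 gives decay with ratio q = s1 / s2
    at s1, and the room between s and s1 absorbs the factor n + 1 of the derivative. One pair A, q
    serves both series. *)
Lemma pser_geometric a f rho s : pser a f rho -> 0 <= s -> s < rho ->
  exists A, exists q, [/\ 0 <= A, 0 <= q < 1,
    forall n, cabs (a n) * s ^+ n <= A * q ^+ n &
    forall n, cabs (dcoef a n) * s ^+ n <= A * q ^+ n].
Proof.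
move=> af s0 sr.
pose s1 := (s + rho) / 2; pose s2 := (s1 + rho) / 2.
have ss1 : s < s1 by rewrite /s1; move: sr; clear; lra.
have s12 : s1 < s2 by rewrite /s2 /s1; move: sr; clear; lra.
have s2r : s2 < rho by rewrite /s2 /s1; move: sr; clear; lra.
clearbody s2; clearbody s1.
have s10 : 0 < s1 by rewrite (le_lt_trans s0).
have s20 : 0 < s2 by rewrite (lt_trans s10).
have [M M0 HM] := pser_bound af (ltW s20) s2r.
have [K K0 HK] := natmul_geometric s0 ss1.
pose q := s1 / s2.
have q0 : 0 <= q by rewrite divr_ge0// ltW.
have q1 : q < 1 by rewrite ltr_pdivrMr// mul1r.
have Hq n : cabs (a n) * s1 ^+ n <= M * q ^+ n.
  rewrite /q expr_div_n mulrA ler_pdivlMr ?exprn_gt0//.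
  have := ler_wpM2l (exprn_ge0 n (ltW s10)) (HM n); clear; lra.
have s2i : 0 <= s2^-1 by rewrite invr_ge0 ltW.
exists (M + K * M / s2), q; split; rewrite ?q0//.
- by rewrite addr_ge0// !mulr_ge0.
- move=> n; apply: le_trans (_ : M * q ^+ n <= _).
    apply: le_trans (Hq n); rewrite ler_wpM2l// lerXn2r ?nnegrE ?(ltW s10)//.
    exact: ltW.
  by rewrite ler_wpM2r ?exprn_ge0// lerDl !mulr_ge0.
- move=> n; apply: le_trans (_ : K * M / s2 * q ^+ n <= _); last first.
    by rewrite ler_wpM2r ?exprn_ge0// lerDr.
  rewrite /dcoef cabsM cabs_nat mulrAC.
  apply: le_trans (ler_wpM2r _ (HK n)) _ => //.
  have -> : K * M / s2 * q ^+ n = K * ((M * q ^+ n.+1) / s1).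
    by rewrite exprS /q; field; rewrite !gt_eqF.
  rewrite -[K * _ * _]mulrA ler_wpM2l// ler_pdivlMr//.
  by have := Hq n.+1; rewrite exprS; clear; lra.
Qed.

Lemma geometric_tail (A q : R) (N M : nat) : 0 <= A -> 0 <= q < 1 -> (N <= M)%N ->
  \sum_(N <= n < M) A * q ^+ n <= A * q ^+ N / (1 - q).
Proof.
move=> A0 /andP[q0 q1] NM; have q1' : 0 < 1 - q by rewrite subr_gt0.
rewrite ler_pdivlMr//.
have -> : (\sum_(N <= n < M) A * q ^+ n) * (1 - q) = A * q ^+ N - A * q ^+ M.
  elim: M NM => [|M IH]; first by rewrite leqn0 => /eqP ->; rewrite big_geq// mul0r subrr.
  rewrite leq_eqVlt => /predU1P[->|]; first by rewrite big_geq// mul0r subrr.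
  rewrite ltnS => NM; rewrite big_nat_recr//= mulrDl IH// exprS; ring.
by rewrite gerBl mulr_ge0// exprn_ge0.
Qed.

Lemma geometric_small (A q e : R) : 0 <= q < 1 -> 0 < e ->
  exists N0, forall N, (N0 <= N)%N -> A * q ^+ N / (1 - q) < e.
Proof.
move=> /andP[q0 q1] e0.
have : (fun n => A / (1 - q) * q ^+ n) @ \oo --> A / (1 - q) * 0.
  by apply: cvgM; [exact: cvg_cst|apply: cvg_expr; rewrite ger0_norm].
rewrite mulr0 => /cvgrPdist_lt/(_ _ e0)[N0 _ HN]; exists N0 => N /HN.
by rewrite /= sub0r normrN => /(le_lt_trans (ler_norm _)); rewrite mulrAC.
Qed.

Lemma csums_tail a z s A q N M : cabs z <= s -> 0 <= A -> 0 <= q < 1 ->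
  (forall n, cabs (a n) * s ^+ n <= A * q ^+ n) -> (N <= M)%N ->
  cabs (csums a z M - csums a z N) <= A * q ^+ N / (1 - q).
Proof.
move=> zs A0 q01 Ha NM; have s0 : 0 <= s by rewrite (le_trans _ zs).
rewrite /csums -!(big_mkord xpredT (fun n => a n * z ^+ n)).
rewrite (big_cat_nat (leq0n N) NM)/= [X in X - _]addrC addrK.
apply: le_trans (cabs_sum _ _ _) _; apply: le_trans (geometric_tail A0 q01 NM).
apply: ler_sum => n _; rewrite cabsM cabsX; apply: le_trans (Ha n).
by rewrite ler_wpM2l// lerXn2r ?nnegrE.
Qed.

Lemma pser_tail a f rho z s A q N : pser a f rho -> cabs z <= s -> s < rho ->
  0 <= A -> 0 <= q < 1 ->
  (forall n, cabs (a n) * s ^+ n <= A * q ^+ n) ->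
  cabs (f z - csums a z N) <= A * q ^+ N / (1 - q).
Proof.
move=> af zs sr A0 q01 Ha; apply/ler_addgt0Pl => e e0.
have [N0 HN] := af z (le_lt_trans zs sr) e e0.
have := HN (maxn N0 N) (leq_maxl _ _).
have := csums_tail zs A0 q01 Ha (leq_maxr N0 N).
set S := csums a z (maxn _ _) => H1 H2.
rewrite (_ : _ - _ = (f z - S) + (S - csums a z N)); last by ring.
by rewrite (le_trans (cabsD _ _))// lerD// ltW.
Qed.

Lemma pser_exists b rho : (forall s, 0 <= s -> s < rho -> exists A, exists q,
    [/\ 0 <= A, 0 <= q < 1 & forall n, cabs (b n) * s ^+ n <= A * q ^+ n]) ->
  exists g, pser b g rho.
Proof.
move=> Hb.
have lim1 z (L : C -> R) : (forall w, `|L w| <= cabs w) -> (forall w w', L (w + w') = L w + L w') ->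
    cabs z < rho -> cvgn (fun N => L (csums b z N)).
  move=> Ln Ladd zr; have [A [q [A0 /andP[q0 q1] HA]]] := Hb _ (cabs_ge0 z) zr.
  have L0 : L 0 = 0 by have := Ln 0; rewrite cabs0 normr_le0 => /eqP.
  have E : (fun N => L (csums b z N)) = series (fun n => L (b n * z ^+ n)).
    apply/funext => N; rewrite /series/= big_mkord /csums.
    by elim/big_rec2 : _ => //= i x y _ <-; rewrite Ladd.
  rewrite E; apply: normed_cvg.
  apply: (@series_le_cvg _ _ (fun n => A * q ^+ n)) => [n|n|n|] /=.
  - exact: normr_ge0.
  - by rewrite mulr_ge0// exprn_ge0.
  - by rewrite (le_trans (Ln _))// cabsM cabsX.
  - by apply: is_cvg_geometric_series; rewrite ger0_norm.
exists (fun z => limn (fun N => complex.Re (csums b z N)) +i*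
              limn (fun N => complex.Im (csums b z N))).
move=> z zr e e0; have e2 : 0 < e / 2 by rewrite divr_gt0.
have /cvgrPdist_lt/(_ _ e2)[N1 _ H1] := lim1 z _ (@Re_le_cabs R) (raddfD (@complex.Re R)) zr.
have /cvgrPdist_lt/(_ _ e2)[N2 _ H2] := lim1 z _ (@Im_le_cabs R) (raddfD (@complex.Im R)) zr.
exists (maxn N1 N2) => N; rewrite geq_max => /andP[/H1 /= h1 /H2 /= h2].
rewrite (le_lt_trans (cabs_le_ReIm _))// (splitr e) !raddfB/=.
exact: ltrD.
Qed.

Lemma diffX_bound z h s n : h != 0 -> cabs z <= s -> cabs (z + h) <= s ->
  cabs (((z + h) ^+ n.+1 - z ^+ n.+1) / h) <= n.+1%:R * s ^+ n.
Proof.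
move=> h0 zs zhs; have s0 : 0 <= s by rewrite (le_trans _ zs).
rewrite subrXX [z + h]addrC addrK mulrAC divff// mul1r.
apply: le_trans (cabs_sum _ _ _) _.
rewrite -[X in _ <= X%:R * _](card_ord n.+1) mulr_natl -sumr_const.
apply: ler_sum => i _; rewrite cabsM !cabsX addrC.
have -> : s ^+ n = s ^+ (n.+1.-1 - i) * s ^+ i.
  by rewrite -exprD subnK//= -ltnS.
by rewrite ler_pM ?exprn_ge0// lerXn2r ?nnegrE.
Qed.

Lemma has_cderiv_csums a z N :
  has_cderiv (fun w => csums a w N.+1) z (csums (dcoef a) z N).
Proof.
elim: N => [|N IH].
  rewrite [csums _ _ 0]big_ord0.
  apply: (has_cderiv_ext _ (has_cderiv_cst (a 0%N) z)) => w.
  by rewrite /csums big_ord1 expr0 mulr1.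
have H := has_cderivZ (a N.+1) (has_cderivX N.+1 (has_cderiv_id z)).
rewrite csumsS /dcoef.
have -> : N.+1%:R * a N.+1 * z ^+ N = a N.+1 * (N.+1%:R * z ^+ N.+1.-1 * 1).
  by rewrite mulr1 mulrA [a _ * _]mulrC.
apply: (has_cderiv_ext _ (has_cderivD IH H)) => w.
by rewrite [RHS]csumsS.
Qed.

(** For a partial sum the statement is about a polynomial; the difference quotients of the tails are
    dominated, uniformly in the increment, by the geometric tail for [dcoef a]. *)
Lemma pser_cderiv_ex a f rho : pser a f rho -> exists2 g, pser (dcoef a) g rho &
  forall z, cabs z < rho -> has_cderiv f z (g z).
Proof.
move=> af; have [g dg] : exists g, pser (dcoef a) g rho.
  apply: pser_exists => s s0 sr; have [A [q [A0 q01 _ Hd]]] := pser_geometric af s0 sr.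
  by exists A, q.
exists g => // z zr e e0.
pose s := (cabs z + rho) / 2.
have zs : cabs z < s by rewrite /s; move: zr; clear; lra.
have sr : s < rho by rewrite /s; move: zr; clear; lra.
have s0 : 0 <= s by rewrite (le_trans _ (ltW zs)).
have [A [q [A0 q01 Ha Hd]]] := pser_geometric af s0 sr.
have e4 : 0 < e / 4 by rewrite divr_gt0.
have [N0 HN0] := geometric_small A q01 e4; pose N := N0.
have TN : A * q ^+ N / (1 - q) < e / 4 by exact: HN0.
have [d d0 Hpol] := has_cderiv_csums a z N e4.
exists (Num.min d (s - cabs z)); first by rewrite lt_min d0 subr_gt0.
move=> h; rewrite lt_min => /and3P[h0 hd hs].
have hn0 : h != 0 by rewrite -cabs_gt0.
have zhs : cabs (z + h) <= s.
  by rewrite (le_trans (cabsD _ _))// addrC -lerBrDr ltW.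
have {}Hpol : cabs ((csums a (z + h) N.+1 - csums a z N.+1) / h - csums (dcoef a) z N) < e / 4.
  by apply: Hpol; rewrite h0.
have H1 : cabs (g z - csums (dcoef a) z N) <= e / 4.
  by rewrite (le_trans (pser_tail N dg (ltW zs) sr A0 q01 Hd))// ltW.
have H2 : cabs ((f (z + h) - f z) / h - (csums a (z + h) N.+1 - csums a z N.+1) / h) <= e / 4.
  apply/ler_addgt0Pl => e' e'0.
  have eh : 0 < e' * cabs h / 2 by rewrite divr_gt0// mulr_gt0.
  have [M1 HM1] := af _ (le_lt_trans zhs sr) _ eh.
  have [M2 HM2] := af _ zr _ eh.
  (* M depends on the increment and on e', while N does not: the bound on the quotients of the tails
     between N and M is uniform in both. *)
  pose M := maxn N (maxn M1 M2).
  have NM : (N <= M)%N by exact: leq_maxl.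
  have MM1 : (M1 <= M.+1)%N by rewrite (leq_trans (leq_maxl M1 M2))// leqW// leq_maxr.
  have MM2 : (M2 <= M.+1)%N by rewrite (leq_trans (leq_maxr M1 M2))// leqW// leq_maxr.
  have {MM1}HM1 := HM1 _ MM1; have {MM2}HM2 := HM2 _ MM2.
  have tl : cabs ((csums a (z + h) M.+1 - csums a z M.+1) / h -
     (csums a (z + h) N.+1 - csums a z N.+1) / h) <= e / 4.
    rewrite -mulrBl.
    have -> : csums a (z + h) M.+1 - csums a z M.+1 - (csums a (z + h) N.+1 - csums a z N.+1) =
        \sum_(N <= n < M) a n.+1 * ((z + h) ^+ n.+1 - z ^+ n.+1).
      rewrite (eq_bigr (fun n => a n.+1 * (z + h) ^+ n.+1 - a n.+1 * z ^+ n.+1)); last first.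
        by move=> n _; rewrite mulrBr.
      rewrite sumrB.
      have X w : \sum_(N <= n < M) a n.+1 * w ^+ n.+1 = csums a w M.+1 - csums a w N.+1.
        rewrite /csums -!(big_mkord xpredT (fun n => a n * w ^+ n)).
        rewrite -(big_add1 _ _ N M.+1 xpredT (fun n => a n * w ^+ n)).
        by rewrite [X in _ = X - _](big_cat_nat (leq0n N.+1) (NM : (N.+1 <= M.+1)%N))/= [X in X - _]addrC addrK.
      by rewrite !X; ring.
    rewrite mulr_suml (le_trans (cabs_sum _ _ _))//.
    apply: le_trans (ltW TN); apply: le_trans (geometric_tail A0 q01 NM).
    apply: ler_sum => n _; apply: le_trans (Hd n).
    rewrite /dcoef -mulrA !cabsM -cabsM cabs_nat mulrC [_ * cabs (a _)]mulrC -mulrA.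
    rewrite mulrC ler_wpM2l//; exact: diffX_bound (ltW zs) zhs.
  set X := csums a (z + h) M.+1 in HM1 tl; set Y := csums a z M.+1 in HM2 tl.
  set Q := (_ - _) / h in tl *; set P := _ / h in tl *.
  have -> : (f (z + h) - f z) / h - P = ((f (z + h) - X) - (f z - Y)) / h + ((X - Y) / h - P).
    by rewrite /P; field.
  rewrite (le_trans (cabsD _ _))// lerD//.
  rewrite cabsM cabsV ler_pdivrMr// (le_trans (cabsD _ _))// cabsN.
  by move: HM1 HM2; clear; lra.
set P := csums (dcoef a) z N in H1 Hpol; set Q := _ / h in H2 Hpol *.
set S := (csums _ _ _ - _) / h in H2 Hpol.
have -> : Q - g z = (Q - S) + ((S - P) - (g z - P)) by ring.
rewrite (le_lt_trans (cabsD _ _))//.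
have := cabsD (S - P) (- (g z - P)); rewrite cabsN.
by move: H1 H2 Hpol e0; clear; lra.
Qed.

Lemma pser_holoD a f rho : pser a f rho -> holoD rho f.
Proof. by move=> /pser_cderiv_ex[g _ dg] z /dg fz; exists (g z). Qed.

Lemma pser_ext a f g rho : (forall z, cabs z < rho -> f z = g z) -> pser a f rho -> pser a g rho.
Proof. by move=> fg af z zr; rewrite -fg//; exact: af. Qed.

Lemma pser_cderiv a f rho : pser a f rho -> pser (dcoef a) (cderiv f) rho.
Proof.
move=> /pser_cderiv_ex[g + dg]; apply: pser_ext => z /dg fz.
by rewrite (cderivE fz).
Qed.

Lemma pser_unique a f g rho z : pser a f rho -> pser a g rho -> cabs z < rho -> f z = g z.
Proof.
move=> af ag zr; apply/eqP; rewrite -subr_eq0 -cabs_eq0 eq_le cabs_ge0 andbT.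
apply/ler_addgt0Pl => e e0; rewrite addr0.
have e2 : 0 < e / 2 by rewrite divr_gt0.
have [N1 H1] := af z zr _ e2; have [N2 H2] := ag z zr _ e2.
have {}H1 := H1 _ (leq_maxl N1 N2); have {}H2 := H2 _ (leq_maxr N1 N2).
set S := csums _ _ _ in H1 H2.
have -> : f z - g z = (f z - S) - (g z - S) by ring.
by rewrite (le_trans (cabsD _ _))// cabsN (splitr e) lerD// ltW.
Qed.

End PowerSeries.

(** * Mean value property and Taylor expansion in a disc *)

Section Taylor.
Variable R : realType.
Local Notation C := R[i].
Local Notation cj := (@conjc R).
Implicit Types (f : C -> C) (z w : C) (rho r : R).

Definition zc r t : C := r%:C * cexpi t.

Lemma cabs_zc r t : cabs (zc r t) = `|r|.
Proof. by rewrite /zc cabsM cabs_cexpi cabsR mulr1. Qed.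

Lemma zc_period r t : zc r (t + 2 * pi) = zc r t.
Proof. by rewrite /zc cexpi_2pi. Qed.

Lemma rcont_zc r : rcont (zc r).
Proof. by apply: rcontZ; exact: rcont_cexpi. Qed.

Lemma rcont_circle rho f r : holoD rho f -> 0 <= r -> r < rho -> rcont (fun t => f (zc r t)).
Proof.
move=> hf r0 rr; apply: rcont_comp; first exact: rcont_zc.
by move=> t; apply: (holoD_continuous hf); rewrite cabs_zc ger0_norm.
Qed.

Lemma circle_mean_const rho f r1 r2 :
  (forall z, 0 < cabs z < rho -> exists l, has_cderiv f z l) ->
  0 < r1 < rho -> 0 < r2 < rho ->
  cmean (fun t => f (zc r1 t)) = cmean (fun t => f (zc r2 t)).
Proof.
move=> df /andP[r10 r1r] /andP[r20 r2r]; rewrite /cmean; congr (_ * _).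
have [r12|r12] := leP r1 r2; first exact: (circle_const df).
by apply/esym; apply: (circle_const df) => //; exact: ltW.
Qed.

(** The circle mean does not depend on the radius, and by continuity it tends to f(0) on small
    circles. *)
Lemma mean_value rho f r : holoD rho f -> 0 < r < rho -> cmean (fun t => f (zc r t)) = f 0.
Proof.
move=> hf /andP[r0 rr]; apply/eqP; rewrite -subr_eq0 -cabs_eq0 eq_le cabs_ge0 andbT.
have rho0 : 0 < rho by rewrite (lt_trans r0).
apply/ler_addgt0Pl => e e0; rewrite addr0.
have c0 : cabs (0 : C) < rho by rewrite cabs0.
have [d d0 Hd] := holoD_continuous hf c0 e0.
pose r' := Num.min r (d / 2).
have r'0 : 0 < r' by rewrite lt_min r0 divr_gt0.
have r'r : r' < rho by rewrite (le_lt_trans _ rr)// ge_min lexx.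
have r'd : r' < d by rewrite gt_min orbC ltr_pdivrMr// ltr_pMr// ltr1n.
have df z : 0 < cabs z < rho -> exists l, has_cderiv f z l by move=> /andP[_ /hf].
have rr' : 0 < r < rho by rewrite r0.
have r'r' : 0 < r' < rho by rewrite r'0.
rewrite (circle_mean_const df rr' r'r') -(cmean_cst (f 0)) -cmeanB.
- apply: cabs_cmean.
    by apply: rcontB; [exact: rcont_circle hf (ltW r'0) r'r|exact: rcont_cst].
  by move=> t; apply/ltW/Hd; rewrite subr0 cabs_zc ger0_norm// ltW.
- exact: rcont_circle hf (ltW r'0) r'r.
- exact: rcont_cst.
Qed.

Lemma holoDX rho n : holoD rho (fun z : C => z ^+ n).
Proof. by move=> z _; eexists; exact: has_cderivX (has_cderiv_id z). Qed.

(** The circle mean of f(z) / z^n is independent of the radius, which yields the factor r^n. For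
    negative indices f(z) z^(n+1) is holomorphic and vanishes at 0, so its mean is zero. *)
Lemma taylor_coef rho f : 0 < rho -> holoD rho f -> exists a : nat -> C,
  forall r, 0 < r < rho -> forall n : nat,
    fcoef (fun t => f (zc r t)) n = a n * (r ^+ n)%:C /\
    fcoef (fun t => f (zc r t)) (- n.+1%:Z) = 0.
Proof.
move=> rho0 hf.
pose r0 := rho / 2; have r00 : 0 < r0 < rho.
  by rewrite divr_gt0//= ltr_pdivrMr// ltr_pMr// ltr1n.
pose h n z := f z * (z ^+ n)^-1.
exists (fun n => cmean (fun t => h n (zc r0 t))) => r rr n.
have /andP[rg rl] := rr.
have cf : rcont (fun t => f (zc r t)) by exact: rcont_circle hf (ltW rg) rl.
have rC0 : r%:C != 0 :> C by rewrite -cabs_gt0 cabsR normr_gt0 gt_eqF.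
split.
  have dh z : 0 < cabs z < rho -> exists l, has_cderiv (h n) z l.
    move=> /andP[z0 /hf[l fl]]; eexists.
    apply: (has_cderivM fl (has_cderivV _ (has_cderivX n (has_cderiv_id z)))).
    by rewrite expf_neq0// -cabs_gt0.
  rewrite (circle_mean_const dh r00 rr) mulrC -cmeanZ.
    apply: eq_cmean => t; rewrite /h /zc exprMn invfM.
    rewrite ekN /ek cexpi_conjV -cexpiX rmorphXn.
    by field; rewrite !expf_neq0// cexpi_neq0.
  rewrite /h; apply: (rcont_comp (f := h n) (rcont_zc r)) => t.
  have [|l] := dh (zc r t); first by rewrite cabs_zc ger0_norm// ltW.
  exact: has_cderiv_continuous.
have hH : holoD rho (fun z => f z * z ^+ n.+1) by apply: holoDM => //; exact: holoDX.
have := mean_value hH rr; rewrite expr0n/= mulr0.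
have -> : cmean (fun t => f (zc r t) * zc r t ^+ n.+1) =
   (r ^+ n.+1)%:C * fcoef (fun t => f (zc r t)) (- n.+1%:Z).
  rewrite -cmeanZ; last exact: rcontM.
  apply: eq_cmean => t; rewrite opprK ek_nat /zc exprMn rmorphXn/=; ring.
by move/eqP; rewrite mulf_eq0 rmorphXn/= expf_eq0/= (negbTE rC0) => /eqP.
Qed.

(** No Cauchy kernel: on the circle through z0 itself, the slope [phi] of f at z0 is continuous, and
    f = f(z0) + phi (w - z0) becomes a recursion between the Fourier coefficients c of f and d of
    [phi]. The recursion telescopes, and the remainder of the Taylor series at z0 is a Fourier
    coefficient of [phi], which tends to 0. *)
Theorem holoD_pser rho f : 0 < rho -> holoD rho f -> exists a, pser a f rho.
Proof.
move=> rho0 hf; have [a Ha] := taylor_coef rho0 hf; exists a => z0 z0r e e0.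
have r0r : 0 < rho / 2 < rho.
  by rewrite divr_gt0//= ltr_pdivrMr// ltr_pMr// ltr1n.
have [z00|z0n] := eqVneq z0 0.
  exists 1%N => -[//|N] _; rewrite /csums big_ord_recl big1 ?addr0; last first.
    by move=> i _; rewrite z00 expr0n/= mulr0.
  have [+ _] := Ha _ r0r 0%N; rewrite !expr0 !mulr1 => <-.
  rewrite /fcoef (eq_cmean (k := fun t => f (zc (rho / 2) t))); last first.
    by move=> t; rewrite oppr0 ek0 mulr1.
  by rewrite (mean_value hf r0r) z00 subrr cabs0.
pose r := cabs z0; have r0 : 0 < r by rewrite cabs_gt0.
have rr : 0 < r < rho by rewrite r0.
have rC0 : r%:C != 0 :> C by rewrite -cabs_gt0 cabsR normr_gt0 gt_eqF.
have [phi [cphi _ phiE]] : exists phi : C -> C, [/\ ccont phi z0, True &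
    forall w, f w = f z0 + phi w * (w - z0)].
  have [l /has_cderiv_slope[phi [? _ ?]]] := hf _ z0r.
  by exists phi.
have cphiT w : cabs w < rho -> ccont phi w.
  move=> wr; have [->//|wz] := eqVneq w z0.
  have cq : ccont (fun w => (f w - f z0) * (w - z0)^-1) w.
    apply: ccontM; first by apply: ccontB; [exact: holoD_continuous wr|exact: ccont_cst].
    apply: ccontV; first by rewrite subr_eq0.
    by apply: ccontB; [exact: ccont_id|exact: ccont_cst].
  move=> e' e'0; have [d d0 Hd] := cq _ e'0.
  have wz0 : 0 < cabs (w - z0) by rewrite cabs_gt0 subr_eq0.
  have E x : x != z0 -> phi x = (f x - f z0) * (x - z0)^-1.
    by move=> xz; rewrite phiE [f z0 + _]addrC addrK mulfK// subr_eq0.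
  exists (Num.min d (cabs (w - z0))) => [|x]; first by rewrite lt_min d0.
  rewrite lt_min => /andP[xd xw]; rewrite !E//; first exact: Hd.
  by apply: contraTneq xw => ->; rewrite cabsB ltxx.
have ck : rcont (fun t => phi (zc r t)).
  apply: rcont_comp; first exact: rcont_zc.
  by move=> t; apply: cphiT; rewrite cabs_zc ger0_norm// ltW.
have cfr : rcont (fun t => f (zc r t)) by exact: rcont_circle hf (ltW r0) z0r.
pose c n := fcoef (fun t => f (zc r t)) n.
pose d n := fcoef (fun t => phi (zc r t)) n.
have rec n : c n - (if n == 0 then f z0 else 0) = r%:C * d (n - 1) - z0 * d n.
  have E : c n = f z0 * cmean (ek (- n)) + (r%:C * d (n - 1) - z0 * d n).
    rewrite /c /d /fcoef -!cmeanZ; [|exact: rcontM|exact: rcontM|exact: rcont_ek].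
    rewrite -cmeanB; [|by apply: rcontZ; exact: rcontM|by apply: rcontZ; exact: rcontM].
    rewrite -cmeanD; first last.
    - by apply: rcontB; apply: rcontZ; exact: rcontM.
    - by apply: rcontZ; exact: rcont_ek.
    apply: eq_cmean => t; rewrite (phiE (zc r t)) opprB addrC ekD -/(zc r t).
    have -> : ek 1 t = cexpi t by rewrite (ek_nat 1) expr1.
    by rewrite {2}/zc; ring.
  rewrite E cmean_ek oppr_eq0; case: eqP => _; rewrite ?mulr1 ?mulr0; ring.
have dE n : fcoef (fun t => phi (zc r t)) n = d n by [].
have cE n : fcoef (fun t => f (zc r t)) n = c n by [].
clearbody c d.
pose u := z0 / r%:C.
have uE : z0 = u * r%:C by rewrite /u divfK.
have u1 : cabs u = 1 by rewrite /u cabsM cabsV cabsR ger0_norm ?(ltW r0)// divff// gt_eqF.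
(* For negative indices c vanishes, so the recursion makes |d| constant there; Riemann-Lebesgue
   forces the constant to be 0. This starts the telescoping. *)
have dm1 : d (-1) = 0.
  have dneg m : cabs (d (- m.+1%:Z)) = cabs (d (-1)).
    elim: m => [//|m IH].
    have [_ cm] := Ha _ rr m.
    have := rec (- m.+1%:Z); rewrite -cE cm.
    have -> : (- m.+1%:Z == 0) = false by rewrite oppr_eq0.
    rewrite subrr => /esym/eqP; rewrite subr_eq0 => /eqP/(congr1 (@cabs R)).
    rewrite !cabsM cabsR ger0_norm ?(ltW r0)// -/r => /(mulfI (lt0r_neq0 r0)).
    rewrite IH => <-; congr (cabs (d _)); rewrite -opprD; congr (- _).
    by rewrite -[1]/(1%:Z) -PoszD addn1.
  apply/eqP; rewrite -cabs_eq0 eq_le cabs_ge0 andbT; apply/ler_addgt0Pl => e' e'0.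
  rewrite addr0; have ik : injective (fun m : nat => - m.+1%:Z).
    by move=> x y /eqP; rewrite eqr_opp eqz_nat eqSS => /eqP.
  have [N HN] := fcoef_cvg0 ck ik e'0.
  by rewrite -(dneg N) -dE ltW// HN.
(* The telescoped recursion, with u = z0 / r of modulus 1. *)
have sums N : csums a z0 N.+1 - f z0 = - (r%:C * u ^+ N.+1 * d N).
  elim: N => [|N IH].
    have [c0 _] := Ha _ rr 0%N; have := rec 0; rewrite eqxx sub0r dm1 mulr0 sub0r.
    rewrite -cE c0 expr0 mulr1 csumsS /csums big_ord0 add0r expr0 mulr1 => ->.
    by rewrite expr1 uE; ring.
  rewrite csumsS addrAC IH.
  have [cN _] := Ha _ rr N.+1; have := rec N.+1%:Z.
  rewrite -cE cN/= subr0 intS [1 + _]addrC addrK => HH.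
  have -> : a N.+1 * z0 ^+ N.+1 = u ^+ N.+1 * (a N.+1 * (r ^+ N.+1)%:C).
    by rewrite uE exprMn rmorphXn/=; ring.
  rewrite HH uE [u ^+ N.+2]exprS.
  have -> : d (N%:Z + 1) = d N.+1 by rewrite intS addrC.
  by ring.
have ik : injective (fun n : nat => n%:Z) by move=> x y [].
have er : 0 < e / r by rewrite divr_gt0.
have [N0 HN] := fcoef_cvg0 ck ik er.
exists N0.+1 => -[//|N] NN; rewrite cabsB sums cabsN !cabsM cabsX u1 expr1n mulr1.
rewrite cabsR ger0_norm ?(ltW r0)// mulrC -ltr_pdivlMr// -dE.
exact: HN.
Qed.

End Taylor.

(** * Square means and Littlewood-Paley comparison *)

Section Parseval.
Variable R : realType.
Local Notation C := R[i].
Local Notation cj := (@conjc R).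
Implicit Types (a : nat -> C) (f g h u v : C -> C) (z w : C) (rho r s : R).

Definition m2 f r : R := rmean (fun t => cabs (f (zc r t)) ^+ 2).
Definition ps2 a r N : R := \sum_(n < N) (cabs (a n) * r ^+ n) ^+ 2.

Lemma m2_ge0 f r : 0 <= m2 f r.
Proof. by apply: rmean_ge0 => t; exact: sqr_ge0. Qed.

Lemma continuous_m2 (h : R -> C) : rcont h -> continuous (fun t => cabs (h t) ^+ 2).
Proof. by move=> /rcont_cabs; exact: sqr_cont. Qed.

Lemma csums_zc a r t N : csums a (zc r t) N = \sum_(n < N) (a n * (r ^+ n)%:C) * ek n t.
Proof.
apply: eq_bigr => n _; rewrite /zc exprMn ek_nat mulrA.
by rewrite (rmorphXn (real_complex R)).
Qed.

Lemma rcont_csums a r N : rcont (fun t => csums a (zc r t) N).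
Proof. by apply: rcont_sum => n; apply: rcontZ; apply: rcontX; exact: rcont_zc. Qed.

Lemma fcoef_pser a f rho r (n : nat) : pser a f rho -> 0 <= r -> r < rho ->
  fcoef (fun t => f (zc r t)) n = a n * (r ^+ n)%:C.
Proof.
move=> af r0 rr; apply/eqP; rewrite -subr_eq0 -cabs_eq0 eq_le cabs_ge0 andbT.
apply/ler_addgt0Pl => e e0; rewrite addr0.
have [A [q [A0 q01 Ha _]]] := pser_geometric af r0 rr.
have [N0 HN] := geometric_small A q01 e0.
pose N := maxn N0 n.+1.
have cf : rcont (fun t => f (zc r t)) := rcont_circle (pser_holoD af) r0 rr.
have cS := rcont_csums a r N.
have -> : a n * (r ^+ n)%:C = cmean (fun t => csums a (zc r t) N * ek (- n%:Z) t).
  rewrite (eq_cmean (k := fun t => \sum_(m < N) (a m * (r ^+ m)%:C) * ek (m%:Z - n%:Z) t)); last first.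
    by move=> t; rewrite csums_zc mulr_suml; apply: eq_bigr => m _; rewrite ekD mulrA.
  rewrite cmean_sum; last by move=> m; exact: rcontZ.
  have nN : (n < N)%N by exact: leq_maxr.
  rewrite (bigD1 (Ordinal nN))//= big1 ?addr0; last first.
    move=> m mn; rewrite cmeanZ// cmean_ek subr_eq0 eqz_nat.
    by rewrite -[m == n :> nat]/(m == Ordinal nN) (negbTE mn) mulr0.
  by rewrite cmeanZ// cmean_ek subrr eqxx mulr1.
rewrite /fcoef -cmeanB; [|exact: rcontM|exact: rcontM].
apply: cabs_cmean; first by apply: rcontB; exact: rcontM.
move=> t; rewrite -mulrBl cabsM cabs_ek mulr1.
have zr : cabs (zc r t) <= r by rewrite cabs_zc ger0_norm.
by apply: (le_trans (pser_tail N af zr rr A0 q01 Ha)); rewrite ltW// HN// leq_maxl.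
Qed.

Lemma parseval a f rho r s A q N : pser a f rho -> 0 <= r -> r <= s -> s < rho ->
  0 <= A -> 0 <= q < 1 -> (forall n, cabs (a n) * s ^+ n <= A * q ^+ n) ->
  ps2 a r N <= m2 f r <= ps2 a r N + (A * q ^+ N / (1 - q)) ^+ 2.
Proof.
move=> af r0 rs sr A0 q01 Ha; have rr := le_lt_trans rs sr.
have cf : rcont (fun t => f (zc r t)) := rcont_circle (pser_holoD af) r0 rr.
have ik : injective (fun n : nat => n%:Z) by move=> x y [].
have := bessel_eq N cf ik.
have -> : \sum_(n < N) cabs (fcoef (fun t => f (zc r t)) n) ^+ 2 = ps2 a r N.
  apply: eq_bigr => n _; rewrite (fcoef_pser n af r0 rr) cabsM cabsR.
  by rewrite (ger0_norm (exprn_ge0 n r0)).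
rewrite -/(m2 f r); set E := rmean _ => EE.
have E0 : 0 <= E by apply: rmean_ge0 => t; exact: sqr_ge0.
have E1 : E <= (A * q ^+ N / (1 - q)) ^+ 2.
  rewrite -[leRHS]rmean_cst; apply: rmean_le.
  - apply: continuous_m2; apply: rcontB => //.
    by apply: rcont_sum => n; exact: rcontZ.
  - by move=> t; exact: cvg_cst.
  move=> t _; apply: lerXn2r; rewrite ?nnegrE//.
    have /andP[q0 q1] := q01.
    by rewrite divr_ge0 ?mulr_ge0 ?exprn_ge0// subr_ge0 ltW.
  have zr : cabs (zc r t) <= s by rewrite cabs_zc ger0_norm.
  have := pser_tail N af zr sr A0 q01 Ha; rewrite csums_zc.
  by under eq_bigr do rewrite -(fcoef_pser _ af r0 rr).
by move: E0 E1 EE; clear; lra.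
Qed.

Lemma ps2_le_m2 a f rho r N : pser a f rho -> 0 <= r -> r < rho -> ps2 a r N <= m2 f r.
Proof.
move=> af r0 rr; have [A [q [A0 q01 Ha _]]] := pser_geometric af r0 rr.
by have /andP[] := parseval N af r0 (lexx r) rr A0 q01 Ha.
Qed.

Lemma m2_le_ps2 a f rho r K : pser a f rho -> 0 <= r -> r < rho ->
  (forall N, ps2 a r N <= K) -> m2 f r <= K.
Proof.
move=> af r0 rr HK; have [A [q [A0 q01 Ha _]]] := pser_geometric af r0 rr.
apply/ler_addgt0Pl => e e0.
(* The error is T^2; capping T at 1 as well gives T^2 <= T <= e. *)
pose e' := Num.min 1 e; have e'0 : 0 < e' by rewrite lt_min ltr01.
have [N HN] := geometric_small A q01 e'0; have {}HN := HN N (leqnn N).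
have /andP[_] := parseval N af r0 (lexx r) rr A0 q01 Ha; set T := _ / _ in HN * => H.
have T0 : 0 <= T.
  by have /andP[q0 q1] := q01; rewrite divr_ge0 ?mulr_ge0 ?exprn_ge0// subr_ge0 ltW.
have T1 : T <= 1 by rewrite (le_trans (ltW HN))// ge_min lexx.
have Te : T <= e by rewrite (le_trans (ltW HN))// ge_min lexx orbT.
rewrite (le_trans H)// addrC lerD//.
by rewrite expr2 (le_trans (ler_piMl T0 T1)).
Qed.

(** Applied to partial sums, which stay continuous at radius 1 where the function itself has no
    values. *)
Lemma le_left1 (P : R -> R) (V : R) : continuous P ->
  (forall r, 0 < r < 1 -> P r <= V) -> P 1 <= V.
Proof.
move=> cP HP; apply/ler_addgt0Pr => e e0.
have /cvgrPdist_lt/(_ _ e0)/nbhs_ballP[d /= d0 Hd] := cP 1.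
pose r : R := 1 - Num.min (d / 2) (2^-1).
have m0 : 0 < Num.min (d / 2) (2^-1) :> R by rewrite lt_min divr_gt0//= invr_gt0.
have m1 : Num.min (d / 2) (2^-1) <= 2^-1 :> R by rewrite ge_min lexx orbT.
have md : Num.min (d / 2) (2^-1) <= d / 2 :> R by rewrite ge_min lexx.
have r01 : 0 < r < 1 by rewrite /r; move: m0 m1; clear; lra.
have := Hd r; rewrite /ball/=.
have -> : 1 - r = Num.min (d / 2) (2^-1) by rewrite /r opprB addrC subrK.
rewrite ger0_norm ?(ltW m0)// => /(_ _)/wrap[].
  by rewrite (le_lt_trans md)// ltr_pdivrMr// ltr_pMr// ltr1n.
move=> /(le_lt_trans (ler_norm _)).
by have := HP r r01; clear; lra.
Qed.

Lemma ps2_at1 a N : ps2 a 1 N = \sum_(n < N) cabs (a n) ^+ 2.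
Proof. by apply: eq_bigr => n _; rewrite expr1n mulr1. Qed.

Lemma ps2_mono a r s N : 0 <= r -> r <= s -> ps2 a r N <= ps2 a s N.
Proof.
move=> r0 rs; apply: ler_sum => n _; apply: lerXn2r; rewrite ?nnegrE ?mulr_ge0//;
  rewrite ?exprn_ge0// ?(le_trans r0)//.
by rewrite ler_wpM2l// lerXn2r ?nnegrE ?(le_trans r0).
Qed.

Lemma continuous_sum (I : Type) (l : seq I) (F : I -> R -> R) :
  (forall i, continuous (F i)) -> continuous (fun x : R => \sum_(i <- l) F i x).
Proof.
move=> cF; elim: l => [|i l IH] x.
  by under eq_fun do rewrite big_nil; exact: cvg_cst.
by under eq_fun do rewrite big_cons; apply: cvgD; [exact: cF|exact: IH].
Qed.

Lemma continuous_ps2 a N : continuous (fun r => ps2 a r N).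
Proof.
apply: continuous_sum => n; apply: sqr_cont => x.
by apply: cvgM; [exact: cvg_cst|exact: exprn_continuous].
Qed.

Lemma sum_coef_le a f (V : R) N : pser a f 1 -> (forall r, 0 < r < 1 -> m2 f r <= V) ->
  \sum_(n < N) cabs (a n) ^+ 2 <= V.
Proof.
move=> af HV; rewrite -ps2_at1; apply: (le_left1 (P := fun r => ps2 a r N)).
  exact: continuous_ps2.
move=> r r01; apply: le_trans (HV r r01); apply: (ps2_le_m2 _ af); first by rewrite ltW//;
  case/andP: r01.
by case/andP: r01.
Qed.

End Parseval.

(** * Littlewood-Paley: weighted means of the derivative *)

Section LittlewoodPaley.
Variable R : realType.
Local Notation C := R[i].
Implicit Types (a b : nat -> C) (f g h u v : C -> C) (z w : C) (rho r s : R).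

(** The radial density of (1 - |z|^2) dA. *)
Definition lpw (r : R) : R := 2 * r * (1 - r ^+ 2).

(** The integral over [0, s] of [lpw] r times r^(2n); at s = 1 it is 1 / ((n+1)(n+2)). *)
Definition lpm (n : nat) (s : R) : R :=
  s ^+ n.+1.*2 / n.+1%:R - s ^+ n.+2.*2 / n.+2%:R.

Lemma continuous_lpw : continuous lpw.
Proof.
move=> x; apply: cvgM; first by apply: cvgM; [exact: cvg_cst|exact: cvg_id].
by apply: cvgB; [exact: cvg_cst|exact: exprn_continuous].
Qed.

Lemma lpw_ge0 r : 0 <= r <= 1 -> 0 <= lpw r.
Proof.
move=> /andP[r0 r1]; rewrite /lpw mulr_ge0 ?mulr_ge0// subr_ge0.
by rewrite exprn_ile1.
Qed.

Lemma is_derive_pow (n : nat) (x : R) : is_derive x 1 (fun s => s ^+ n) (n%:R * x ^+ n.-1).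
Proof.
have := is_deriveX n (is_derive_id x (1 : R)).
by rewrite exprfctE /GRing.scale/= mulr1.
Qed.

Lemma is_derive_cM (f : R -> R) (c x l : R) : is_derive x 1 f l ->
  is_derive x 1 (fun s => c * f s) (c * l).
Proof. by move=> /(is_deriveZ c); rewrite /GRing.scale. Qed.

Lemma is_derive_lpm n (x : R) : is_derive x 1 (lpm n) (lpw x * (x ^+ n) ^+ 2).
Proof.
have H (m : nat) : is_derive x 1 (fun s => s ^+ m.+1.*2 / m.+1%:R : R) (2 * x ^+ m.*2.+1).
  have := is_derive_cM (m.+1%:R^-1) (is_derive_pow m.+1.*2 x).
  rewrite (_ : _ * (_ * _) = 2 * x ^+ m.*2.+1).
    by under [X in is_derive _ _ X _ -> _]eq_fun do rewrite mulrC.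
  by rewrite -[in m.+1.*2%:R]muln2 natrM doubleS/=; field; rewrite nat1r pnatr_eq0.
have := is_deriveB (H n) (H n.+1).
rewrite (_ : _ - _ = lpw x * (x ^+ n) ^+ 2)//.
by rewrite /lpw -exprM muln2 doubleS !exprS; ring.
Qed.

Lemma rint_sum (I : Type) (l : seq I) (F : I -> R -> R) x y :
  (forall i, continuous (F i)) ->
  rint x y (fun t => \sum_(i <- l) F i t) = \sum_(i <- l) rint x y (F i).
Proof.
move=> cF; elim: l => [|i l IH].
  under eq_fun do rewrite big_nil; rewrite big_nil.
  rewrite -[RHS](mul0r (rint x y (fun=> 1))) -rintZ; last by move=> t; exact: cvg_cst.
  by apply: eq_rint => t _; rewrite mul0r.
rewrite big_cons -IH -rintD//; last exact: continuous_sum.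
by under eq_fun do rewrite big_cons.
Qed.

Lemma continuous_lpw_pow n : continuous (fun r => lpw r * (r ^+ n) ^+ 2).
Proof.
by move=> x; apply: cvgM; [exact: continuous_lpw|exact: (sqr_cont (@exprn_continuous R n))].
Qed.

Lemma rint_lpw_mono n s : 0 <= s -> rint 0 s (fun r => lpw r * (r ^+ n) ^+ 2) = lpm n s.
Proof.
move=> s0; rewrite (rint_FTC _ (is_derive_lpm n) s0).
  by rewrite {2}/lpm doubleS doubleS !expr0n/= !mul0r subrr subr0.
exact: continuous_lpw_pow.
Qed.

Lemma lpm1 n : lpm n 1 = (n.+1%:R * n.+2%:R)^-1.
Proof.
rewrite /lpm !expr1n -[in n.+2%:R]natr1.
have h1 : n.+1%:R != 0 :> R by rewrite pnatr_eq0.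
have h2 : n.+1%:R + 1 != 0 :> R by rewrite natr1 pnatr_eq0.
by move: (n.+1%:R) h1 h2 => x h1 h2; field; rewrite h1 h2.
Qed.

Lemma lpm_le1 n s : 0 <= s <= 1 -> lpm n s <= (n.+1%:R * n.+2%:R)^-1.
Proof.
move=> /andP[s0 s1]; rewrite -lpm1 -!rint_lpw_mono//.
rewrite (rint_split (@continuous_lpw_pow n) s0 s1) lerDl; apply: rint_ge0 => t /andP[st t1].
by rewrite mulr_ge0 ?sqr_ge0// lpw_ge0// t1 (le_trans s0).
Qed.

Lemma rint_lpw_ps2 a N s : 0 <= s ->
  rint 0 s (fun r => lpw r * ps2 a r N) = \sum_(n < N) cabs (a n) ^+ 2 * lpm n s.
Proof.
move=> s0.
rewrite (eq_rint (k := fun r => \sum_(n < N) cabs (a n) ^+ 2 * (lpw r * (r ^+ n) ^+ 2))); last first.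
  by move=> r _; rewrite mulr_sumr; apply: eq_bigr => n _; rewrite exprMn mulrCA.
rewrite rint_sum => [|n]; last first.
  by move=> x; apply: cvgM; [exact: cvg_cst|exact: continuous_lpw_pow].
apply: eq_bigr => n _; rewrite rintZ ?rint_lpw_mono//.
exact: continuous_lpw_pow.
Qed.

Lemma dcoef_lpm_le a n s : 0 <= s <= 1 -> cabs (dcoef a n) ^+ 2 * lpm n s <= cabs (a n.+1) ^+ 2.
Proof.
move=> s01; apply: le_trans (ler_wpM2l (sqr_ge0 _) (lpm_le1 n s01)) _.
rewrite /dcoef cabsM cabs_nat exprMn mulrAC ler_piMl ?sqr_ge0//.
rewrite ler_pdivrMr ?mulr_gt0// mul1r expr2 ler_wpM2l// ler_nat//.
Qed.

(** Termwise, (n+1)^2 / ((n+1)(n+2)) <= 1 turns the weighted integral of the derivative into a sum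
    of squared coefficients. The majorant [P], a partial sum plus a squared tail bound, is
    continuous in r and can be integrated and compared directly. *)
Lemma lp_upper a h (V s e : R) : pser a h 1 -> (forall r, 0 < r < 1 -> m2 h r <= V) ->
  0 <= s -> s < 1 -> 0 < e -> exists P : R -> R, [/\ continuous P,
    forall r, 0 <= r <= s -> m2 (cderiv h) r <= P r &
    rint 0 s (fun r => lpw r * P r) <= V + e].
Proof.
move=> ah HV s0 s1 e0.
have dh := pser_cderiv ah.
have [A [q [A0 q01 _ Hd]]] := pser_geometric ah s0 s1.
pose e' := Num.min 1 e; have e'0 : 0 < e' by rewrite lt_min ltr01.
have [N HN] := geometric_small A q01 e'0; have {}HN := HN N (leqnn N).
set T := _ / _ in HN.
have T0 : 0 <= T.
  by have /andP[q0 q1] := q01; rewrite divr_ge0 ?mulr_ge0 ?exprn_ge0// subr_ge0 ltW.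
have T1 : T <= 1 by rewrite (le_trans (ltW HN))// ge_min lexx.
have Te : T <= e by rewrite (le_trans (ltW HN))// ge_min lexx orbT.
have T2 : T ^+ 2 <= e by rewrite expr2 (le_trans (ler_piMl T0 T1)).
exists (fun r => ps2 (dcoef a) r N + T ^+ 2); split.
- by move=> x; apply: cvgD; [exact: continuous_ps2|exact: cvg_cst].
- move=> r /andP[r0 rs].
  by have /andP[] := parseval N dh r0 rs s1 A0 q01 Hd.
have s01 : 0 <= s <= 1 by rewrite s0 ltW.
have cP : continuous (fun r => lpw r * ps2 (dcoef a) r N).
  by move=> x; apply: cvgM; [exact: continuous_lpw|exact: continuous_ps2].
rewrite (eq_rint (k := fun r => lpw r * ps2 (dcoef a) r N + T ^+ 2 * (lpw r * (r ^+ 0) ^+ 2)));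
  last first.
  by move=> r _; rewrite expr0 expr1n; ring.
rewrite rintD//; last first.
  by move=> x; apply: cvgM; [exact: cvg_cst|exact: continuous_lpw_pow].
rewrite rintZ ?rint_lpw_ps2 ?rint_lpw_mono//; last exact: continuous_lpw_pow.
apply: lerD.
  apply: le_trans (sum_coef_le N.+1 ah HV).
  rewrite big_ord_recl/= -[leLHS]add0r lerD ?sqr_ge0//.
  by apply: ler_sum => n _; exact: dcoef_lpm_le.
apply: le_trans T2; rewrite ler_piMr ?sqr_ge0//.
by apply: le_trans (lpm_le1 0 s01) _; rewrite mul1r invf_le1 ?ler1n ?ltr0n.
Qed.

Lemma continuous_lpm n : continuous (lpm n).
Proof.
move=> x; apply: cvgB; (apply: cvgM; last exact: cvg_cst); exact: exprn_continuous.
Qed.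

(* Both sides are compared through their circle means, integrated against
   the weight [lpw]. *)
Lemma lp_compare a b u v (G V : R) : pser a u 1 -> pser b v 1 ->
  (forall z, cabs z < 1 -> cabs (cderiv u z) <= G * cabs (cderiv v z)) ->
  (forall r, 0 < r < 1 -> m2 v r <= V) ->
  forall N, \sum_(n < N) cabs (a n.+1) ^+ 2 <= 2 * G ^+ 2 * V.
Proof.
move=> au bv uv HV N.
have du := pser_cderiv au; have dv := pser_cderiv bv.
have step s : 0 < s < 1 -> \sum_(n < N) cabs (dcoef a n) ^+ 2 * lpm n s <= G ^+ 2 * V.
  move=> /andP[s0 s1]; apply/ler_addgt0Pr => e e0.
  (* Dividing by G^2 + 1 instead of G^2 covers G = 0. *)
  have G1 : 0 < G ^+ 2 + 1 by rewrite ltr_wpDl// sqr_ge0.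
  have eG : 0 < e / (G ^+ 2 + 1) by rewrite divr_gt0.
  have [P [cP HP iP]] := lp_upper bv HV (ltW s0) s1 eG.
  rewrite -rint_lpw_ps2; last exact: ltW.
  apply: le_trans (_ : G ^+ 2 * rint 0 s (fun r => lpw r * P r) <= _); last first.
    apply: le_trans (ler_wpM2l (sqr_ge0 G) iP) _; rewrite mulrDr lerD2l mulrCA ler_piMr ?(ltW e0)//.
    by rewrite ler_pdivrMr// mul1r lerDl.
  have cW : continuous (fun r => lpw r * P r).
    by move=> x; apply: cvgM; [exact: continuous_lpw|exact: cP].
  rewrite -rintZ//; apply: rint_le.
  - by move=> x; apply: cvgM; [exact: continuous_lpw|exact: continuous_ps2].
  - by move=> x; apply: cvgM; [exact: cvg_cst|exact: cW].
  move=> r /andP[r0 rs]; have r1 := le_lt_trans rs s1.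
  rewrite mulrCA; apply: ler_wpM2l; first by rewrite lpw_ge0// r0 ltW.
  apply: le_trans (ps2_le_m2 _ du r0 r1) _.
  have cu : rcont (fun t => cderiv u (zc r t)) := rcont_circle (pser_holoD du) r0 r1.
  have cv : rcont (fun t => cderiv v (zc r t)) := rcont_circle (pser_holoD dv) r0 r1.
  apply: le_trans (_ : G ^+ 2 * m2 (cderiv v) r <= _); last first.
    by rewrite ler_wpM2l ?sqr_ge0// HP// r0.
  rewrite /m2 -rmeanZ; last exact: continuous_m2.
  apply: rmean_le; first exact: continuous_m2.
    by move=> x; apply: cvgM; [exact: cvg_cst|exact: continuous_m2].
  move=> t _; rewrite -exprMn; apply: lerXn2r; rewrite ?nnegrE//.
    by apply: le_trans (uv (zc r t) _) => //; rewrite cabs_zc ger0_norm.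
  by apply: uv; rewrite cabs_zc ger0_norm.
have := le_left1 (P := fun s => \sum_(n < N) cabs (dcoef a n) ^+ 2 * lpm n s) _ step.
move=> /(_ _)/wrap[].
  apply: continuous_sum => n x; apply: cvgM; [exact: cvg_cst|exact: continuous_lpm].
move=> H; rewrite -mulrA; apply: le_trans (ler_wpM2l (ler0n R 2) H).
rewrite mulr_sumr; apply: ler_sum => n _.
rewrite lpm1 /dcoef cabsM cabs_nat exprMn.
(* The factor 2 of the statement: (n+1)^2 / ((n+1)(n+2)) is at least 1/2, while for [v] it was only
   bounded above by 1. *)
have -> : 2 * (n.+1%:R ^+ 2 * cabs (a n.+1) ^+ 2 / (n.+1%:R * n.+2%:R)) =
   (2 * n.+1%:R / n.+2%:R) * cabs (a n.+1) ^+ 2 :> R.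
  have h1 : n.+1%:R != 0 :> R by rewrite pnatr_eq0.
  have h2 : n.+2%:R != 0 :> R by rewrite pnatr_eq0.
  by move: (n.+1%:R) (n.+2%:R) h1 h2 => x y h1 h2; field; rewrite h1 h2.
rewrite ler_peMl ?sqr_ge0// ler_pdivlMr// mul1r -natrM ler_nat.
by rewrite mul2n -addnn addSn ltnS leq_addl.
Qed.

End LittlewoodPaley.

(** * The kernel 1 / (1 - conj(a) z) *)

Section Kernel.
Variable R : realType.
Local Notation C := R[i].
Local Notation cj := (@conjc R).
Implicit Types (a b z w : C) (f g h u v : C -> C) (rho r s d : R).

(** The Szegoe kernel; its square modulus times 1 - |a|^2 is the Poisson kernel on the unit
    circle. *)
Definition ker a z : C := (1 - cj a * z)^-1.

Lemma ker_den_ge a z : 1 - cabs a * cabs z <= cabs (1 - cj a * z).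
Proof.
have := cabs_triB (1 : C) (cj a * z); rewrite cabs1 cabsM cabs_conj.
exact.
Qed.

Lemma ker_den_neq0 a z : cabs a * cabs z < 1 -> 1 - cj a * z != 0.
Proof.
by move=> az; rewrite -cabs_gt0 (lt_le_trans _ (ker_den_ge a z))// subr_gt0.
Qed.

Lemma has_cderiv_ker a z : cabs a * cabs z < 1 ->
  has_cderiv (ker a) z (cj a * ker a z ^+ 2).
Proof.
move=> /ker_den_neq0 d0.
have H := has_cderivB (has_cderiv_cst 1 z) (has_cderivZ (cj a) (has_cderiv_id z)).
have := @has_cderivV R (fun w => 1 - cj a * w) z _ d0 H.
rewrite (_ : - _ * _ = cj a * ker a z ^+ 2)//.
by rewrite /ker exprVn mulr1 sub0r mulrNN mulrC.
Qed.

Lemma holoD_ker a rho : cabs a * rho <= 1 -> holoD rho (ker a).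
Proof.
move=> ar z zr; exists (cj a * ker a z ^+ 2); apply: has_cderiv_ker.
have [a0|a0] := eqVneq (cabs a) 0; first by rewrite a0 mul0r.
rewrite (lt_le_trans _ ar)// ltr_pM2l//.
by rewrite lt_def a0 cabs_ge0.
Qed.

Lemma cabs_ker_le a z d : 0 < d -> cabs a * cabs z <= 1 - d -> cabs (ker a z) <= d^-1.
Proof.
move=> d0 az; rewrite /ker cabsV lef_pV2 ?posrE//.
  by apply: le_trans (ker_den_ge a z); rewrite lerBrDr addrC -lerBrDr.
rewrite cabs_gt0 ker_den_neq0// (le_lt_trans az)// ltrBlDr ltrDl//.
Qed.

Lemma ker_zc a r t : ker a (zc r t) = ker (r%:C * a) (zc 1 t).
Proof. by rewrite /ker /zc cconjM conjc_real mul1r mulrCA mulrA. Qed.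

Lemma pser_ker a rho : 0 < rho -> cabs a * rho <= 1 -> pser (fun n => cj a ^+ n) (ker a) rho.
Proof.
move=> rho0 ar z zr e e0; pose w := cj a * z.
have w1 : cabs w < 1.
  rewrite /w cabsM cabs_conj; have [a0|a0] := eqVneq (cabs a) 0; first by rewrite a0 mul0r.
  by rewrite (lt_le_trans _ ar)// ltr_pM2l// lt_def a0 cabs_ge0.
have dn : 1 - w != 0 by apply: ker_den_neq0; rewrite -(cabs_conj a) -cabsM.
have dg : 0 < cabs (1 - w) by rewrite cabs_gt0.
have E N : csums (fun n => cj a ^+ n) z N = (1 - w ^+ N) / (1 - w).
  apply: (mulfI dn); rewrite mulrCA divff// mulr1 -[in RHS](expr1n _ N) subrXX; congr (_ * _).
  by apply: eq_bigr => i _; rewrite expr1n mul1r /w exprMn.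
have q01 : 0 <= cabs w < 1 by rewrite cabs_ge0.
have [N0 HN] := geometric_small ((1 - cabs w) / cabs (1 - w)) q01 e0.
exists N0 => N /HN.
have -> : ker a z - csums (fun n => cj a ^+ n) z N = w ^+ N / (1 - w).
  by rewrite E /ker -/w; field.
rewrite cabsM cabsX cabsV => /(le_lt_trans _); apply.
rewrite le_eqVlt; apply/orP; left; apply/eqP; field.
by rewrite !gt_eqF// subr_gt0.
Qed.

Lemma rcont_ker a r : cabs a * r < 1 -> 0 <= r -> rcont (fun t => ker a (zc r t)).
Proof.
move=> ar r0; apply: rcont_comp; first exact: rcont_zc.
move=> t; have : cabs a * cabs (zc r t) < 1 by rewrite cabs_zc ger0_norm.
by move=> /has_cderiv_ker /has_cderiv_continuous.
Qed.

Lemma m2_ker a d : 0 < d -> cabs a <= 1 - d -> m2 (ker a) 1 <= d^-1.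
Proof.
(* A radius above 1 with |a| rho <= 1, so that the series of [ker a] converges across the unit
   circle. *)
move=> d0 ad; pose rho := (1 - d / 2)^-1.
have d1 : d <= 1 by have := le_trans (cabs_ge0 a) ad; rewrite subr_ge0.
have d20 : 0 < 1 - d / 2 by move: d0 d1; clear; lra.
have rho1 : 1 < rho by rewrite /rho invf_gt1//; move: d0; clear; lra.
have ar : cabs a * rho <= 1.
  by rewrite ler_pdivrMr// mul1r (le_trans ad)//; move: d0; clear; lra.
have rho0 : 0 < rho by rewrite (lt_trans _ rho1).
apply: (m2_le_ps2 (pser_ker rho0 ar)) => // N.
rewrite ps2_at1; pose q := cabs a ^+ 2.
have q1 : 0 <= q < 1.
  rewrite /q sqr_ge0 expr_lt1//.
  by rewrite (le_lt_trans ad)// ltrBlDr ltrDl.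
have := geometric_tail (@ler01 R) q1 (leq0n N).
rewrite big_mkord expr0 mulr1 => H.
apply: le_trans (_ : \sum_(i < N) 1 * q ^+ i <= _) => //.
  by apply: ler_sum => n _; rewrite cabsX cabs_conj mul1r /q -!exprM mulnC.
apply: le_trans H _; rewrite mul1r lef_pV2 ?posrE//; last by rewrite subr_gt0; case/andP: q1.
rewrite /q lerBrDr -lerBrDl; apply: le_trans (ad).
by rewrite expr2 ler_piMl// (le_trans ad)// gerBl ltW.
Qed.

Lemma cauchy_schwarz_sum (x y : nat -> R) N : (forall n, 0 <= x n) -> (forall n, 0 <= y n) ->
  (\sum_(n < N) x n * y n) ^+ 2 <= (\sum_(n < N) x n ^+ 2) * (\sum_(n < N) y n ^+ 2).
Proof.
move=> x0 y0; elim: N => [|N IH]; first by rewrite !big_ord0 mulr0 expr0n.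
rewrite !big_ord_recr/=; move: IH.
have S0 : 0 <= \sum_(n < N) x n * y n by apply: sumr_ge0 => n _; exact: mulr_ge0.
have A0 : 0 <= \sum_(n < N) x n ^+ 2 by apply: sumr_ge0 => n _; exact: sqr_ge0.
have B0 : 0 <= \sum_(n < N) y n ^+ 2 by apply: sumr_ge0 => n _; exact: sqr_ge0.
move: (\sum_(n < N) x n * y n) (\sum_(n < N) x n ^+ 2) (\sum_(n < N) y n ^+ 2) S0 A0 B0.
move: (x N) (y N) (x0 N) (y0 N) => c d c0 d0 S A B S0 A0 B0 IH.
suff H : 2 * S * (c * d) <= A * d ^+ 2 + B * c ^+ 2.
  have -> : (S + c * d) ^+ 2 = S ^+ 2 + 2 * S * (c * d) + c ^+ 2 * d ^+ 2 by ring.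
  have -> : (A + c ^+ 2) * (B + d ^+ 2) = A * B + (A * d ^+ 2 + B * c ^+ 2) + c ^+ 2 * d ^+ 2 by ring.
  by rewrite lerD// lerD.
rewrite -(@ler_pXn2r _ 2)// ?nnegrE ?addr_ge0 ?mulr_ge0 ?sqr_ge0//.
have -> : (2 * S * (c * d)) ^+ 2 = 4 * (c ^+ 2 * d ^+ 2) * S ^+ 2 by ring.
apply: le_trans (_ : 4 * (c ^+ 2 * d ^+ 2) * (A * B) <= _).
  by rewrite ler_wpM2l// !mulr_ge0 ?sqr_ge0.
rewrite -subr_ge0 (_ : _ - _ = (A * d ^+ 2 - B * c ^+ 2) ^+ 2) ?sqr_ge0//; ring.
Qed.

(** Cauchy-Schwarz on the Taylor series against the weights (|z| / r)^n, whose squares sum to 1 / (1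
    - (|z| / r)^2). At z = 0 it is the sub-mean value property of |f|^2. *)
Lemma point_bound f rho r z : 0 < rho -> holoD rho f -> 0 < r -> r < rho -> cabs z < r ->
  cabs (f z) ^+ 2 * (1 - (cabs z / r) ^+ 2) <= m2 f r.
Proof.
move=> rho0 hf r0 rr zr; have [a af] := holoD_pser rho0 hf.
pose x := cabs z / r.
have x0 : 0 <= x by rewrite divr_ge0// ltW.
have x1 : x < 1 by rewrite ltr_pdivrMr// mul1r.
have q01 : 0 <= x ^+ 2 < 1 by rewrite sqr_ge0 expr_lt1.
have q1 : 0 < 1 - x ^+ 2 by rewrite subr_gt0; case/andP: q01.
have M0 := m2_ge0 f r.
suff H : cabs (f z) <= Num.sqrt (m2 f r / (1 - x ^+ 2)).
  rewrite -ler_pdivlMr//.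
  have := lerXn2r 2 (cabs_ge0 (f z)) (sqrtr_ge0 _) H.
  by rewrite sqr_sqrtr// divr_ge0// ltW.
apply/ler_addgt0Pr => e e0.
have [N0 HN] := af z (lt_trans zr rr) e e0; have {}HN := HN N0 (leqnn N0).
rewrite -(subrK (csums a z N0) (f z)) (le_trans (cabsD _ _))// addrC.
apply: lerD; last exact: ltW.
rewrite -(@ler_pXn2r _ 2)// ?nnegrE ?sqrtr_ge0// sqr_sqrtr; last by rewrite divr_ge0// ltW.
apply: le_trans (_ : (\sum_(n < N0) (cabs (a n) * r ^+ n) * x ^+ n) ^+ 2 <= _).
  apply: lerXn2r; rewrite ?nnegrE//.
    by apply: sumr_ge0 => n _; rewrite !mulr_ge0 ?exprn_ge0// ltW.
  apply: le_trans (cabs_sum _ _ _) _; apply: ler_sum => n _.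
  by rewrite cabsM cabsX -mulrA -exprMn /x mulrCA divff ?mulr1// gt_eqF.
apply: le_trans (cauchy_schwarz_sum (x := fun n => cabs (a n) * r ^+ n)
  (y := fun n => x ^+ n) N0 _ _) _.
- by move=> n; rewrite mulr_ge0// exprn_ge0// ltW.
- by move=> n; exact: exprn_ge0.
rewrite ler_pM ?sumr_ge0//.
- by move=> n _; exact: sqr_ge0.
- by move=> n _; exact: sqr_ge0.
- exact: (ps2_le_m2 _ af (ltW r0) rr).
have := geometric_tail (@ler01 R) q01 (leq0n N0); rewrite big_mkord expr0 mulr1 mul1r.
apply: le_trans; apply: ler_sum => n _; by rewrite mul1r -!exprM mulnC.
Qed.

(** The Poisson majorization of |f|^2 from the point bound for f times [ker a] at a itself, where
    the kernel equals 1 / (1 - |a|^2). *)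
Lemma sub_poisson f rho a : 1 < rho -> holoD rho f -> cabs a < 1 ->
  cabs (f a) ^+ 2 <= (1 - cabs a ^+ 2) *
    rmean (fun t => cabs (f (zc 1 t)) ^+ 2 * cabs (ker a (zc 1 t)) ^+ 2).
Proof.
move=> rho1 hf a1.
(* |a| times 2 / (1 + |a|) is at most 1, so [ker a] is holomorphic in this disc, and 2 / (1 + |a|)
   exceeds 1. *)
pose rho' := Num.min rho (2 / (1 + cabs a)).
have c0 : 0 < 1 + cabs a by rewrite ltr_wpDr.
have r1 : 1 < rho'.
  by rewrite lt_min rho1/= ltr_pdivlMr// mul1r -[ltRHS]/(1 + 1) ltrD2l.
have r0 : 0 < rho' by rewrite (lt_trans _ r1).
have ar : cabs a * rho' <= 1.
  apply: le_trans (_ : cabs a * (2 / (1 + cabs a)) <= _).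
    by rewrite ler_wpM2l// ge_min lexx orbT.
  by rewrite mulrA ler_pdivrMr// mul1r; move: a1; clear; lra.
have hh : holoD rho' (fun z => f z * ker a z).
  by apply: holoDM; [apply: holoDS hf; rewrite ge_min lexx|exact: holoD_ker].
have := point_bound r0 hh ltr01 r1 a1.
rewrite divr1.
have q1 : 0 < 1 - cabs a ^+ 2 by rewrite subr_gt0 expr_lt1.
have kE : cabs (ker a a) = (1 - cabs a ^+ 2)^-1.
  rewrite /ker cabsV mulrC mul_conj -(rmorph1 (real_complex R)) -rmorphB/= cabsR ger0_norm//.
  exact: ltW.
rewrite [cabs (_ * _)]cabsM exprMn kE => H.
have {H} : cabs (f a) ^+ 2 / (1 - cabs a ^+ 2) <= m2 (fun z => f z * ker a z) 1.
  apply: le_trans H; rewrite le_eqVlt; apply/orP; left; apply/eqP.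
  by field; rewrite gt_eqF.
rewrite ler_pdivrMr// mulrC => /le_trans; apply; rewrite ler_wpM2l ?(ltW q1)//.
rewrite /m2; under [X in rmean X <= _]eq_fun do rewrite cabsM exprMn.
exact: lexx.
Qed.

End Kernel.

(** * The weighted estimate for Hardy functions *)

Section HardyBound.
Variable R : realType.
Local Notation C := R[i].
Local Notation cj := (@conjc R).
Implicit Types (f g : C -> C) (r s d N q : R).

Lemma continuous_powR_comp (h : R -> R) q : 0 < q -> continuous h ->
  (forall t, 0 <= h t) -> continuous (fun t => h t `^ q).
Proof.
move=> q0 ch h0 t; have qn0 : q != 0 by rewrite gt_eqF.
have := h0 t; rewrite le_eqVlt => /predU1P[ht|ht].
  apply/cvgrPdist_lt => e e0; rewrite -ht powR0//.
  have e1 : 0 < e `^ q^-1 by exact: powR_gt0.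
  have /cvgrPdist_lt/(_ _ e1) := ch t; apply: filterS => s.
  rewrite -ht !sub0r !normrN (ger0_norm (h0 s)) (ger0_norm (powR_ge0 _ _)) => hs.
  rewrite -[ltRHS]powRr1 ?(ltW e0)// -(mulVf qn0).
  by rewrite powRrM gt0_ltr_powR// nnegrE ?powR_ge0.
have nz : \forall s \near t, 0 < h s.
  have /cvgrPdist_lt/(_ _ ht) := ch t; apply: filterS => s.
  by move=> /(le_lt_trans (ler_norm _)); rewrite ltrBlDr ltrDl.
have E : {for t, continuous (fun s => expR (q * ln (h s)))}.
  apply: (@continuous_comp _ _ _ (fun s => q * ln (h s)) expR); last exact: continuous_expR.
  apply: cvgM; first exact: cvg_cst.
  by apply: continuous_comp; [exact: ch|exact: continuous_ln].
rewrite /continuous_at {2}/powR gt_eqF//; apply: cvg_trans E.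
apply: near_eq_cvg; apply: filterS nz => s hs.
by rewrite /powR gt_eqF.
Qed.

(** The bound [hnorm p f <= N] spread over the circles, free of extended reals; the default branch
    is the sup norm bound. *)
Definition hp_le (p : \bar R) N f :=
  match p with
  | q%:E => forall r, 0 < r < 1 -> rmean (fun t => cabs (f (zc r t)) `^ q) <= N `^ q
  | _ => forall z, cabs z < 1 -> cabs (f z) <= N
  end.

Lemma hmeanE f q r : holo f -> 0 < q -> 0 <= r < 1 ->
  hmean q f r = (rmean (fun t => cabs (f (zc r t)) `^ q))%:E.
Proof.
move=> hf q0 /andP[r0 r1]; rewrite /hmean integral_rint//.
apply: continuous_powR_comp => //; apply: rcont_cabs.
exact: (rcont_circle hf).
Qed.

Lemma hnorm_hp_le (p : \bar R) N f : (2%:E < p)%E -> holo f -> 0 < N ->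
  (hnorm p f <= N%:E)%E -> hp_le p N f.
Proof.
case: p => [q||]//=; last first.
  move=> _ hf N0 fN z z1; rewrite -lee_fin; apply: le_trans fN.
  by apply: ereal_sup_ubound; exists z.
rewrite lte_fin => q2 hf N0 fN r r01.
have q0 : 0 < q by rewrite (lt_trans _ q2).
set S := ereal_sup _ in fN.
have rS : ((rmean (fun t => cabs (f (zc r t)) `^ q))%:E <= S)%E.
  rewrite -hmeanE//; last by case/andP: r01 => /ltW -> ->.
  by apply: ereal_sup_ubound; exists r => //; rewrite /= in_itv/=.
have S0 : (0 <= S)%E.
  by apply: le_trans rS; rewrite lee_fin rmean_ge0// => t; exact: powR_ge0.
rewrite -lee_fin; apply: (le_trans rS).
rewrite -(poweRe1 S0) -(mulVf (lt0r_neq0 q0)) poweRrM -poweR_EFin.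
apply: gt0_ler_poweR => //; rewrite ?(ltW q0)// in_itv/= ?leey ?andbT ?poweR_ge0//.
by rewrite lee_fin ltW.
Qed.

(* [x ^ 2 <= s ^ 2 + x ^ q s ^ (2 - q)] replaces Hoelder's inequality. *)
Lemma sqr_le_powR (x s q : R) : 2 < q -> 0 <= x -> 0 < s ->
  x ^+ 2 <= s ^+ 2 + s `^ (2 - q) * x `^ q.
Proof.
move=> q2 x0 s0; have [xs|xs] := leP x s.
  apply: le_trans (_ : s ^+ 2 <= _); last by rewrite lerDl mulr_ge0 ?powR_ge0.
  by apply: lerXn2r; rewrite ?nnegrE// ltW.
have xp : 0 < x by rewrite (lt_trans s0).
apply: le_trans (_ : s `^ (2 - q) * x `^ q <= _); last by rewrite lerDr sqr_ge0.
have -> : x ^+ 2 = x `^ (2 - q) * x `^ q.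
  by rewrite -powRD ?subrK ?powR_mulrn// (gt_eqF xp) implybT.
rewrite ler_wpM2r ?powR_ge0//.
rewrite -opprB !powRN lef_pV2 ?posrE ?powR_gt0//.
by apply: ge0_ler_powR; rewrite ?nnegrE ?subr_ge0 ?ltW.
Qed.

(** The only form in which the Hardy hypothesis is used later. For lam = 1 - 2/q the exponent is -
    2/q - 1: the first part is the price of passing from L^q to L^2, the second the mean of |ker
    b|^2. Taking d = 1 and b = 0 recovers a plain bound on [m2]. *)
Definition wbound f (K lam : R) := forall r d b, 0 < r < 1 -> 0 < d -> cabs b <= 1 - d ->
  rmean (fun t => cabs (f (zc r t)) ^+ 2 * cabs (ker b (zc 1 t)) ^+ 2) <= K * d `^ (lam - 2).

Lemma hp_le_wbound (p : \bar R) N f : (2%:E < p)%E -> holo f -> 0 < N -> hp_le p N f ->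
  wbound f (2 * N ^+ 2) (lam_of p).
Proof.
move=> p2 hf N0 fN r d b r01 d0 bd; have /andP[r0 r1] := r01.
have b1 : cabs b < 1 by rewrite (le_lt_trans bd)// ltrBlDr ltrDl.
have cf : rcont (fun t => f (zc r t)) := rcont_circle hf (ltW r0) r1.
have ck : rcont (fun t => ker b (zc 1 t)) by apply: rcont_ker; rewrite ?mulr1.
have c2 := continuous_m2 ck; have c1 := continuous_m2 cf.
have mk : rmean (fun t => cabs (ker b (zc 1 t)) ^+ 2) <= d^-1 := m2_ker d0 bd.
have cM (x : R) (h : R -> R) : continuous h -> continuous (fun t => x * h t).
  by move=> ch t; apply: cvgM; [exact: cvg_cst|exact: ch].
have cMM (h k : R -> R) : continuous h -> continuous k -> continuous (fun t => h t * k t).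
  by move=> ch ckk t; apply: cvgM; [exact: ch|exact: ckk].
have cD (h k : R -> R) : continuous h -> continuous k -> continuous (fun t => h t + k t).
  by move=> ch ckk t; apply: cvgD; [exact: ch|exact: ckk].
have kd t : cabs (ker b (zc 1 t)) <= d^-1.
  by apply: cabs_ker_le => //; rewrite cabs_zc normr1 mulr1.
case: p p2 fN => [q||]//=; last first.
  move=> _ fN.
  have -> : d `^ (1 - 2) = d^-1.
    by rewrite (_ : 1 - 2 = -1); [rewrite powR_inv1// ltW|ring].
  apply: le_trans (_ : N ^+ 2 * d^-1 <= _); last first.
    by rewrite ler_wpM2r ?invr_ge0 ?(ltW d0)// ler_peMl ?sqr_ge0// ler1n.
  apply: le_trans (ler_wpM2l (sqr_ge0 N) mk); rewrite -rmeanZ//.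
  apply: rmean_le; [exact: cMM|exact: cM|].
  move=> t _; rewrite ler_wpM2r ?sqr_ge0//; apply: lerXn2r; rewrite ?nnegrE ?(ltW N0)//.
  by apply: fN; rewrite cabs_zc ger0_norm// ltW.
rewrite lte_fin => q2 fN; have q0 : 0 < q by rewrite (lt_trans _ q2).
have qn0 : q != 0 by rewrite gt_eqF.
(* This threshold balances the two terms of [sqr_le_powR]: after the kernel is bounded by its mean
   1/d in the first and by its supremum d^(-2) in the second, both equal s^2 / d. *)
pose s := N * d `^ (- q^-1).
have s0 : 0 < s by rewrite mulr_gt0// powR_gt0.
have cq : continuous (fun t => cabs (f (zc r t)) `^ q).
  by apply: continuous_powR_comp => //; exact: rcont_cabs.
apply: le_trans (_ : s ^+ 2 * d^-1 + s `^ (2 - q) * d ^- 2 * N `^ q <= _).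
  apply: le_trans (_ : rmean (fun t => s ^+ 2 * cabs (ker b (zc 1 t)) ^+ 2 +
      s `^ (2 - q) * d ^- 2 * cabs (f (zc r t)) `^ q) <= _).
    apply: rmean_le; [exact: cMM|by apply: cD; exact: cM|].
    move=> t _; apply: le_trans (ler_wpM2r (sqr_ge0 _) (sqr_le_powR q2 (cabs_ge0 (f (zc r t))) s0)) _.
    rewrite mulrDl lerD2l -!mulrA ler_wpM2l ?powR_ge0// mulrC ler_wpM2r ?powR_ge0//.
    by rewrite -exprVn; apply: lerXn2r; rewrite ?nnegrE ?invr_ge0 ?(ltW d0).
  rewrite rmeanD; [|exact: cM|exact: cM].
  rewrite !rmeanZ//; apply: lerD; first by rewrite ler_wpM2l ?sqr_ge0.
  by rewrite ler_wpM2l ?fN// mulr_ge0 ?powR_ge0// invr_ge0 sqr_ge0.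
have sq : s `^ q = N `^ q * d^-1.
  rewrite /s powRM ?(ltW N0) ?powR_ge0// -powRrM mulNr mulVf// powR_inv1//.
  exact: ltW.
have E1 : s `^ (2 - q) = s ^+ 2 / s `^ q.
  rewrite powRB ?(powR_mulrn 2 (ltW s0))//.
  by rewrite (gt_eqF s0) implybT.
have Nq : 0 < N `^ q by exact: powR_gt0.
have -> : s ^+ 2 * d^-1 + s `^ (2 - q) * d ^- 2 * N `^ q = 2 * (s ^+ 2 * d^-1).
  by rewrite E1 sq; field; rewrite !gt_eqF.
have -> : d `^ (1 - 2 / q - 2) = d `^ (- q^-1) ^+ 2 * d^-1.
  have -> : 1 - 2 / q - 2 = - q^-1 * 2 + - 1 by field.
  rewrite powRD ?(gt_eqF d0) ?implybT// powRrM powR_mulrn ?powR_ge0//.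
  by rewrite powR_inv1// ltW.
by rewrite /s exprMn; lra.
Qed.

End HardyBound.

(** * Polar coordinates *)

Section AffineChange.
Variable R : realType.
Local Notation mu := (@lebesgue_measure R).
Local Open Scope ereal_scope.

Lemma measurable_affine (c d : R) : measurable_fun [set: R] (fun x : R => (c * x + d)%R).
Proof.
apply: measurable_funD; last exact: measurable_cst.
by apply: measurable_funM; [exact: measurable_cst|exact: measurable_id].
Qed.

(** By uniqueness of Lebesgue measure it suffices to test half-open intervals; for c < 0 the
    preimage is half-open on the other side. *)
Lemma lebesgue_affine (c d : R) (A : set R) : (c != 0)%R -> measurable A ->
  mu A = (`|c|)%:E * mu ((fun x => (c * x + d)%R) @^-1` A).
Proof.
move=> c0 mA; pose phi (x : measurableTypeR R) : measurableTypeR R := (c * x + d)%R.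
have mphi : measurable_fun setT phi by exact: measurable_affine.
pose pf := (pushforward mu phi : {measure set (measurableTypeR R) -> \bar R}).
pose nu : {measure set (measurableTypeR R) -> \bar R} :=
  mscale (NngNum (normr_ge0 c)) (pf mphi).
apply: (@lebesgue_measure_unique R nu) => // _ [[a b] _ <-] /=.
rewrite /nu /pf /mscale/= /pushforward.
have [ba|ab] := leP b a.
  rewrite set_itv_ge; last by rewrite bnd_simp -leNgt.
  by rewrite preimage_set0 !measure0 mule0.
rewrite lebesgue_measure_itv/= lte_fin ab.
have [cp|cn] := ltP 0%R c.
  have -> : phi @^-1` [set` `]a, b]%R] = [set` `](a - d) / c, (b - d) / c]%R].
    apply/seteqP; split => x /=; rewrite !in_itv/= ltr_pdivrMr// ler_pdivlMr// mulrC
      ltrBlDr lerBrDr//.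
  rewrite lebesgue_measure_itv/= lte_fin ltr_pM2r ?invr_gt0// ltrD2r ab.
  rewrite -!EFinB -EFinM gtr0_norm//; congr (_%:E); field; exact: c0.
have {cn c0}cn : (c < 0)%R by rewrite lt_neqAle c0.
have -> : phi @^-1` [set` `]a, b]%R] = [set` `[(b - d) / c, (a - d) / c[%R].
  apply/seteqP; split => x /=; rewrite !in_itv/= ler_ndivrMr// ltr_ndivlMr// mulrC
    ltrBlDr lerBrDr; by rewrite andbC.
rewrite lebesgue_measure_itv/= lte_fin ltr_nM2r ?invr_lt0// ltrD2r ab.
rewrite -!EFinB -EFinM ltr0_norm//; congr (_%:E); field; by rewrite lt_eqF.
Qed.

Lemma integral_affine (c d : R) (g : R -> \bar R) : (c != 0)%R ->
  measurable_fun setT g -> (forall x, 0 <= g x) ->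
  \int[mu]_x g x = (`|c|)%:E * \int[mu]_x g (c * x + d)%R.
Proof.
move=> c0 mg g0; pose phi (x : measurableTypeR R) : measurableTypeR R := (c * x + d)%R.
have mphi : measurable_fun setT phi by exact: measurable_affine.
have := @ge0_integral_pushforward _ _ _ _ R phi mphi mu setT g measurableT mg (fun x _ => g0 x).
rewrite preimage_setT => <-.
rewrite -(@ge0_integral_mscale _ _ R (pushforward mu phi) setT measurableT
  (NngNum (normr_ge0 c)) g mg (fun x _ => g0 x)).
apply: eq_measure_integral => A mA _.
by rewrite /mscale/= /pushforward; exact: lebesgue_affine.
Qed.

End AffineChange.

Section Polar.
Variable R : realType.
Local Notation mu := (@lebesgue_measure R).
Implicit Types (k : R -> R -> R) (G : R -> R).

Lemma sin_atan (u : R) : sin (atan u) = u * cos (atan u).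
Proof.
have c0 : cos (atan u) != 0.
  by rewrite gt_eqF// cos_gt0_pihalf// atan_gtNpi2 atan_ltpi2.
have := atanK u; rewrite /tan => h; by rewrite -{2}h divfK.
Qed.

Lemma cos_atan_sqr (u : R) : cos (atan u) ^+ 2 = (1 + u ^+ 2)^-1.
Proof. by rewrite cos_atan exprVn sqr_sqrtr// addr_ge0 ?sqr_ge0. Qed.

(** The substitution t = atan u, dt = cos(atan u)^2 du, carried out by the fundamental theorem on a
    half-line with limit value at pi / 2. *)
Lemma half_line_atan G : continuous G -> (forall x, 0 <= G x) ->
  (\int[mu]_(u in `[0%R, +oo[) (cos (atan u) ^+ 2 * G (atan u))%:E)%E =
  (rint 0 (pi / 2) G)%:E.
Proof.
move=> cG G0; have [H dH HE] := antiderivative cG.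
have p2 : 0 <= pi / 2 :> R by rewrite divr_ge0// pi_ge0.
have cH : continuous H.
  by move=> x; apply: differentiable_continuous; apply/derivable1_diffP; case: (dH x).
have cF : continuous (fun u : R => H (atan u)).
  by move=> x; apply: continuous_comp; [exact: continuous_atan|exact: cH].
have lim : (fun u : R => H (atan u)) x @[x --> +oo] --> H (pi / 2).
  by apply: cvg_comp; [exact: cvgy_atan|exact: cH].
have dF (u : R) : is_derive u 1 (fun u => H (atan u)) (cos (atan u) ^+ 2 * G (atan u)).
  have := @is_derive1_comp _ H atan u _ _ (dH (atan u)) (is_derive1_atan u).
  by rewrite cos_atan_sqr mulrC.
have cf : continuous (fun u : R => cos (atan u) ^+ 2 * G (atan u)).
  have ca := @continuous_atan R.
  move=> x; apply: cvgM.
    have cc : continuous (fun u : R => cos (atan u)).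
      by move=> y; apply: continuous_comp; [exact: ca|exact: continuous_cos].
    exact: (sqr_cont cc).
  by apply: continuous_comp; [exact: ca|exact: cG].
rewrite (ge0_continuous_FTC2y _ _ lim)/=.
- by rewrite atan0 HE// EFinB.
- by move=> x _; rewrite mulr_ge0 ?sqr_ge0.
- by apply: continuous_subspaceT.
- by move=> x _; case: (dF x).
- by apply: cvg_at_right_filter; exact: cF.
- by move=> x _; rewrite derive1E; case: (dF x).
Qed.

(** A real factor in place of a domain of integration, so that Tonelli can be applied on the whole
    plane. *)
Definition pos (x : R) : R := \1_(`]0, +oo[%classic) x.

Lemma posE x : pos x = (0 < x)%R%:R.
Proof. by rewrite /pos indicE mem_setE in_itv/= andbT. Qed.

Lemma pos_ge0 x : 0 <= pos x. Proof. by rewrite posE. Qed.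

Lemma measurable_pos : measurable_fun setT pos.
Proof. exact: measurable_indic. Qed.

Lemma integral_pos (f : R -> \bar R) :
  (\int[mu]_x ((pos x)%:E * f x) = \int[mu]_(x in `]0%R, +oo[) f x)%E.
Proof.
rewrite [RHS]integral_mkcond; apply: eq_integral => x _.
rewrite patchE mem_setE in_itv/= andbT posE; case: ifP => _; first by rewrite mul1e.
by rewrite mul0e.
Qed.

Lemma measurable_neg : measurable_fun [set: R] (fun x : R => - x).
Proof.
have := @measurable_affine R (-1) 0; congr (measurable_fun _ _).
by apply/funext => x; rewrite mulN1r addr0.
Qed.

Lemma integral_split_pos (f : R -> \bar R) : measurable_fun setT f -> (forall x, 0 <= f x)%E ->
  (\int[mu]_x f x = \int[mu]_x ((pos x)%:E * f x) + \int[mu]_x ((pos x)%:E * f (- x)%R))%E.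
Proof.
move=> mf f0.
have mp : measurable_fun [set: R] (fun x => (pos x)%:E).
  by apply/measurable_EFinP; exact: measurable_pos.
have mN : measurable_fun [set: R] (fun x : R => f (- x)).
  by apply: (measurableT_comp mf); exact: measurable_neg.
have -> : (\int[mu]_x ((pos x)%:E * f (- x)%R) = \int[mu]_x ((pos (- x))%:E * f x))%E.
  rewrite [RHS](@integral_affine _ (-1) 0) ?oppr_eq0 ?oner_eq0//.
  - rewrite normrN1 mul1e; apply: eq_integral => x _.
    by rewrite mulN1r addr0 opprK.
  - apply: emeasurable_funM => //; apply/measurable_EFinP.
    by apply: (measurableT_comp measurable_pos); exact: measurable_neg.
  - by move=> x; rewrite mule_ge0// lee_fin pos_ge0.
rewrite -[LHS](@integral_setD1 _ f 0 setT).
- rewrite integral_mkcond -ge0_integralD//.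
  + apply: eq_integral => x _; rewrite patchE !posE oppr_gt0.
    have [xs|/negP xs] := boolP (x \in [set: R] `\ 0).
      move: xs; rewrite inE/= => -[_ /eqP x0].
      by have [xn|xp|/eqP] := ltgtP x 0; rewrite ?mul1e ?mul0e ?add0e ?adde0// (negPf x0).
    have [xn|xp|->] := ltgtP x 0; last by rewrite !mul0e adde0.
    - by case: xs; rewrite inE/=; split => //; by move=> x0; rewrite x0 ltxx in xn.
    - by case: xs; rewrite inE/=; split => //; by move=> x0; rewrite x0 ltxx in xp.
  + by move=> x _; rewrite mule_ge0// lee_fin pos_ge0.
  + exact: emeasurable_funM.
  + by move=> x _; rewrite mule_ge0// lee_fin pos_ge0.
  + apply: emeasurable_funM => //; apply/measurable_EFinP.
    by apply: (measurableT_comp measurable_pos); exact: measurable_neg.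
- by apply: measurableD.
- by apply: measurable_funTS.
Qed.

Lemma measurable_atan : measurable_fun [set: R] (@atan R).
Proof. by apply: continuous_measurable_fun; exact: continuous_atan. Qed.

Lemma line_atan G : continuous G -> (forall x, 0 <= G x) ->
  (\int[mu]_u (cos (atan u) ^+ 2 * G (atan u))%:E)%E =
  (rint (- (pi / 2)) (pi / 2) G)%:E.
Proof.
move=> cG G0.
have p2 : 0 <= pi / 2 :> R by rewrite divr_ge0// pi_ge0.
have cGN : continuous (fun x => G (- x)).
  by move=> x; apply: continuous_comp; [apply: cvgN; exact: cvg_id|exact: cG].
have mc (K : R -> R) : continuous K ->
    measurable_fun [set: R] (fun u : R => (cos (atan u) ^+ 2 * K (atan u))%:E).
  move=> cK; apply/measurable_EFinP; apply: measurable_funM.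
    apply: measurable_funX; apply: (measurableT_comp _ measurable_atan).
    by apply: continuous_measurable_fun; exact: continuous_cos.
  apply: (measurableT_comp _ measurable_atan); exact: continuous_measurable_fun.
rewrite integral_split_pos; last 2 first.
- exact: mc.
- by move=> u; rewrite lee_fin mulr_ge0// sqr_ge0.
rewrite !integral_pos !integral_itv_obnd_cbnd; last 2 first.
- apply: measurable_funTS.
  have := mc (fun x => G (- x)) cGN; congr (measurable_fun _ _).
  by apply/funext => u; rewrite atanN cosN.
- apply: measurable_funTS; exact: mc.
rewrite half_line_atan//.
under eq_integral do rewrite atanN cosN.
rewrite (@half_line_atan (fun x => G (- x)))// -EFinD; congr (_%:E).
have [H dH HE] := antiderivative cG.
have n2 : - (pi / 2) <= 0 :> R by rewrite oppr_le0.
have dN (x : R) : is_derive x 1 (fun x => - H (- x)) (G (- x)).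
  have d1 := @is_derive1_comp _ H (fun y => - y) x _ _ (dH (- x)) (is_deriveN (is_derive_id x 1)).
  have d2 := is_deriveN d1.
  by apply: is_derive_eq; rewrite mulrN1 opprK.
rewrite (rint_FTC cGN dN p2).
rewrite (HE 0)// (HE (- _))// ?(le_trans n2)//.
by rewrite oppr0; ring.
Qed.

Local Notation mu2 := (mu \x mu)%E.
Local Notation kk k := (fun xy : R * R => k xy.1 xy.2).

Lemma measurable_comp2 d (T : measurableType d) k (f g : T -> R) :
  measurable_fun setT (kk k) -> measurable_fun setT f -> measurable_fun setT g ->
  measurable_fun setT (fun z => k (f z) (g z)).
Proof.
move=> mk mf mg.
exact: (@measurableT_comp _ _ _ _ _ _ (kk k) _ (fun z => (f z, g z)) mk (measurable_fun_pair mf mg)).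
Qed.

(** Only scalings of the line and Tonelli: put y = x u on each vertical line, exchange, put x = r
    cos(atan u) for fixed u, exchange back, and finally t = atan u. The Jacobian r collects the
    scaling factors x and cos(atan u), and the remaining cos(atan u)^2 is absorbed by dt. *)
Lemma half_plane_polar k : measurable_fun setT (kk k) -> (forall x y, 0 <= k x y) ->
  (forall r, 0 < r -> continuous (fun t => k (r * cos t) (r * sin t))) ->
  measurable_fun setT
    (fun r => pos r * r * rint (- (pi / 2)) (pi / 2) (fun t => k (r * cos t) (r * sin t))) /\
  (\int[mu]_x ((pos x)%:E * \int[mu]_y (k x y)%:E) =
   \int[mu]_r (pos r * r * rint (- (pi / 2)) (pi / 2) (fun t => k (r * cos t) (r * sin t)))%:E)%E.
Proof.
move=> mk k0 ck.
pose F (xu : R * R) : \bar R := (pos xu.1 * xu.1 * k xu.1 (xu.1 * xu.2))%:E.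
have pos_ge (x : R) : 0 <= pos x * x.
  by rewrite posE; case: ltP => [/ltW|]; rewrite ?mul1r// mul0r.
have mF : measurable_fun setT F.
  apply/measurable_EFinP; apply: measurable_funM.
    apply: measurable_funM; last exact: measurable_fst.
    by apply: (measurableT_comp measurable_pos); exact: measurable_fst.
  apply: (measurable_comp2 mk); first exact: measurable_fst.
  by apply: measurable_funM; [exact: measurable_fst|exact: measurable_snd].
have F0 xu : (0 <= F xu)%E by rewrite lee_fin mulr_ge0.
have mk2 x : measurable_fun [set: R] (fun y => (k x y)%:E).
  apply/measurable_EFinP; exact: (measurable_fun_pair2 x mk).
pose F2 (ru : R * R) : \bar R := (pos ru.1 * ru.1 *
  (cos (atan ru.2) ^+ 2 * k (ru.1 * cos (atan ru.2)) (ru.1 * sin (atan ru.2))))%:E.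
have F20 ru : (0 <= F2 ru)%E by rewrite lee_fin mulr_ge0// mulr_ge0// sqr_ge0.
have mca : measurable_fun [set: R * R] (fun ru => cos (atan ru.2)).
  apply: (@measurableT_comp _ _ _ _ _ _ (fun u => cos (atan u))); last exact: measurable_snd.
  apply: continuous_measurable_fun => y.
  by apply: continuous_comp; [exact: continuous_atan|exact: continuous_cos].
have msa : measurable_fun [set: R * R] (fun ru => sin (atan ru.2)).
  apply: (@measurableT_comp _ _ _ _ _ _ (fun u => sin (atan u))); last exact: measurable_snd.
  apply: continuous_measurable_fun => y.
  by apply: continuous_comp; [exact: continuous_atan|exact: continuous_sin].
have mF2 : measurable_fun setT F2.
  apply/measurable_EFinP; apply: measurable_funM.
    apply: measurable_funM; last exact: measurable_fst.
    by apply: (measurableT_comp measurable_pos); exact: measurable_fst.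
  apply: measurable_funM; first exact: measurable_funX.
  apply: (measurable_comp2 mk);
    by apply: measurable_funM => //; exact: measurable_fst.
have E r : (\int[mu]_u F2 (r, u))%E =
    (pos r * r * rint (- (pi / 2)) (pi / 2) (fun t => k (r * cos t) (r * sin t)))%:E.
  rewrite /F2/= posE.
  case: ltP => r0; last by rewrite !mul0r integral0_eq// => u _; rewrite !mul0r.
  rewrite mul1r; under eq_integral do rewrite EFinM.
  rewrite ge0_integralZl_EFin//.
  - by rewrite (@line_atan (fun t => k (r * cos t) (r * sin t)))//; exact: ck.
  - by move=> u _; rewrite lee_fin mulr_ge0// sqr_ge0.
  - apply/measurable_EFinP; apply: measurable_funM.
      apply: measurable_funX; exact: (measurable_fun_pair2 r mca).
    apply: (@measurableT_comp _ _ _ _ _ _ (fun t => k (r * cos t) (r * sin t)));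
      last exact: measurable_atan.
    by apply: continuous_measurable_fun; exact: ck.
  - exact: ltW.
split.
  have := @measurable_fun_fubini_tonelli_F _ _ _ _ _ mu F2 mF2 F20.
  by rewrite /fubini_F; under eq_fun do rewrite E; move/measurable_EFinP.
transitivity (\int[mu]_x \int[mu]_u F (x, u))%E.
  apply: eq_integral => x _; rewrite /F/= posE.
  case: ltP => x0; last by rewrite mul0e !mul0r integral0_eq// => u _; rewrite mul0r.
  rewrite mul1e (@integral_affine _ x 0) ?gt_eqF//; last by move=> y; rewrite lee_fin.
  rewrite gtr0_norm// -ge0_integralZl_EFin//.
  - by apply: eq_integral => u _; rewrite mul1r addr0 EFinM.
  - by move=> u _; rewrite lee_fin.
  - apply: (measurableT_comp (mk2 x)); exact: measurable_affine.
  - exact: ltW.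
rewrite (@fubini_tonelli _ _ _ _ _ mu mu F)//.
transitivity (\int[mu]_u \int[mu]_r F2 (r, u))%E.
  apply: eq_integral => u _.
  have c0 : 0 < cos (atan u) by rewrite cos_gt0_pihalf// atan_gtNpi2 atan_ltpi2.
  rewrite (@integral_affine _ (cos (atan u)) 0 (fun x => F (x, u))) ?gt_eqF//; last first.
    exact: (measurable_fun_pair1 u mF).
  rewrite gtr0_norm// -ge0_integralZl_EFin//; last 2 first.
  - apply: (@measurableT_comp _ _ _ _ _ _ (fun x => F (x, u))); last exact: measurable_affine.
    exact: (measurable_fun_pair1 u mF).
  - exact: ltW.
  apply: eq_integral => r _; rewrite /F /F2/= addr0 -EFinM; congr (_%:E).
  rewrite !posE pmulr_rgt0// sin_atan [cos _ * r]mulrC.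
  rewrite (_ : r * cos (atan u) * u = r * (u * cos (atan u))); last by ring.
  by rewrite expr2; ring.
rewrite -(@fubini_tonelli _ _ _ _ _ mu mu F2)//.
by apply: eq_integral => r _; rewrite E.
Qed.

Lemma integral_add_eq (A B C : R -> R) : measurable_fun setT A -> measurable_fun setT B ->
  (forall x, 0 <= A x) -> (forall x, 0 <= B x) -> (forall x, C x = A x + B x) ->
  (\int[mu]_x (A x)%:E + \int[mu]_x (B x)%:E = \int[mu]_x (C x)%:E)%E.
Proof.
move=> mA mB A0 B0 CE; rewrite -ge0_integralD//.
- by apply: eq_integral => x _; rewrite CE EFinD.
- by move=> x _; rewrite lee_fin.
- exact/measurable_EFinP.
- by move=> x _; rewrite lee_fin.
- exact/measurable_EFinP.
Qed.

(** The left half-plane is the image of the right one under z -> - z, which shifts the angle by pi;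
    periodicity joins the two angular integrals. *)
Lemma polar k : measurable_fun setT (kk k) -> (forall x y, 0 <= k x y) ->
  (forall r, 0 < r -> continuous (fun t => k (r * cos t) (r * sin t))) ->
  measurable_fun setT (fun r => pos r * r * rint 0 (2 * pi) (fun t => k (r * cos t) (r * sin t))) /\
  (\int[mu2]_xy (k xy.1 xy.2)%:E =
   \int[mu]_r (pos r * r * rint 0 (2 * pi) (fun t => k (r * cos t) (r * sin t)))%:E)%E.
Proof.
move=> mk k0 ck.
pose k' x y := k (- x) (- y).
have mk' : measurable_fun setT (kk k').
  apply: (measurable_comp2 mk).
    by apply: (measurableT_comp measurable_neg); exact: measurable_fst.
  by apply: (measurableT_comp measurable_neg); exact: measurable_snd.
have cpi (G : R -> R) : continuous G -> continuous (fun t => G (t + pi)).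
  move=> cG t; apply: continuous_comp; last exact: cG.
  by apply: cvgD; [exact: cvg_id|exact: cvg_cst].
have k'E r : (fun t => k' (r * cos t) (r * sin t)) =
    (fun t => (fun t => k (r * cos t) (r * sin t)) (t + pi)).
  by apply/funext => t; rewrite /k' cosDpi sinDpi !mulrN.
have ck' r : 0 < r -> continuous (fun t => k' (r * cos t) (r * sin t)).
  by move=> r0; rewrite k'E; exact: (cpi (fun t => k (r * cos t) (r * sin t)) (ck r r0)).
have [m1 h1] := half_plane_polar mk k0 ck.
have [m2 h2] := half_plane_polar mk' (fun x y => k0 (- x) (- y)) ck'.
have E r : pos r * r * rint 0 (2 * pi) (fun t => k (r * cos t) (r * sin t)) =
    pos r * r * rint (- (pi / 2)) (pi / 2) (fun t => k (r * cos t) (r * sin t)) +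
    pos r * r * rint (- (pi / 2)) (pi / 2) (fun t => k' (r * cos t) (r * sin t)).
  rewrite -mulrDr posE; case: ltP => r0; last by rewrite !mul0r.
  congr (_ * _); rewrite k'E; set G := fun t => k (r * cos t) (r * sin t).
  have cG : continuous G by exact: ck.
  have p0 := pi_gt0 R.
  have [H dH HE] := antiderivative cG.
  have dpi (x : R) : is_derive x 1 (fun x => H (x + pi)) (G (x + pi)).
    have d2 : is_derive x 1 (fun y => y + pi) 1 by apply: is_derive_eq; rewrite addr0.
    have d1 := @is_derive1_comp _ H (fun y => y + pi) x _ _ (dH (x + pi)) d2.
    by apply: is_derive_eq; rewrite mulr1.
  have le1 : - (pi / 2) <= pi / 2 :> R by clear -p0; lra.
  rewrite (rint_FTC (cpi G cG) dpi le1) (HE _ _ le1).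
  rewrite -(@rint_period R (- (pi / 2)) (2 * pi) G)//.
  - rewrite HE; last by clear -p0; lra.
    rewrite (_ : pi / 2 + pi = - (pi / 2) + 2 * pi); last by field.
    rewrite (_ : - (pi / 2) + pi = pi / 2); last by field.
    by rewrite [RHS]addrC addrA subrK.
  - by clear -p0; lra.
  - by move=> t; rewrite /G mulr_natl cosD2pi sinD2pi.
split; first by under eq_fun do rewrite E; exact: measurable_funD.
have pos_ge (x : R) : 0 <= pos x * x.
  by rewrite posE; case: ltP => [/ltW|]; rewrite ?mul1r// mul0r.
rewrite (@fubini_tonelli1 _ _ _ _ _ mu mu (fun xy => (k xy.1 xy.2)%:E)); last 2 first.
- exact/measurable_EFinP.
- by move=> xy; rewrite lee_fin.
rewrite /fubini_F/= integral_split_pos; last 2 first.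
- apply: (@measurable_fun_fubini_tonelli_F _ _ _ _ _ mu (fun xy => (k xy.1 xy.2)%:E)) => //.
  + exact/measurable_EFinP.
  + by move=> xy; rewrite lee_fin.
- by move=> x; apply: integral_ge0 => y _; rewrite lee_fin.
have -> : (\int[mu]_x ((pos x)%:E * \int[mu]_y (k (- x) y)%:E) =
    \int[mu]_x ((pos x)%:E * \int[mu]_y (k' x y)%:E))%E.
  apply: eq_integral => x _; congr (_ * _)%E.
  rewrite (@integral_affine _ (-1) 0) ?oppr_eq0 ?oner_eq0//.
  - rewrite normrN1 mul1e; apply: eq_integral => y _.
    by rewrite mulN1r addr0.
  - by apply/measurable_EFinP; exact: (measurable_fun_pair2 (- x) mk).
  - by move=> y; rewrite lee_fin.
rewrite h1 h2; apply: (integral_add_eq m1 m2) => r; last exact: E.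
- by rewrite mulr_ge0// rint_ge0// => t.
- by rewrite mulr_ge0// rint_ge0// => t; rewrite /k'.
Qed.

Lemma polar_center (a b : R) k : measurable_fun setT (kk k) -> (forall x y, 0 <= k x y) ->
  (forall r, 0 < r -> continuous (fun t => k (a + r * cos t) (b + r * sin t))) ->
  measurable_fun setT (fun r => pos r * r * rint 0 (2 * pi) (fun t => k (a + r * cos t) (b + r * sin t))) /\
  (\int[mu2]_xy (k xy.1 xy.2)%:E =
   \int[mu]_r (pos r * r * rint 0 (2 * pi) (fun t => k (a + r * cos t) (b + r * sin t)))%:E)%E.
Proof.
move=> mk k0 ck; pose k' x y := k (a + x) (b + y).
have madd (c : R) : measurable_fun [set: R] (fun x => c + x).
  by apply: measurable_funD; [exact: measurable_cst|exact: measurable_id].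
have mk' : measurable_fun setT (kk k').
  apply: (measurable_comp2 mk).
    by apply: (measurableT_comp (madd a)); exact: measurable_fst.
  by apply: (measurableT_comp (madd b)); exact: measurable_snd.
have [mp <-] := polar mk' (fun x y => k0 (a + x) (b + y)) ck.
split => //.
rewrite (@fubini_tonelli1 _ _ _ _ _ mu mu (fun xy => (k xy.1 xy.2)%:E)); last 2 first.
- exact/measurable_EFinP.
- by move=> xy; rewrite lee_fin.
rewrite (@fubini_tonelli1 _ _ _ _ _ mu mu (fun xy => (k' xy.1 xy.2)%:E)); last 2 first.
- exact/measurable_EFinP.
- by move=> xy; rewrite lee_fin /k'.
rewrite /fubini_F/= (@integral_affine _ 1 a) ?oner_eq0//; last 2 first.
- apply: (@measurable_fun_fubini_tonelli_F _ _ _ _ _ mu (fun xy => (k xy.1 xy.2)%:E)) => //.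
  + exact/measurable_EFinP.
  + by move=> xy; rewrite lee_fin.
- by move=> x; apply: integral_ge0 => y _; rewrite lee_fin.
rewrite normr1 mul1e; apply: eq_integral => x _.
rewrite (@integral_affine _ 1 b) ?oner_eq0//; last 2 first.
- by apply/measurable_EFinP; exact: (measurable_fun_pair2 _ mk).
- by move=> y; rewrite lee_fin.
rewrite normr1 mul1e; apply: eq_integral => y _.
by rewrite /k' !mul1r ![_ + a]addrC ![_ + b]addrC.
Qed.

End Polar.

(** * Monotonicity of integrals of nonnegative functions *)

Section IntegralMono.
Local Open Scope ereal_scope.
Context d (T : measurableType d) (R : realType).
Variable mu : {measure set T -> \bar R}.

(* No measurability: the integral of a nonnegative function is a supremum over
   the simple functions below it. *)
Lemma integral_mono_restrict (D E : set T) (f g : T -> \bar R) :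
  (forall x, D x -> 0 <= f x) -> (forall x, E x -> 0 <= g x) ->
  (forall x, (f \_ D) x <= (g \_ E) x) ->
  \int[mu]_(x in D) f x <= \int[mu]_(x in E) g x.
Proof.
move=> f0 g0 fg; rewrite !ge0_integralE//.
apply: le_ereal_sup => _ [h/= hf <-].
by exists h => //= x; exact: le_trans (hf x) (fg x).
Qed.

Lemma integral_mono (D : set T) (f g : T -> \bar R) :
  (forall x, D x -> 0 <= f x) -> (forall x, D x -> f x <= g x) ->
  \int[mu]_(x in D) f x <= \int[mu]_(x in D) g x.
Proof.
move=> f0 fg; apply: integral_mono_restrict => // x.
  by move=> Dx; exact: le_trans (f0 _ Dx) (fg _ Dx).
by rewrite !patchE; case: ifPn => // /set_mem; exact: fg.
Qed.

(** Raising g to +oo on the null set makes the inequality hold everywhere, and changes the integral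
    of the measurable g by nothing; f may be arbitrary. *)
Lemma integral_mono_ae (D : set T) (f g : T -> \bar R) : measurable D -> measurable_fun D g ->
  (forall x, D x -> 0 <= f x) -> (forall x, D x -> 0 <= g x) ->
  {ae mu, forall x, D x -> f x <= g x} ->
  \int[mu]_(x in D) f x <= \int[mu]_(x in D) g x.
Proof.
move=> mD mg f0 g0 [N [mN N0 sN]].
pose g' x := if x \in N then +oo else g x.
have mg' : measurable_fun D g'.
  apply: measurable_fun_if => //; last by apply: measurable_funS mg => // x [].
  apply: (@measurable_fun_bool _ _ _ _ true).
  rewrite (_ : _ @^-1` _ = N); first exact: measurableI.
  by apply/seteqP; split => x /=; [move/set_mem|move/mem_set].
apply: (@le_trans _ _ (\int[mu]_(x in D) g' x)).
  apply: integral_mono => // x Dx; rewrite /g'; case: ifPn => [_|]; first exact: leey.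
  rewrite notin_setE => Nx; apply: contrapT => h; apply: Nx; apply: sN => /= /(_ Dx).
  exact: h.
rewrite (@ge0_negligible_integral _ _ _ mu D N)//.
  apply: integral_mono_restrict => //.
  + by move=> x [Dx Nx]; rewrite /g' memNset//; exact: g0.
  + move=> x; rewrite !patchE; case: ifPn => [/set_mem[Dx Nx]|_].
      by rewrite mem_set// /g' memNset.
    by case: ifPn => // /set_mem; exact: g0.
by move=> x Dx; rewrite /g'; case: ifPn => _; [exact: leey|exact: g0].
Qed.

End IntegralMono.

(** * Carleson boxes *)

Section MeasurableDisc.
Variable R : realType.
Local Notation C := R[i].
Implicit Types (a : nat -> C) (f : C -> C).

Definition cmeas d (T : measurableType d) (h : T -> C) :=
  measurable_fun setT (fun x => complex.Re (h x)) /\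
  measurable_fun setT (fun x => complex.Im (h x)).

Lemma cmeasD d (T : measurableType d) (h k : T -> C) :
  cmeas h -> cmeas k -> cmeas (fun x => h x + k x).
Proof.
move=> [h1 h2] [k1 k2]; split.
  by have := measurable_funD h1 k1; congr (measurable_fun _ _); apply/funext => x /=; case: (h x);
    case: (k x).
by have := measurable_funD h2 k2; congr (measurable_fun _ _); apply/funext => x /=; case: (h x);
  case: (k x).
Qed.

Lemma cmeasM d (T : measurableType d) (h k : T -> C) :
  cmeas h -> cmeas k -> cmeas (fun x => h x * k x).
Proof.
move=> [h1 h2] [k1 k2]; split.
  have := measurable_funB (measurable_funM h1 k1) (measurable_funM h2 k2).
  by congr (measurable_fun _ _); apply/funext => x /=; rewrite cReM.
have := measurable_funD (measurable_funM h1 k2) (measurable_funM h2 k1).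
by congr (measurable_fun _ _); apply/funext => x /=; rewrite cImM.
Qed.

Lemma cmeas_cst d (T : measurableType d) (c : C) : cmeas (fun _ : T => c).
Proof. by split; exact: measurable_cst. Qed.

Lemma cmeas_csums d (T : measurableType d) (h : T -> C) a N :
  cmeas h -> cmeas (fun x => csums a (h x) N).
Proof.
move=> mh; elim: N => [|N IH].
  by rewrite (_ : (fun _ => _) = fun=> 0); [exact: cmeas_cst|apply/funext => x; rewrite /csums big_ord0].
under eq_fun do rewrite csumsS; apply: cmeasD => //.
apply: cmeasM; first exact: cmeas_cst.
elim: N {IH} => [|N IH]; first by under eq_fun do rewrite expr0; exact: cmeas_cst.
by under eq_fun do rewrite exprS; exact: cmeasM.
Qed.

Lemma cmeas_cabs d (T : measurableType d) (h : T -> C) :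
  cmeas h -> measurable_fun setT (fun x => cabs (h x) ^+ 2).
Proof.
move=> [h1 h2]; have := measurable_funD (measurable_funX 2 h1) (measurable_funX 2 h2).
by congr (measurable_fun _ _); apply/funext => x /=; rewrite sqr_cabs.
Qed.

Lemma cmeas_pair : cmeas (fun xy : R * R => xy.1 +i* xy.2).
Proof. by split => /=; [exact: measurable_fst|exact: measurable_snd]. Qed.

Lemma csums_cvg a f z : pser a f 1 -> cabs z < 1 ->
  (fun N => cabs (csums a z N) ^+ 2) @ \oo --> cabs (f z) ^+ 2.
Proof.
move=> af z1.
have h : (fun N => cabs (csums a z N)) @ \oo --> cabs (f z).
  apply/cvgrPdist_lt => e e0; have [N HN] := af z z1 e e0.
  exists N => // n /= Nn; apply: le_lt_trans (HN n Nn).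
  exact: cabs_ltr_dist.
under eq_fun do rewrite expr2; rewrite expr2; exact: cvgM.
Qed.

(** Outside the disc f is arbitrary, so a weight vanishing there is built in; the product is then
    the pointwise limit of the weighted Taylor polynomials. *)
Lemma measurable_weight a f (w : R * R -> R) : pser a f 1 -> measurable_fun setT w ->
  (forall xy, 1 <= cabs (xy.1 +i* xy.2) -> w xy = 0) ->
  measurable_fun setT (fun xy : R * R => w xy * cabs (f (xy.1 +i* xy.2)) ^+ 2).
Proof.
move=> af mw w0.
apply: (@measurable_fun_cvg _ _ _ setT
  (fun N (xy : R * R) => w xy * cabs (csums a (xy.1 +i* xy.2) N) ^+ 2)) => [N|xy _].
  apply: measurable_funM => //; apply: cmeas_cabs; apply: cmeas_csums; exact: cmeas_pair.
have [z1|z1] := ltP (cabs (xy.1 +i* xy.2)) 1.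
  apply: cvgM; [exact: cvg_cst|exact: csums_cvg].
rewrite w0// mul0r; under eq_fun do rewrite mul0r; exact: cvg_cst.
Qed.

Local Notation mu := (@lebesgue_measure R).

Lemma zcE r t : zc r t = (r * cos t) +i* (r * sin t) :> C.
Proof. by apply: complex_eq; rewrite /zc ?cReM ?cImM/= ?mul0r ?subr0 ?addr0. Qed.

Lemma pos_mul_ge0 (x : R) : 0 <= pos x * x.
Proof. by rewrite posE; case: ltP => [/ltW|]; rewrite ?mul1r// mul0r. Qed.

Lemma radial_area a f (w : R -> R) : pser a f 1 -> measurable_fun setT w ->
  (forall x, 0 <= w x) -> (forall x, 1 <= x -> w x = 0) ->
  measurable_fun setT (fun r => pos r * r * (w (r ^+ 2) * m2 f r)) /\
  (\int[(mu \x mu)%E]_xy (w (xy.1 ^+ 2 + xy.2 ^+ 2) * cabs (f (xy.1 +i* xy.2)) ^+ 2)%:E =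
   (2 * pi)%:E * \int[mu]_r (pos r * r * (w (r ^+ 2) * m2 f r))%:E)%E.
Proof.
move=> af mw w0 w1; have hf := pser_holoD af.
pose k x y := w (x ^+ 2 + y ^+ 2) * cabs (f (x +i* y)) ^+ 2.
have mk : measurable_fun setT (fun xy : R * R => k xy.1 xy.2).
  apply: (measurable_weight (w := fun xy => w (xy.1 ^+ 2 + xy.2 ^+ 2)) af) => [|xy h].
    apply: (measurableT_comp mw); apply: measurable_funD; apply: measurable_funX;
      [exact: measurable_fst|exact: measurable_snd].
  by apply: w1; have := sqr_cabs (xy.1 +i* xy.2); rewrite /= => <-; rewrite expr_ge1.
have k0 x y : 0 <= k x y by rewrite mulr_ge0// sqr_ge0.
have kE r : (fun t => k (r * cos t) (r * sin t)) = (fun t => w (r ^+ 2) * cabs (f (zc r t)) ^+ 2).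
  apply/funext => t; rewrite /k -zcE; congr (w _ * _).
  by rewrite !exprMn -mulrDr cos2Dsin2 mulr1.
have ck r : 0 < r -> continuous (fun t => k (r * cos t) (r * sin t)).
  move=> r0; rewrite kE; have [r1|r1] := ltP r 1.
    have cc : rcont (fun t => f (zc r t)) := rcont_circle hf (ltW r0) r1.
    by move=> t; apply: cvgM; [exact: cvg_cst|exact: (continuous_m2 cc)].
  rewrite w1 ?expr_ge1// ?ltW//; under eq_fun do rewrite mul0r; exact: cst_continuous.
have E r : pos r * r * rint 0 (2 * pi) (fun t => k (r * cos t) (r * sin t)) =
    2 * pi * (pos r * r * (w (r ^+ 2) * m2 f r)).
  rewrite kE posE; case: ltP => r0; last by rewrite !mul0r mulr0.
  have [r1|r1] := ltP r 1; last first.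
    rewrite w1 ?expr_ge1// ?ltW// mul0r !mulr0.
    rewrite (_ : (fun _ => _) = (fun=> 0)); last by apply/funext => t; rewrite mul0r.
    by rewrite rint_cst ?mul0r ?mulr0.
  have cc : rcont (fun t => f (zc r t)) := rcont_circle hf (ltW r0) r1.
  rewrite /m2 /rmean rintZ; last exact: continuous_m2.
  have p0 : (pi : R) != 0 by rewrite gt_eqF ?pi_gt0.
  rewrite [RHS]mulrCA; congr (_ * _); rewrite [RHS]mulrCA; congr (_ * _).
  by rewrite mulrA divff ?mul1r// mulf_neq0// pnatr_eq0.
have [mp hp] := polar mk k0 ck.
have p20 : 2 * pi != 0 :> R by rewrite mulf_neq0// ?pnatr_eq0// gt_eqF// pi_gt0.
have mQ : measurable_fun setT (fun r => pos r * r * (w (r ^+ 2) * m2 f r)).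
  have := measurable_funM (@measurable_cst _ _ _ _ setT ((2 * pi)^-1 : R)) mp.
  by congr (measurable_fun _ _); apply/funext => r /=; rewrite E mulKf.
split => //; rewrite hp -ge0_integralZl_EFin//.
- by apply: eq_integral => r _; rewrite E EFinM.
- by move=> r _; rewrite lee_fin mulr_ge0 ?pos_mul_ge0 ?(mulr_ge0 (w0 _) (m2_ge0 _ _)).
- exact/measurable_EFinP.
- by rewrite mulr_ge0// pi_ge0.
Qed.

Lemma integral_le_left (Q : R -> R) (s0 : R) (B : \bar R) : s0 < 1 -> measurable_fun setT Q ->
  (forall x, 0 <= Q x) -> (forall x, ~~ (s0 <= x < 1) -> Q x = 0) ->
  (forall s, s0 <= s < 1 -> (\int[mu]_(r in `[s0, s]) (Q r)%:E <= B)%E) ->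
  (\int[mu]_r (Q r)%:E <= B)%E.
Proof.
move=> s01 mQ Q0 Qz HB.
pose sn n : R := 1 - (1 - s0) * n.+1%:R^-1.
have d0 : 0 < 1 - s0 by rewrite subr_gt0.
have sn01 n : s0 <= sn n < 1.
  rewrite /sn ltrBlDr ltrDl mulr_gt0 ?invr_gt0// andbT lerBrDr -lerBrDl.
  by rewrite ger_pMr// invf_le1// ler1n.
pose g n r : \bar R := (\1_(`[s0, sn n]%classic) r * Q r)%:E.
have mg n : measurable_fun setT (g n).
  by apply/measurable_EFinP; apply: measurable_funM => //; exact: measurable_indic.
have gle m n r : (m <= n)%N -> (g m r <= g n r)%E.
  move=> mn; rewrite lee_fin ler_wpM2r// !indicE !mem_setE !in_itv/=.
  have : sn m <= sn n by rewrite lerD2l lerN2 ler_pM2l// lef_pV2 ?posrE// ler_nat.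
  case: (s0 <= r) => //= h; have [h1|h1] := leP r (sn m); last by rewrite ler0n.
  by rewrite (le_trans h1 h).
have -> : (\int[mu]_r (Q r)%:E = \int[mu]_r limn (g ^~ r))%E.
  apply: eq_integral => r _; apply/esym/lim_near_cst => //.
  have [/andP[r1 r2]|h] := boolP (s0 <= r < 1); last first.
    by apply: nearW => n; rewrite /g Qz// mulr0.
  have e0 : 0 < (1 - r) / (1 - s0) by rewrite divr_gt0// subr_gt0.
  near=> n; rewrite /g indicE mem_set ?mul1r//= in_itv/= r1/= /sn.
  rewrite lerBrDr addrC -lerBrDr -ler_pdivlMl// mulrC ltW//.
  by near: n; exact: (near_infty_natSinv_lt (PosNum e0)).
rewrite monotone_convergence//.
- apply: lime_le.
    apply: ereal_nondecreasing_is_cvgn => m n mn; apply: integral_mono => r _; last exact: gle.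
    by rewrite lee_fin mulr_ge0.
  apply: nearW => n; apply: le_trans (HB _ (sn01 n)).
  rewrite [leRHS]integral_mkcond; apply: integral_mono => r _.
    by rewrite lee_fin mulr_ge0.
  rewrite patchE /g indicE; case: ifPn => _; first by rewrite mul1r.
  by rewrite mul0r.
- by move=> n r _; rewrite lee_fin mulr_ge0.
- by move=> r _ m n mn; exact: gle.
Unshelve. all: by end_near. Qed.

End MeasurableDisc.

(** * The box integral of the derivative *)

Section Carleson.
Variable R : realType.
Local Notation C := R[i].
Local Notation cj := (@conjc R).
Local Notation mu := (@lebesgue_measure R).
Implicit Types (a z : C) (f : C -> C).

Lemma wbound_m2 f K lam d a r : wbound f K lam -> 0 < d -> cabs a <= 1 - d -> 0 < r < 1 ->
  m2 (fun z => f z * ker a z) r <= K * d `^ (lam - 2).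
Proof.
move=> wf d0 ad r01; have /andP[r0 r1] := r01.
have -> : m2 (fun z => f z * ker a z) r =
    rmean (fun t => cabs (f (zc r t)) ^+ 2 * cabs (ker (r%:C * a) (zc 1 t)) ^+ 2).
  rewrite /m2; congr rmean; apply/funext => t.
  by rewrite cabsM exprMn ker_zc.
apply: wf => //; rewrite cabsM cabsR gtr0_norm//; apply: le_trans ad.
by rewrite ler_piMl// ltW.
Qed.

(** With h = f k for the kernel k, the product rule gives f' k = h' - conj(a) k h, and |k| <=
    1/d. *)
Lemma m2_deriv_ker f a d r : holoD 1 f -> 0 < d -> cabs a <= 1 - d -> 0 < r < 1 ->
  m2 (fun z => cderiv f z * ker a z) r <=
  2 * m2 (cderiv (fun z => f z * ker a z)) r + 2 * d ^- 2 * m2 (fun z => f z * ker a z) r.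
Proof.
move=> hf d0 ad /andP[r0 r1].
have a1 : cabs a < 1 by rewrite (le_lt_trans ad)// ltrBlDr ltrDl.
have hk : holoD 1 (ker a) by apply: holoD_ker; rewrite mulr1 ltW.
have hh := holoDM hf hk; set h := fun z => f z * ker a z in hh *.
have [b hb] := holoD_pser ltr01 hh.
have hdh := pser_holoD (pser_cderiv hb).
have [c fc] := holoD_pser ltr01 hf.
have hdf := pser_holoD (pser_cderiv fc).
have E t : cderiv f (zc r t) * ker a (zc r t) = cderiv h (zc r t) - cj a * ker a (zc r t) * h (zc r t).
  have z1 : cabs (zc r t) < 1 by rewrite cabs_zc gtr0_norm.
  have kz : cabs a * cabs (zc r t) < 1.
    by rewrite (le_lt_trans _ z1)// ler_piMl// ltW.
  rewrite (cderivE (has_cderivM (holoD_cderiv hf z1) (has_cderiv_ker kz))) /h.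
  by ring.
have cdf : rcont (fun t => cderiv f (zc r t)) := rcont_circle hdf (ltW r0) r1.
have ck : rcont (fun t => ker a (zc r t)) := rcont_circle hk (ltW r0) r1.
have cdh : rcont (fun t => cderiv h (zc r t)) := rcont_circle hdh (ltW r0) r1.
have chh : rcont (fun t => h (zc r t)) := rcont_circle hh (ltW r0) r1.
have c1 := continuous_m2 (rcontM cdf ck).
have c2 := continuous_m2 cdh; have c3 := continuous_m2 chh.
have c2' : continuous (fun t => 2 * cabs (cderiv h (zc r t)) ^+ 2).
  by move=> t; apply: cvgM; [exact: cvg_cst|exact: c2].
have c3' : continuous (fun t => 2 * d ^- 2 * cabs (h (zc r t)) ^+ 2).
  by move=> t; apply: cvgM; [exact: cvg_cst|exact: c3].
rewrite /m2 -!rmeanZ// -rmeanD//.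
apply: rmean_le => // [t|t _].
  by apply: cvgD; [exact: c2'|exact: c3'].
rewrite E; set x := cderiv h _; set y := cj a * _ * _.
have ty : cabs y ^+ 2 <= d ^- 2 * cabs (h (zc r t)) ^+ 2.
  rewrite /y cabsM exprMn ler_wpM2r ?sqr_ge0// -exprVn ler_pXn2r ?nnegrE// ?invr_ge0; last exact: ltW.
  apply: (@le_trans _ _ (cabs (ker a (zc r t)))).
    by rewrite cabsM cabs_conj ler_piMl//; exact: ltW.
  apply: cabs_ker_le => //; apply: le_trans ad.
  by rewrite cabs_zc gtr0_norm// ler_piMr// ltW.
have tx := cabsD x (- y); rewrite cabsN in tx.
have := cabs_ge0 (x - y); have := cabs_ge0 x; have := cabs_ge0 y.
move: ty tx; rewrite -mulrA; move: (cabs (x - y)) (cabs x) (cabs y) (d ^- 2 * _) => m n p q.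
move=> pq mn p0 n0 m0.
have mnp : m ^+ 2 <= (n + p) ^+ 2 by rewrite ler_pXn2r// nnegrE addr_ge0.
have h2 := sqr_ge0 (n - p); apply: (le_trans mnp).
apply: (@le_trans _ _ (2 * n ^+ 2 + 2 * p ^+ 2)); last by rewrite lerD2l ler_pM2l.
move: h2; rewrite sqrrB sqrrD; clear; lra.
Qed.

(* The weight [1 - |z|^2] on the annulus [1 - d <= |z| < 1], as a function of
   [x = |z|^2]. *)
Definition cw d (x : R) : R := \1_(`[(1 - d) ^+ 2, 1[%classic) x * (1 - x).

Lemma cw_ge0 d x : 0 <= cw d x.
Proof.
rewrite /cw indicE mem_setE in_itv/=; case: andP => [[_ x1]|_]; last by rewrite mul0r.
by rewrite mul1r subr_ge0 ltW.
Qed.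

Lemma cw_out d x : 1 <= x -> cw d x = 0.
Proof. by move=> x1; rewrite /cw indicE mem_setE in_itv/= [x < 1]ltNge x1 andbF mul0r. Qed.

Lemma measurable_cw d : measurable_fun setT (cw d).
Proof.
apply: measurable_funM; first exact: measurable_indic.
by apply: measurable_funB; [exact: measurable_cst|exact: measurable_id].
Qed.

Lemma carleson_kernel f K lam d a : holoD 1 f -> 0 <= K -> wbound f K lam -> 0 < d <= 1 ->
  cabs a <= 1 - d ->
  (\int[(mu \x mu)%E]_xy (cw d (xy.1 ^+ 2 + xy.2 ^+ 2) *
     cabs (cderiv f (xy.1 +i* xy.2) * ker a (xy.1 +i* xy.2)) ^+ 2)%:E <=
   (2 * pi * (5 * (K * d `^ (lam - 2))))%:E)%E.
Proof.
move=> hf K0 wf /andP[d0 d1] ad; set V := K * _.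
have V0 : 0 <= V by rewrite mulr_ge0// powR_ge0.
have a1 : cabs a < 1 by rewrite (le_lt_trans ad)// ltrBlDr ltrDl.
have hk : holoD 1 (ker a) by apply: holoD_ker; rewrite mulr1 ltW.
have [c fc] := holoD_pser ltr01 hf.
have hdf := pser_holoD (pser_cderiv fc).
have [b hb] := holoD_pser ltr01 (holoDM hdf hk).
have [mQ ->] := radial_area hb (@measurable_cw d) (cw_ge0 d) (@cw_out d).
rewrite [leRHS]EFinM lee_pmul2l// ?lte_fin ?mulr_gt0 ?pi_gt0//.
set phi := fun z => cderiv f z * ker a z in hb mQ *.
set h := fun z => f z * ker a z.
have [bh hbh] := holoD_pser ltr01 (holoDM hf hk); rewrite -/h in hbh.
have HV r : 0 < r < 1 -> m2 h r <= V by exact: wbound_m2.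
have d1' : 0 <= 1 - d by rewrite subr_ge0.
(* [lp_upper] covers radii up to some s < 1; the edge of the disc is reached by monotone
   convergence. *)
apply: (integral_le_left (s0 := 1 - d)) => //.
- by rewrite ltrBlDr ltrDl.
- by move=> r; rewrite mulr_ge0 ?pos_mul_ge0 ?(mulr_ge0 (cw_ge0 _ _) (m2_ge0 _ _)).
- move=> r; rewrite negb_and -ltNge -leNgt => rd; rewrite posE.
  case: ltP => r0; last by rewrite !mul0r.
  rewrite /cw indicE mem_setE in_itv/=.
  case: andP => [[h1 h2]|_]; last by rewrite !mul0r mulr0.
  case/orP: rd => rd.
    by move: h1; rewrite leNgt ltr_pXn2r ?nnegrE ?(ltW r0)// rd.
  by move: h2; rewrite ltNge expr_ge1 ?rd// ltW.
move=> s /andP[s0 s1]; apply/lee_addgt0Pr => e e0.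
have s0' : 0 <= s := le_trans d1' s0.
have [P [cP HP IP]] := lp_upper hbh HV s0' s1 e0.
(* The 5 of the statement: the h' term contributes V through [lpw]. In the other term r (1 - r^2) <=
   2 d on the annulus makes the integrand at most 4 V / d, and the annulus has width d, which gives
   4 V. *)
pose S r := lpw r * P r + 4 * V / d.
have cl : continuous (fun r => lpw r * P r).
  by move=> r; apply: cvgM; [exact: continuous_lpw|exact: cP].
have cS : continuous S.
  by move=> r; apply: cvgD; [exact: cl|exact: cvg_cst].
have P0 r : 0 <= r <= s -> 0 <= P r by move=> /HP; apply: le_trans; exact: m2_ge0.
apply: (@le_trans _ _ (\int[mu]_(r in `[(1 - d)%R, s]) (S r)%:E)%E).
  apply: integral_mono => r; rewrite /= in_itv/= => /andP[dr rs].
    by rewrite lee_fin mulr_ge0 ?pos_mul_ge0 ?(mulr_ge0 (cw_ge0 _ _) (m2_ge0 _ _)).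
  rewrite lee_fin posE; case: ltP => r0; last first.
    have -> : r = 0 by apply/eqP; rewrite eq_le r0 (le_trans d1').
    rewrite !mul0r /S /lpw mulr0 !mul0r add0r.
    by apply: divr_ge0; [exact: mulr_ge0|exact: ltW].
  have r1 : r < 1 := le_lt_trans rs s1.
  have r01 : 0 < r < 1 by rewrite r0.
  have rs' : 0 <= r <= s by rewrite ltW.
  have H := m2_deriv_ker hf d0 ad r01; rewrite -/phi -/h in H.
  have Hh := HV r r01; have Hp := HP r rs'.
  have -> : cw d (r ^+ 2) = 1 - r ^+ 2.
    rewrite /cw indicE mem_set ?mul1r//= in_itv/= ler_pXn2r ?nnegrE ?(ltW r0)// dr/=.
    by rewrite exprn_ilt1// ltW.
  have r2 : 0 <= 1 - r ^+ 2 by rewrite subr_ge0 exprn_ile1//; exact: ltW.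
  have l0 : 0 <= r * (1 - r ^+ 2) by rewrite mulr_ge0//; exact: ltW.
  have l1 : r * (1 - r ^+ 2) <= 2 * d.
    have : 1 - r ^+ 2 <= 2 * d by move: dr r0 r1; clear; nra.
    by apply: le_trans; rewrite ler_piMl//; exact: ltW.
  have H2 : m2 phi r <= 2 * P r + 2 * d ^- 2 * V.
    apply: (le_trans H); rewrite lerD ?ler_wpM2l//.
    by rewrite mulr_ge0// invr_ge0 sqr_ge0.
  rewrite mul1r mulrA /S /lpw.
  apply: (le_trans (ler_wpM2l l0 H2)); rewrite mulrDr lerD//.
    by rewrite le_eqVlt; apply/orP; left; apply/eqP; ring.
  have -> : 4 * V / d = 2 * d * (2 * d ^- 2 * V) by field; exact: lt0r_neq0.
  apply: ler_wpM2r; last exact: l1.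
  by apply: mulr_ge0 => //; apply: divr_ge0 => //; exact: sqr_ge0.
rewrite integral_rint// lee_fin rintD//; last exact: cst_continuous.
rewrite rint_cst//.
suff h1 : rint (1 - d) s (fun r => lpw r * P r) <= V + e.
  have : 4 * V / d * (s - (1 - d)) <= 4 * V.
    rewrite mulrAC ler_pdivrMr// ler_wpM2l ?(mulr_ge0 (ler0n _ 4) V0)//.
    by move: s1; clear; lra.
  by move: h1; clear; lra.
apply: le_trans IP; rewrite (rint_split cl d1' s0) lerDr.
apply: rint_ge0 => r /andP[r0 rd]; rewrite mulr_ge0//.
  by apply: lpw_ge0; rewrite r0; move: rd d0; clear; lra.
by apply: P0; rewrite r0 (le_trans rd).
Qed.

(** A chord is at most its arc: the modulus is 2 |sin(b/2)|. *)
Lemma cexpi_sub1 (b : R) : 0 <= b -> cabs (cexpi b - 1) <= b.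
Proof.
move=> b0.
have h : cabs (cexpi b - 1) ^+ 2 = (2 * sin (b / 2)) ^+ 2.
  rewrite sqr_cabs /cexpi/= subr0.
  have {1 2}-> : b = (b / 2) *+ 2 by rewrite -[RHS]mulr_natr divfK// pnatr_eq0.
  rewrite cos_mulr2n sin_mulr2n; have := cos2Dsin2 (b / 2).
  move: (cos _) (sin _) => x y h.
  have -> : (x ^+ 2 *+ 2 - 1 - 1) ^+ 2 + (x * y *+ 2) ^+ 2 =
    4 * y ^+ 2 * (x ^+ 2 + y ^+ 2) + 4 * (1 - x ^+ 2 - y ^+ 2) * (1 - x ^+ 2 + y ^+ 2) by ring.
  have -> : 1 - x ^+ 2 - y ^+ 2 = 0 by rewrite -h; ring.
  by rewrite h; ring.
have s0 : 0 <= b / 2 by rewrite divr_ge0.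
have sb : `|sin (b / 2)| <= b / 2.
  have [H dH HE] := antiderivative (@continuous_cos R).
  have cc : continuous (fun t : R => cos t) by exact: continuous_cos.
  have ds (x : R) : is_derive x 1 sin (cos x) by exact: is_derive_sin.
  have := rint_FTC cc ds s0; rewrite sin0 subr0 => <-.
  apply: le_trans (rint_abs 0 (b / 2) cc) _.
  have ca : continuous (fun t : R => `|cos t|).
    by move=> t; apply: cvg_norm; exact: cc.
  apply: le_trans (rint_le (k := fun=> 1) ca _ _) _.
  - by move=> t; exact: cvg_cst.
  - by move=> t _; rewrite ler_norml cos_geN1 cos_le1.
  - by rewrite rint_cst// mul1r subr0.
rewrite -(@ler_pXn2r _ 2)// ?nnegrE// h exprMn -(real_normK (num_real (sin _))).
have n0 := normr_ge0 (sin (b / 2)); move: n0 sb; move: (`|_|) => n; clear; nra.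
Qed.

Lemma arc_size_gt0 (I : Defs.arc R) : 0 < arc_size I.
Proof. by rewrite divr_gt0 ?mulr_gt0 ?pi_gt0// arc_len_gt0. Qed.

Lemma arc_size_le1 (I : Defs.arc R) : arc_size I <= 1.
Proof. by rewrite ler_pdivrMr ?mulr_gt0 ?pi_gt0// mul1r arc_len_le. Qed.

Lemma arc_lenE (I : Defs.arc R) : arc_len I = 2 * pi * arc_size I.
Proof. by rewrite mulrC divfK// mulf_neq0 ?pnatr_eq0// gt_eqF ?pi_gt0. Qed.

(** Placed over the endpoint, so that the angle t - [arc_start] is nonnegative along the arc; the
    cost is only in the constant 2 + 2 pi. *)
Definition box_pt (I : Defs.arc R) : C := (1 - arc_size I)%:C * cexpi (arc_start I).

Lemma cabs_box_pt I : cabs (box_pt I) = 1 - arc_size I.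
Proof. by rewrite cabsM cabs_cexpi mulr1 cabsR ger0_norm// subr_ge0 arc_size_le1. Qed.

(** With q = (1 - d) r and b the angle from the endpoint, the modulus is at most (1 - q) + |e^(ib) -
    1|, where 1 - q <= 2 d and b <= 2 pi d. *)
Lemma arc_den (I : Defs.arc R) r t : 1 - arc_size I <= r <= 1 ->
  arc_start I <= t <= arc_start I + arc_len I ->
  cabs (1 - cj (box_pt I) * zc r t) <= (2 + 2 * pi) * arc_size I.
Proof.
move=> /andP[r0 r1] tI; have d0 := arc_size_gt0 I; have d1 := arc_size_le1 I.
have lE := arc_lenE I.
set d := arc_size I in r0 d0 d1 lE *; set b := t - arc_start I.
have b0 : 0 <= b by rewrite subr_ge0; case/andP: tI.
have bd : b <= 2 * pi * d by rewrite -lE lerBlDl; case/andP: tI.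
pose q := (1 - d) * r.
have qE : cj (box_pt I) * zc r t = q%:C * cexpi b.
  have cr (x : R) : cj x%:C = x%:C by apply: complex_eq => //=; rewrite oppr0.
  rewrite /zc /box_pt cconjM cr -cexpiN /b [t - _]addrC cexpiD /q -/d rmorphM.
  by rewrite /=; ring.
rewrite qE.
have -> : 1 - q%:C * cexpi b = (1 - q)%:C - q%:C * (cexpi b - 1).
  by rewrite rmorphB/= rmorph1; ring.
apply: le_trans (cabsD _ _) _; rewrite cabsN cabsM !cabsR.
have rr : 0 <= r by rewrite (le_trans _ r0)// subr_ge0.
have q0 : 0 <= q by rewrite mulr_ge0// subr_ge0.
have q1 : q <= 1 by rewrite mulr_ile1 ?subr_ge0// lerBlDr lerDl ltW.
rewrite (ger0_norm q0) ger0_norm ?subr_ge0// mulrDl lerD//.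
  by move: r0 r1 d0 d1; rewrite /q; clear; nra.
apply: le_trans bd; apply: le_trans (cexpi_sub1 b0); exact: ler_piMl.
Qed.

Lemma box_den I z : carleson_box I z ->
  cabs (1 - cj (box_pt I) * z) <= (2 + 2 * pi) * arc_size I.
Proof.
move=> [/andP[z0 z1] [t tI tz]]; rewrite /= in_itv/= in tI.
have zn : z != 0.
  apply/eqP => zE; have := congr1 (@cabs R) tz.
  by rewrite zE mul0r cabs0 cabs_cexpi => /eqP; rewrite oner_eq0.
have -> : z = zc (cabs z) t by rewrite /zc tz -cabsE mulrC divfK// normr_eq0.
by apply: arc_den => //; rewrite z0 ltW.
Qed.

Lemma carleson_upper f g K lam G (I : Defs.arc R) : holoD 1 f -> 0 <= K -> wbound f K lam ->
  (forall z, cabs z < 1 -> cabs (cderiv g z) <= G * cabs (cderiv f z)) ->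
  (area_int (carleson_box I) (fun z => cabs (cderiv g z) ^+ 2 * (1 - cabs z ^+ 2))%R <=
   (10 * (2 + 2 * pi) ^+ 2 * G ^+ 2 * K * arc_size I `^ lam)%:E)%E.
Proof.
move=> hf K0 wf fg.
have d0 := arc_size_gt0 I; have d1 := arc_size_le1 I.
have d01 : 0 < arc_size I <= 1 by rewrite d0.
have ad : cabs (box_pt I) <= 1 - arc_size I by rewrite cabs_box_pt.
have H := carleson_kernel hf K0 wf d01 ad.
set d := arc_size I in d0 d1 d01 H *; set a := box_pt I in H.
(* On the box 1 <= (2 + 2 pi)^2 d^2 |ker a z|^2, which inserts the kernel. The d^2 raises d^(lam -
   2) to d^lam, and 10 is 2 pi times 5 divided by pi. *)
pose B : R := G ^+ 2 * ((2 + 2 * pi) * d) ^+ 2.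
have B0 : 0 <= B by rewrite mulr_ge0 ?sqr_ge0.
have p0 := pi_gt0 R.
rewrite /area_int.
set J := (X in (_ * X)%E); suff : (J <= B%:E * (2 * pi * (5 * (K * d `^ (lam - 2))))%:E)%E.
  move=> h; apply: le_trans (lee_wpmul2l _ h) _; first by rewrite lee_fin invr_ge0 ltW.
  rewrite -!EFinM lee_fin le_eqVlt; apply/orP; left; apply/eqP.
  have -> : d `^ lam = d `^ (lam - 2) * d ^+ 2.
    by rewrite -(powR_mulrn 2 (ltW d0)) -powRD ?subrK// (gt_eqF d0) implybT.
  rewrite /B; move: (d `^ _) => D; move: (pi : R) p0 => P p0.
  by field; rewrite lt0r_neq0.
apply: le_trans (lee_wpmul2l _ H); last by rewrite lee_fin.
have hk : holoD 1 (ker a).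
  by apply: holoD_ker; rewrite mulr1 /a cabs_box_pt lerBlDr lerDl ltW// arc_size_gt0.
have [c fc] := holoD_pser ltr01 hf.
have [b hb] := holoD_pser ltr01 (holoDM (pser_holoD (pser_cderiv fc)) hk).
pose k (xy : R * R) := cw d (xy.1 ^+ 2 + xy.2 ^+ 2) *
  cabs (cderiv f (xy.1 +i* xy.2) * ker a (xy.1 +i* xy.2)) ^+ 2.
rewrite -[X in (_ <= _ * X)%E]/(\int[(mu \x mu)%E]_xy (k xy)%:E)%E.
have mk : measurable_fun setT k.
  apply: (measurable_weight (w := fun xy => cw d (xy.1 ^+ 2 + xy.2 ^+ 2)) hb) => [|xy h].
    apply: (measurableT_comp (@measurable_cw d)); apply: measurable_funD; apply: measurable_funX;
      [exact: measurable_fst|exact: measurable_snd].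
  by apply: cw_out; have := sqr_cabs (xy.1 +i* xy.2); rewrite /= => <-; rewrite expr_ge1.
have k0 xy : 0 <= k xy by rewrite mulr_ge0 ?sqr_ge0// cw_ge0.
rewrite -ge0_integralZl_EFin//; last 2 first.
- by move=> xy _; rewrite lee_fin.
- exact/measurable_EFinP.
(* The box is enlarged to the whole annulus carried by [cw]; only pointwise domination of the
   restricted integrands is used. *)
apply: integral_mono_restrict => [xy/= [/andP[_ h] _]|xy _|[x y]].
- by rewrite lee_fin mulr_ge0 ?sqr_ge0// subr_ge0 exprn_ile1//; exact: ltW.
- by rewrite -EFinM lee_fin mulr_ge0.
rewrite patch_setT patchE; case: ifPn => [/set_mem/= zI|_]; last first.
  by rewrite -EFinM lee_fin mulr_ge0.
rewrite -EFinM lee_fin /k/=; set z := x +i* y in zI *.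
have /andP[z0 z1] := zI.1; rewrite -/d in z0.
have den := box_den zI; rewrite -/a -/d in den.
have -> : x ^+ 2 + y ^+ 2 = cabs z ^+ 2 by rewrite sqr_cabs.
have zz : cabs z ^+ 2 < 1 by rewrite exprn_ilt1.
have -> : cw d (cabs z ^+ 2) = 1 - cabs z ^+ 2.
  rewrite /cw indicE mem_set ?mul1r//= in_itv/= zz andbT ler_pXn2r ?nnegrE//.
  by rewrite subr_ge0.
have kn : 1 - cj a * z != 0.
  apply: ker_den_neq0; rewrite (le_lt_trans _ z1)// ler_piMl//.
  by rewrite cabs_box_pt lerBlDr lerDl ltW// arc_size_gt0.
have kp : 0 < cabs (1 - cj a * z) by rewrite cabs_gt0.
rewrite [leRHS]mulrCA mulrC; apply: ler_wpM2l; first by rewrite subr_ge0 ltW.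
rewrite /B /ker cabsM [(_ * (cabs _)) ^+ 2]exprMn cabsV.
have P0 : 0 <= 2 + 2 * pi :> R by rewrite addr_ge0// mulr_ge0// ltW.
apply: (@le_trans _ _ (G ^+ 2 * cabs (cderiv f z) ^+ 2)).
  by rewrite -exprMn ler_pXn2r ?nnegrE ?fg// (le_trans (cabs_ge0 _) (fg z z1)).
rewrite -[leRHS]mulrA; apply: ler_wpM2l; first exact: sqr_ge0.
rewrite [leRHS]mulrCA; apply: ler_peMr; first exact: sqr_ge0.
rewrite exprVn ler_pdivlMr ?exprn_gt0// mul1r ler_pXn2r ?nnegrE//.
by rewrite mulr_ge0//; exact: ltW.
Qed.

End Carleson.

(** * The operator I_g *)

Section IgOperator.
Variable R : realType.
Local Notation C := R[i].
Implicit Types (f g F : C -> C) (c : nat -> C).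

(** The coefficients of the primitive vanishing at 0. *)
Definition icoef c (n : nat) : C := if n is m.+1 then c m / m.+1%:R else 0.

Lemma rint_pow (n : nat) : rint 0 1 (fun t : R => t ^+ n) = n.+1%:R^-1.
Proof.
have cX : continuous (fun t : R => t ^+ n) by exact: exprn_continuous.
have dX (x : R) : is_derive x 1 (fun s => n.+1%:R^-1 * s ^+ n.+1) (x ^+ n).
  have d1 := is_derive_cM (n.+1%:R^-1) (is_derive_pow n.+1 x).
  by apply: is_derive_eq; rewrite mulrA mulVf ?mul1r// pnatr_eq0.
by rewrite (rint_FTC cX dX)// expr1n expr0n/= mulr0 subr0 mulr1.
Qed.

Lemma csums_icoef c z N : csums (icoef c) z N.+1 = z * cint 0 1 (fun t => csums c (t%:C * z) N).
Proof.
rewrite /csums big_ord_recl/= mul0r add0r.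
rewrite (@eq_cint _ _ _ _ (fun t => \sum_(n < N) (c n * z ^+ n) * (t ^+ n)%:C)); last first.
  by move=> t _; apply: eq_bigr => n _; rewrite exprMn rmorphXn/=; ring.
rewrite cint_sum; last first.
  move=> n; apply: rcontZ; apply: rcont_real; exact: exprn_continuous.
rewrite big_distrr/=; apply: eq_bigr => n _; rewrite /bump/= add1n.
rewrite cintZ; last by apply: rcont_real; exact: exprn_continuous.
rewrite cint_real rint_pow exprS fmorphV/= rmorph_nat; ring.
Qed.

(** The retraction of the line onto [0, 1]: composed with it, an integrand defined along the segment
    from 0 to z becomes continuous on the whole line, as [rcont] demands. *)
Definition clamp (t : R) : R := (1 + `|t| - `|t - 1|) / 2.

Lemma continuous_clamp : continuous clamp.
Proof.
move=> t; apply: cvgM; last exact: cvg_cst.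
apply: cvgB; first by apply: cvgD; [exact: cvg_cst|apply: cvg_norm; exact: cvg_id].
by apply: cvg_norm; apply: cvgB; [exact: cvg_id|exact: cvg_cst].
Qed.

Lemma clamp_id t : 0 <= t <= 1 -> clamp t = t.
Proof.
by move=> /andP[t0 t1]; rewrite /clamp ger0_norm// ler0_norm ?subr_le0//; field.
Qed.

Lemma clamp_itv t : 0 <= clamp t <= 1.
Proof.
have := ler_normB t 1; have := ler_dist_normD t (- 1); rewrite /clamp.
case: (ger0P t); case: (ger0P (t - 1)); lra.
Qed.

Lemma pser_segment_int c F : pser c F 1 ->
  pser (icoef c) (fun z => z * cint 0 1 (fun t => F (t%:C * z))) 1.
Proof.
move=> cF z z1 e e0; have hF := pser_holoD cF.
have [A [q [A0 q01 HA _]]] := pser_geometric cF (cabs_ge0 z) z1.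
have [N0 HN] := geometric_small A q01 e0.
exists N0.+1 => -[//|N] NN; rewrite csums_icoef -mulrBr cabsM.
have cz t : 0 <= t <= 1 -> cabs (t%:C * z) <= cabs z.
  by move=> /andP[t0 t1]; rewrite cabsM cabsR ger0_norm// ler_piMl.
have rc : rcont (fun t => (clamp t)%:C * z).
  apply: rcontM; [apply: rcont_real; exact: continuous_clamp|exact: rcont_cst].
have c1 : rcont (fun t => F ((clamp t)%:C * z)).
  apply: rcont_comp => // t; apply: (holoD_continuous hF).
  exact: le_lt_trans (cz _ (clamp_itv t)) z1.
have c2 : rcont (fun t => csums c ((clamp t)%:C * z) N).
  apply: (rcont_comp (f := fun w => csums c w N)) => // t.
  case: N {NN} => [|N]; last exact: has_cderiv_continuous (has_cderiv_csums _ _ _).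
  by rewrite (_ : (fun w => _) = fun=> 0); [exact: ccont_cst|apply/funext => w; rewrite /csums big_ord0].
rewrite (@eq_cint _ _ _ _ (fun t => F ((clamp t)%:C * z))); last by move=> t /clamp_id ->.
rewrite (@eq_cint _ _ _ (fun t => csums _ _ _) (fun t => csums c ((clamp t)%:C * z) N)); last first.
  by move=> t /clamp_id ->.
rewrite -cintB//.
apply: le_lt_trans (HN N NN).
have b0 : 0 <= A * q ^+ N / (1 - q).
  case/andP: q01 => q0 q1; rewrite divr_ge0 ?mulr_ge0 ?exprn_ge0// subr_ge0; exact: ltW.
have h : cabs (cint 0 1 (fun t => F ((clamp t)%:C * z) - csums c ((clamp t)%:C * z) N)) <=
    A * q ^+ N / (1 - q).
  have := @cabs_cint_le _ 0 1 _ (A * q ^+ N / (1 - q)) ler01 (rcontB c1 c2).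
  rewrite subr0 mulr1; apply => t _.
  exact: (pser_tail N cF (cz _ (clamp_itv t)) z1 A0 q01 HA).
by apply: le_trans (ler_wpM2l (cabs_ge0 z) h) _; rewrite ler_piMl// ltW.
Qed.

Lemma Ig_pser f g : holo f -> holo g -> exists c,
  [/\ pser (icoef c) (Ig g f) 1, Ig g f 0 = 0 &
      forall z, cabs z < 1 -> cderiv (Ig g f) z = cderiv f z * g z].
Proof.
move=> hf hg; have {}hf : holoD 1 f by []. have {}hg : holoD 1 g by [].
have [a af] := holoD_pser ltr01 hf.
have [c hc] := holoD_pser ltr01 (holoDM (pser_holoD (pser_cderiv af)) hg).
have hI := pser_segment_int hc.
exists c; split => //; first by rewrite /Ig mul0r.
move=> z z1; have := pser_cderiv hI.
have -> : dcoef (icoef c) = c.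
  by apply/funext => n; rewrite /dcoef /icoef mulrCA divff ?mulr1// pnatr_eq0.
by move=> h; exact: (pser_unique h hc z1).
Qed.

(** The case d = 1, b = 0, where the kernel is 1. *)
Lemma wbound_m2_le f K lam r : wbound f K lam -> 0 < r < 1 -> m2 f r <= K.
Proof.
move=> wf r01; have := wf r 1 0 r01 ltr01.
rewrite cabs0 subrr lexx powR1 mulr1 => /(_ isT); congr (_ <= _).
rewrite /m2; congr rmean; apply/funext => t.
by rewrite /ker conjc0 mul0r subr0 invr1 cabs1 expr1n mulr1.
Qed.

Lemma in_H2 f V : holo f -> (forall r, 0 < r < 1 -> m2 f r <= V) -> in_Hp 2%:E f.
Proof.
move=> hf HV; split => //=.
have h : (ereal_sup [set hmean 2 f r | r in `]0%R, 1%R[] <= V%:E)%E.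
  apply: ge_ereal_sup => _ [r /= r01 <-]; rewrite in_itv/= in r01.
  have /andP[r0 r1] := r01.
  rewrite hmeanE//; last by rewrite ltW.
  rewrite lee_fin; have := HV r r01; congr (_ <= _); rewrite /m2; congr rmean.
  by apply/funext => t; rewrite powR_mulrn.
case: (ereal_sup _) h => [x||]//=; first by rewrite ltry.
by case: eqP; rewrite ?ltry// ?ltNyr.
Qed.

Lemma Ig_in_H2 f g (G V : R) : holo f -> holo g -> (forall z, cabs z < 1 -> cabs (g z) <= G) ->
  (forall r, 0 < r < 1 -> m2 f r <= V) -> in_Hp 2%:E (Ig g f).
Proof.
move=> hf hg HG HV; have [c [hc _ dc]] := Ig_pser hf hg.
have [a af] := holoD_pser ltr01 (hf : holoD 1 f).
have uv z : cabs z < 1 -> cabs (cderiv (Ig g f) z) <= G * cabs (cderiv f z).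
  by move=> z1; rewrite dc// cabsM mulrC ler_wpM2r ?HG.
have hI : holo (Ig g f) by exact: (pser_holoD hc).
apply: (in_H2 (V := 2 * G ^+ 2 * V)) => // r /andP[r0 r1].
apply: (m2_le_ps2 hc (ltW r0) r1) => N.
apply: le_trans (ps2_mono _ _ (ltW r0) (ltW r1)) _; rewrite ps2_at1.
case: N => [|N].
  have r01 : 0 < r < 1 by rewrite r0.
  have V0 : 0 <= V by exact: le_trans (m2_ge0 f r) (HV r r01).
  by rewrite big_ord0; apply: mulr_ge0 => //; apply: mulr_ge0 => //; exact: sqr_ge0.
rewrite big_ord_recl/= cabs0 expr0n/= add0r.
exact: (lp_compare hc af uv HV).
Qed.

End IgOperator.

(** * Moebius involutions *)

Section Moebius.
Variable R : realType.
Local Notation C := R[i].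
Local Notation cj := (@conjc R).
Implicit Types (a z : C) (f F : C -> C).

Lemma pser_at0 (c : nat -> C) f rho : 0 < rho -> pser c f rho -> f 0 = c 0%N.
Proof.
move=> r0 cf; apply/eqP; rewrite -subr_eq0 -cabs_eq0 eq_le cabs_ge0 andbT.
apply/ler_addgt0Pl => e e0; rewrite addr0; have [|N HN] := cf 0 _ e e0; first by rewrite cabs0.
have := HN N.+1 (leqnSn N); rewrite /csums big_ord_recl expr0 mulr1 big1 ?addr0; first exact: ltW.
by move=> i _; rewrite exprS mul0r mulr0.
Qed.

Lemma zc1 t : zc 1 t = cexpi t :> C.
Proof. by rewrite /zc mul1r. Qed.

Definition mob a z : C := (a - z) * ker a z.

Lemma mob_num a z :
  cabs (a - z) ^+ 2 = cabs (1 - cj a * z) ^+ 2 - (1 - cabs a ^+ 2) * (1 - cabs z ^+ 2).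
Proof. by rewrite !sqr_cabs; case: a => p q; case: z => x y /=; ring. Qed.

Lemma cabs_mob_sqr a z : 1 - cj a * z != 0 ->
  cabs (mob a z) ^+ 2 = 1 - (1 - cabs a ^+ 2) * (1 - cabs z ^+ 2) * cabs (ker a z) ^+ 2.
Proof.
move=> d0; have w0 : cabs (1 - cj a * z) != 0 by rewrite cabs_eq0.
rewrite /mob cabsM exprMn mob_num /ker cabsV.
by move: (cabs (1 - _)) w0 => w w0; field.
Qed.

Lemma mobK a z : cabs a < 1 -> 1 - cj a * z != 0 -> mob a (mob a z) = z.
Proof.
move=> a1 d0; rewrite /mob /ker.
have aa : 1 - cj a * a != 0 by apply: ker_den_neq0; rewrite -expr2 exprn_ilt1.
have -> : 1 - cj a * ((a - z) / (1 - cj a * z)) = (1 - cj a * a) / (1 - cj a * z).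
  by move: (cj a) d0 aa => b d0 aa; field.
by move: (cj a) d0 aa => b d0 aa; field; rewrite d0 aa.
Qed.

Lemma has_cderiv_mob a z : cabs a * cabs z < 1 -> exists l, has_cderiv (mob a) z l.
Proof.
move=> h; eexists; apply: has_cderivM (has_cderiv_ker h).
exact: (has_cderivB (has_cderiv_cst a z) (has_cderiv_id z)).
Qed.

Lemma mob_disc a z : cabs a < 1 -> cabs z < 1 -> cabs (mob a z) < 1.
Proof.
move=> a1 z1; have az : cabs a * cabs z < 1 by rewrite mulr_ilt1.
rewrite -(@expr_lt1 _ 2)// cabs_mob_sqr ?ker_den_neq0// ltrBlDr ltrDl.
apply: mulr_gt0; first by apply: mulr_gt0; rewrite subr_gt0 exprn_ilt1.
by rewrite exprn_gt0// cabs_gt0 invr_eq0 ker_den_neq0.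
Qed.

(** Functions holomorphic in a disc larger than the unit disc must stay so after composition,
    because circle means are taken at radius 1. *)
Lemma mob_radius a (rho : R) : cabs a < 1 -> 1 < rho -> exists2 rho' : R, 1 < rho' &
  cabs a * rho' < 1 /\ forall z, cabs z < rho' -> cabs (mob a z) < rho.
Proof.
move=> a1 r1; set A := cabs a in a1 *; have A0 : 0 <= A by exact: cabs_ge0.
pose m := Num.min 1 (rho ^+ 2 - 1).
have m0 : 0 < m by rewrite lt_min ltr01 subr_gt0 exprn_egt1.
have m1 : m <= 1 by rewrite ge_min lexx.
have mr : m <= rho ^+ 2 - 1 by rewrite ge_min lexx orbT.
(* Past the unit circle |mob a z|^2 - 1 is at most (1 - |a|^2) (x^2 - 1) 4 / (1 - |a|)^2; the 24
   brings this down to (1 + |a|) m / 2, which is below m. *)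
pose x := 1 + (1 - A) * m / 24.
have c0 : 0 < 1 - A by rewrite subr_gt0.
have x1 : 1 < x by rewrite ltrDl divr_gt0// mulr_gt0.
have xA : (1 - A) / 2 <= 1 - A * x.
  have h : A * ((1 - A) * m) <= (1 - A) * 1.
    by rewrite mulrCA ler_wpM2l ?(ltW c0)// mulr_ile1 ?(ltW a1) ?(ltW m0).
  rewrite /x; move: h c0; clear; lra.
exists x => //; split; first by move: xA c0; clear; lra.
move=> z zx.
have wz : (1 - A) / 2 <= cabs (1 - cj a * z).
  apply: le_trans (ker_den_ge a z); apply: le_trans xA _.
  by rewrite lerD2l lerN2 ler_wpM2l// ltW.
have w0 : 0 < cabs (1 - cj a * z) by apply: lt_le_trans wz; rewrite divr_gt0.
have d0 : 1 - cj a * z != 0 by rewrite -cabs_gt0.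
rewrite -(@ltr_pXn2r _ 2)// ?nnegrE//; last by rewrite ltW// (lt_trans ltr01).
rewrite cabs_mob_sqr//.
have kz : cabs (ker a z) ^+ 2 <= 4 / (1 - A) ^+ 2.
  have -> : 4 / (1 - A) ^+ 2 = ((1 - A) / 2) ^- 2 by field; rewrite gt_eqF.
  by rewrite /ker cabsV exprVn lef_pV2 ?posrE ?exprn_gt0 ?divr_gt0// ler_pXn2r ?nnegrE// ltW ?divr_gt0.
have [z1|z1] := leP (cabs z) 1.
  apply: (@le_lt_trans _ _ 1); last by rewrite exprn_egt1.
  rewrite lerBlDr lerDl; apply: mulr_ge0; last exact: sqr_ge0.
  by apply: mulr_ge0; rewrite subr_ge0 exprn_ile1//; exact: ltW.
have zx2 : cabs z ^+ 2 - 1 <= 3 * ((1 - A) * m / 24).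
  have : cabs z <= x := ltW zx. rewrite /x.
  have : 0 < (1 - A) * m / 24 by rewrite divr_gt0// mulr_gt0.
  have : (1 - A) * m / 24 <= 1.
    by rewrite ler_pdivrMr// mul1r (le_trans (y := 1))// ?ler1n// mulr_ile1 ?(ltW c0) ?(ltW m0)// lerBlDr lerDl.
  move: z1; move: (cabs z) (_ / 24) => y e; clear; nra.
have z20 : 0 <= cabs z ^+ 2 - 1 by rewrite subr_ge0 exprn_ege1// ltW.
have -> : 1 - (1 - A ^+ 2) * (1 - cabs z ^+ 2) * cabs (ker a z) ^+ 2 =
  1 + (1 - A ^+ 2) * ((cabs z ^+ 2 - 1) * cabs (ker a z) ^+ 2) by ring.
rewrite -ltrBrDl; apply: (lt_le_trans _ mr).
apply: (@le_lt_trans _ _ ((1 - A ^+ 2) * (3 * ((1 - A) * m / 24) * (4 / (1 - A) ^+ 2)))).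
  rewrite ler_wpM2l ?subr_ge0 ?exprn_ile1// ?(ltW a1)//.
  by apply: ler_pM => //; exact: sqr_ge0.
have -> : (1 - A ^+ 2) * (3 * ((1 - A) * m / 24) * (4 / (1 - A) ^+ 2)) = (1 + A) / 2 * m.
  by field; rewrite gt_eqF.
by rewrite gtr_pMl// ltr_pdivrMr// mul1r; move: a1; clear; lra.
Qed.

(** On the circle mob a e^(it) = - e^(it) conj(w) / w with w = 1 - conj(a) e^(it). Since Re w > 0,
    the angle t + pi - 2 arg w is a global smooth lift; its derivative is the Poisson kernel, and it
    advances by 2 pi over a period. *)
Lemma circle_subst a (h : C -> R) : cabs a < 1 -> continuous (fun t => h (cexpi t)) ->
  continuous (fun t => h (mob a (cexpi t))) ->
  rmean (fun t => h (mob a (cexpi t)) * ((1 - cabs a ^+ 2) * cabs (ker a (cexpi t)) ^+ 2)) =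
  rmean (fun t => h (cexpi t)).
Proof.
move=> a1 ch chm; congr (_ * _).
have [H dH HE] := antiderivative ch.
pose p := complex.Re a; pose q := complex.Im a.
pose X (t : R) := 1 - (p * cos t + q * sin t); pose Y (t : R) := q * cos t - p * sin t.
have wE t : 1 - cj a * cexpi t = X t +i* Y t.
  by rewrite /X /Y /p /q; case: (a) => x y; apply: complex_eq; rewrite /cexpi /=; ring.
have aE : cabs a ^+ 2 = p ^+ 2 + q ^+ 2 by rewrite sqr_cabs.
have X0 t : 0 < X t.
  have := Re_le_cabs (cj a * cexpi t); rewrite cabsM cabs_conj cabs_cexpi mulr1 => h1.
  have : complex.Re (cj a * cexpi t) = 1 - X t by rewrite -[cj a * _](subKr 1) wE/= /X; ring.
  move=> E; rewrite E in h1; have := le_lt_trans h1 a1.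
  by rewrite ltr_norml => /andP[_]; lra.
(* The lift of the boundary map; [X] and [Y] are the real and imaginary parts of w, and arg w =
   atan(Y / X). *)
pose psi t := t + pi - 2 * atan (Y t / X t).
have N0 t : 0 < X t ^+ 2 + Y t ^+ 2 by rewrite ltr_wpDr ?sqr_ge0// exprn_gt0.
have kE t : cabs (ker a (cexpi t)) ^+ 2 = (X t ^+ 2 + Y t ^+ 2)^-1.
  by rewrite /ker wE cabsV exprVn sqr_cabs.
have dX (t : R) : is_derive t 1 X (- Y t).
  by apply: is_derive_eq; rewrite /Y /GRing.scale/=; ring.
have dY (t : R) : is_derive t 1 Y (X t - 1).
  by apply: is_derive_eq; rewrite /X /GRing.scale/=; ring.
have dpsi (t : R) : is_derive t 1 psi ((1 - cabs a ^+ 2) * cabs (ker a (cexpi t)) ^+ 2).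
  have X0t := X0 t; have xn : X t != 0 by rewrite gt_eqF.
  have dv := is_deriveV xn (dX t).
  have dq := is_deriveM (dY t) dv.
  have da := @is_derive1_comp _ (@atan R) (fun t => Y t / X t) t _ _ (is_derive1_atan _) dq.
  rewrite /psi; have db := is_derive_cM 2 da.
  have dt : is_derive t 1 (fun t => t + pi) 1 by apply: is_derive_eq; rewrite addr0.
  have dd := is_deriveB dt db.
  suff -> : (1 - cabs a ^+ 2) * cabs (ker a (cexpi t)) ^+ 2 =
    1 - 2 * ((1 + (Y t / X t) ^+ 2)^-1 *
       (Y t *: (- X t ^- 2 *: - Y t) + (X t)^-1 *: (X t - 1))) by exact: dd.
  rewrite kE aE /GRing.scale/=.
  have E : p ^+ 2 + q ^+ 2 = (X t - 1) ^+ 2 + Y t ^+ 2.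
    rewrite /X /Y; have := cos2Dsin2 t; move: (cos t) (sin t) => c s cs.
    have -> : (1 - (p * c + q * s) - 1) ^+ 2 + (q * c - p * s) ^+ 2 =
      (p ^+ 2 + q ^+ 2) * (c ^+ 2 + s ^+ 2) by ring.
    by rewrite cs mulr1.
  rewrite E; move: (X t) (Y t) (N0 t) xn => x y n xn.
  by field; rewrite xn ?gt_eqF//; rewrite addrC -expr2 -expr2 in n *.
have mE t : mob a (cexpi t) = cexpi (psi t).
  have X0t := X0 t; have xn : X t != 0 by rewrite gt_eqF.
  pose al := atan (Y t / X t).
  have sE : sin al = Y t / X t * cos al by rewrite /al sin_atan.
  have cE : cos al ^+ 2 = X t ^+ 2 / (X t ^+ 2 + Y t ^+ 2).
    rewrite /al cos_atan_sqr; move: (X t) (Y t) (N0 t) xn => x y n xn.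
    have nn : x ^+ 2 + y ^+ 2 != 0 by rewrite gt_eqF.
    by field; rewrite xn ?nn ?[y ^+ 2 + _]addrC ?nn.
  have psiE : psi t = t + (pi + (- al + - al)) by rewrite /psi -/al; ring.
  have pE : cexpi (pi : R) = -1 :> C by apply: complex_eq; rewrite /cexpi/= ?cospi ?sinpi ?oppr0.
  rewrite psiE (cexpiD t) (cexpiD pi) (cexpiD (- al)) pE.
  have E2 : cexpi (- al) * cexpi (- al) = cj (1 - cj a * cexpi t) / (1 - cj a * cexpi t) :> C.
    rewrite wE -[X t +i* Y t in RHS]/(X t +i* Y t) -[RHS]mulr1.
    have wn : X t +i* Y t != 0 :> C by apply/eqP => -[/eqP]; rewrite (negPf xn).
    apply: (mulIf wn); rewrite mulr1 divfK//.
    apply: complex_eq; rewrite /cexpi /= !cosN !sinN sE;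
      move: cE; move: (cos al) (X t) (Y t) (N0 t) xn => c x y n xn cE;
      have nn : x ^+ 2 + y ^+ 2 != 0 by rewrite gt_eqF.
      have -> : (c * c - - (y / x * c) * - (y / x * c)) * x - (c * - (y / x * c) + - (y / x * c) * c) * y =
        c ^+ 2 * ((x ^+ 2 + y ^+ 2) / x) by field.
      by rewrite cE; field; rewrite xn ?nn ?[y ^+ 2 + _]addrC ?nn.
    have -> : (c * c - - (y / x * c) * - (y / x * c)) * y + (c * - (y / x * c) + - (y / x * c) * c) * x =
      - c ^+ 2 * (y * (x ^+ 2 + y ^+ 2) / x ^+ 2) by field.
    by rewrite cE; field; rewrite xn ?nn ?[y ^+ 2 + _]addrC ?nn.
  rewrite E2 mulrA mulrN1 /mob /ker mulrA; congr (_ / _).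
  have e1 : cexpi t * cj (cexpi t) = 1 by rewrite mul_conj cabs_cexpi expr1n.
  have -> : cj (1 - cj a * cexpi t) = 1 - a * cj (cexpi t).
    by case: (a) => x y; apply: complex_eq; rewrite /cexpi/=; ring.
  by rewrite mulNr mulrBr mulr1 mulrCA e1 mulr1 opprB.
have cc : continuous (fun t => h (mob a (cexpi t)) * ((1 - cabs a ^+ 2) * cabs (ker a (cexpi t)) ^+ 2)).
  have ck : rcont (fun t => ker a (cexpi t)).
    by under eq_fun do rewrite -zc1; apply: rcont_ker; rewrite ?mulr1.
  move=> t; apply: cvgM; first exact: chm.
  by apply: cvgM; [exact: cvg_cst|exact: (continuous_m2 ck)].
have dHp (t : R) : is_derive t 1 (fun t => H (psi t))
    (h (mob a (cexpi t)) * ((1 - cabs a ^+ 2) * cabs (ker a (cexpi t)) ^+ 2)).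
  by rewrite mE; exact: (@is_derive1_comp _ H psi t _ _ (dH (psi t)) (dpsi t)).
rewrite (rint_FTC cc dHp (twopi_ge0 R)).
have pp t : psi (t + 2 * pi) = psi t + 2 * pi.
  rewrite /psi /X /Y mulr_natl cosD2pi sinD2pi -mulr_natl; ring.
have := pp 0; rewrite add0r => ->.
rewrite -HE ?lerDl ?twopi_ge0//; apply: rint_period => //; first exact: twopi_ge0.
by move=> t; rewrite cexpi_2pi.
Qed.

Lemma holoD_mob f rho rho' a : holoD rho f -> cabs a * rho' < 1 ->
  (forall z, cabs z < rho' -> cabs (mob a z) < rho) -> holoD rho' (fun z => f (mob a z)).
Proof.
move=> hf ar mr z zr; have [|l hl] := @has_cderiv_mob a z.
  by apply: le_lt_trans ar; rewrite ler_wpM2l// ltW.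
have [m hm] := hf _ (mr z zr); eexists; exact: has_cderiv_comp hl hm.
Qed.

Lemma m2_mob f rho a : 1 < rho -> holoD rho f -> cabs a < 1 ->
  m2 (fun z => f (mob a z)) 1 =
  (1 - cabs a ^+ 2) * rmean (fun t => cabs (f (zc 1 t)) ^+ 2 * cabs (ker a (zc 1 t)) ^+ 2).
Proof.
move=> r1 hf a1.
have ck : rcont (fun t => ker a (zc 1 t)) by apply: rcont_ker; rewrite ?mulr1.
have cf : rcont (fun t => f (zc 1 t)) by apply: (rcont_circle hf).
have d0 t : 1 - cj a * cexpi t != 0 by apply: ker_den_neq0; rewrite cabs_cexpi mulr1.
have [rho' r1' [ar mr]] := mob_radius a1 r1.
have hm := holoD_mob hf ar mr.
have cm : rcont (fun t => f (mob a (zc 1 t))) by apply: (rcont_circle hm).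
have cfk : continuous (fun t => cabs (f (zc 1 t)) ^+ 2 * cabs (ker a (zc 1 t)) ^+ 2).
  by move=> t; apply: cvgM; [exact: (continuous_m2 cf)|exact: (continuous_m2 ck)].
rewrite -rmeanZ//.
have := @circle_subst a (fun z => cabs (f (mob a z)) ^+ 2) a1.
have -> : (fun t => cabs (f (mob a (cexpi t))) ^+ 2) = (fun t => cabs (f (mob a (zc 1 t))) ^+ 2).
  by apply/funext => t; rewrite zc1.
have -> : (fun t => cabs (f (mob a (mob a (cexpi t)))) ^+ 2) = (fun t => cabs (f (zc 1 t)) ^+ 2).
  by apply/funext => t; rewrite mobK// zc1.
move=> /(_ (continuous_m2 cm) (continuous_m2 cf)); rewrite /m2 => <-.
congr rmean; apply/funext => t; rewrite mobK// zc1; ring.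
Qed.

(** The involution carries a to 0 and the Poisson weight to the uniform one. The chain rule gives
    both derivatives the same factor, so |F'| <= G |f'| survives, and subtracting F(a) removes the
    constant term that [lp_compare] does not see. *)
Lemma mobius_compare f F (G rho : R) a : 1 < rho -> holoD rho f -> holoD rho F ->
  (forall z, cabs z < 1 -> cabs (cderiv F z) <= G * cabs (cderiv f z)) -> cabs a < 1 ->
  rmean (fun t => cabs (F (zc 1 t) - F a) ^+ 2 * cabs (ker a (zc 1 t)) ^+ 2) <=
  2 * G ^+ 2 * rmean (fun t => cabs (f (zc 1 t)) ^+ 2 * cabs (ker a (zc 1 t)) ^+ 2).
Proof.
move=> r1 hf hF fF a1.
have hF' : holoD rho (fun z => F z - F a) by apply: holoDB => //; exact: holoD_cst.
have [rho' r1' [ar mr]] := mob_radius a1 r1.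
have p0 : 0 < 1 - cabs a ^+ 2 by rewrite subr_gt0 exprn_ilt1.
have hv := holoD_mob hf ar mr; have hu := holoD_mob hF' ar mr.
rewrite -(ler_pM2l p0) [leRHS]mulrCA -(m2_mob r1 hf a1) -(m2_mob r1 hF' a1).
set u := fun z => _ in hu *; set v := fun z => _ in hv *.
have r0' : 0 < rho' := lt_trans ltr01 r1'.
have [b bu] := holoD_pser r0' hu; have [c cv] := holoD_pser r0' hv.
have b0 : b 0%N = 0.
  rewrite -(pser_at0 r0' bu) /u /mob subr0 /ker mulr0 subr0 invr1 mulr1; exact: subrr.
have HV r : 0 < r < 1 -> m2 v r <= m2 v 1.
  move=> /andP[rr0 rr1]; apply: (m2_le_ps2 cv (ltW rr0) (lt_trans rr1 r1')) => N.
  apply: le_trans (ps2_mono _ _ (ltW rr0) (ltW rr1)) _.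
  exact: (ps2_le_m2 N cv ler01 r1').
have bu1 := pserS (ltW r1') bu; have cv1 := pserS (ltW r1') cv.
have uv z : cabs z < 1 -> cabs (cderiv u z) <= G * cabs (cderiv v z).
  move=> z1; have az : cabs a * cabs z < 1 by rewrite mulr_ilt1.
  have [l hl] := has_cderiv_mob az; have m1 := mob_disc a1 z1.
  have mrho := lt_trans m1 r1.
  have h1 := has_cderivB (holoD_cderiv hF mrho) (has_cderiv_cst (F a) (mob a z)).
  rewrite subr0 in h1.
  rewrite (cderivE (has_cderiv_comp hl h1)) (cderivE (has_cderiv_comp hl (holoD_cderiv hf mrho))).
  by rewrite !cabsM mulrA ler_wpM2r// fF.
have HN := lp_compare bu1 cv1 uv HV.
apply: (m2_le_ps2 bu ler01 r1') => -[|N]; rewrite ps2_at1.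
  rewrite big_ord0; apply: mulr_ge0; last exact: m2_ge0.
  by apply: mulr_ge0 => //; exact: sqr_ge0.
by rewrite big_ord_recl/= b0 cabs0 expr0n/= add0r; exact: HN.
Qed.

(** Dilating by s makes both functions holomorphic in radius 1/s > 1. On the arc the kernel at the
    box point is at least 1 / ((2 + 2 pi) d), so the weighted oscillation over the circle controls
    the oscillation on the arc. *)
Lemma arc_osc f F (G K lam s : R) (I : Defs.arc R) : holoD 1 f -> holoD 1 F -> wbound f K lam ->
  (forall z, cabs z < 1 -> cabs (cderiv F z) <= G * cabs (cderiv f z)) -> 0 < s < 1 ->
  rint (arc_start I) (arc_start I + arc_len I)
    (fun t => cabs (F (zc s t) - F (s%:C * box_pt I)) ^+ 2) <=
  4 * pi * (2 + 2 * pi) ^+ 2 * G ^+ 2 * K * arc_size I `^ lam.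
Proof.
move=> hf hF wf fF s01; have /andP[s0 s1] := s01.
have d0 := arc_size_gt0 I; have d1 := arc_size_le1 I; set d := arc_size I in d0 d1 *.
set a := box_pt I; have p0 := pi_gt0 R.
have aE : cabs a = 1 - d := cabs_box_pt I.
have a1 : cabs a < 1 by rewrite aE ltrBlDr ltrDl.
have sC : cabs s%:C * s^-1 <= 1 :> R by rewrite cabsR gtr0_norm// divff// gt_eqF.
have r1 : 1 < s^-1 by rewrite invf_gt1.
have hfs := holoD_dilate hf sC; have hFs := holoD_dilate hF sC.
have fFs z : cabs z < 1 -> cabs (cderiv (fun z => F (s%:C * z)) z) <=
    G * cabs (cderiv (fun z => f (s%:C * z)) z).
  move=> z1; have sz : cabs (s%:C * z) < 1 by rewrite cabsM cabsR gtr0_norm// mulr_ilt1// ltW.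
  by rewrite !(cderiv_dilate (rho := 1))// !cabsM mulrCA ler_wpM2l ?fF.
have := mobius_compare r1 hfs hFs fFs a1.
have sE t : s%:C * zc 1 t = zc s t :> C by rewrite zc1.
rewrite (_ : (fun t : R => cabs (F (s%:C * zc 1 t) - _) ^+ 2 * _) = (fun t =>
    cabs (F (zc s t) - F (s%:C * a)) ^+ 2 * cabs (ker a (zc 1 t)) ^+ 2)); last first.
  by apply/funext => t; rewrite sE.
rewrite (_ : (fun t : R => cabs (f (s%:C * zc 1 t)) ^+ 2 * _) = (fun t =>
    cabs (f (zc s t)) ^+ 2 * cabs (ker a (zc 1 t)) ^+ 2)); last first.
  by apply/funext => t; rewrite sE.
move=> H.
have W := wf s d a s01 d0; rewrite aE lexx in W; have {}W := W isT.
have {W}H : rmean (fun t => cabs (F (zc s t) - F (s%:C * a)) ^+ 2 * cabs (ker a (zc 1 t)) ^+ 2) <=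
    2 * G ^+ 2 * (K * d `^ (lam - 2)).
  by apply: le_trans H _; apply: ler_wpM2l => //; apply: mulr_ge0 => //; exact: sqr_ge0.
have cF : rcont (fun t => F (zc s t) - F (s%:C * a)).
  by apply: rcontB; [apply: (rcont_circle hF) => //; exact: ltW|exact: rcont_cst].
have ck : rcont (fun t => ker a (zc 1 t)) by apply: rcont_ker; rewrite ?mulr1.
set q := fun t => cabs (F (zc s t) - F (s%:C * a)) ^+ 2.
have cq : continuous q := continuous_m2 cF.
set w := fun t => _ in H.
have cw : continuous w.
  by move=> t; apply: cvgM; [exact: cq|exact: (continuous_m2 ck)].
have w0 t : 0 <= w t by apply: mulr_ge0; exact: sqr_ge0.
pose B : R := ((2 + 2 * pi) * d) ^+ 2.
have P0 : 0 <= 2 + 2 * pi :> R by rewrite addr_ge0// mulr_ge0// ltW.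
have cBw : continuous (fun t => B * w t) by move=> t; apply: cvgM; [exact: cvg_cst|exact: cw].
apply: (@le_trans _ _ (rint (arc_start I) (arc_start I + arc_len I) (fun t => B * w t))).
  apply: rint_le => // t tI.
  have den : cabs (1 - cj a * zc 1 t) <= (2 + 2 * pi) * d.
    by apply: arc_den => //; rewrite lexx andbT lerBlDr lerDl; exact: ltW.
  have kp : 0 < cabs (1 - cj a * zc 1 t).
    by rewrite cabs_gt0 ker_den_neq0// zc1 cabs_cexpi mulr1.
  rewrite /w mulrCA; apply: ler_peMr; first exact: sqr_ge0.
  rewrite /B /ker cabsV exprVn ler_pdivlMr ?exprn_gt0// mul1r ler_pXn2r ?nnegrE//.
  by apply: mulr_ge0 => //; exact: ltW.
rewrite rintZ//.
have wp t : w (t + 2 * pi) = w t by rewrite /w !zc_period.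
have wI : rint (arc_start I) (arc_start I + arc_len I) w <= 2 * pi * rmean w.
  have -> : 2 * pi * rmean w = rint (arc_start I) (arc_start I + 2 * pi) w.
    have tp : 2 * pi != 0 :> R by rewrite lt0r_neq0// twopi_gt0.
    by rewrite (rint_period (arc_start I) cw (twopi_ge0 R) wp) /rmean mulrA divff// mul1r.
  rewrite (rint_split (b := arc_start I + arc_len I) (c := arc_start I + 2 * pi) cw) ?lerD2l ?arc_len_le// ?lerDl ?(ltW (arc_len_gt0 I))//.
  by apply: rint_ge0 => t _.
apply: (@le_trans _ _ (B * (2 * pi * (2 * G ^+ 2 * (K * d `^ (lam - 2)))))).
  apply: ler_wpM2l; first exact: sqr_ge0.
  apply: le_trans wI _; apply: ler_wpM2l => //; exact: twopi_ge0.
rewrite le_eqVlt; apply/orP; left; apply/eqP.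
have -> : d `^ lam = d `^ (lam - 2) * d ^+ 2.
  by rewrite -(powR_mulrn 2 (ltW d0)) -powRD ?subrK// (gt_eqF d0) implybT.
by rewrite /B; ring.
Qed.

End Moebius.

(** * Radial limits *)

Section RadialMaximal.
Variable R : realType.
Local Notation C := R[i].
Local Notation cj := (@conjc R).
Local Notation mu := (@lebesgue_measure R).
Implicit Types (E F : C -> C) (b : nat -> C).

Lemma is_derive_val (f : R -> R) (x l l' : R) : is_derive x 1 f l -> l = l' -> is_derive x 1 f l'.
Proof. by move=> + <-. Qed.

(** With s = 4 v, 1 - cos s = 2 sin(2 v)^2, and v <= sin(2 v) follows from v cos v <= sin v and 2
    cos(v)^2 >= 1. This leaves s^2 / 8; the 9 makes the bound the square of s / 3. *)
Lemma one_sub_cos_ge (s : R) : 0 <= s <= pi -> s ^+ 2 / 9 <= 1 - cos s.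
Proof.
move=> /andP[s0 spi]; have p0 := pi_gt0 R.
have vc (v : R) : 0 <= v <= pi -> v * cos v <= sin v.
  move=> /andP[v0 vp].
  have dS (x : R) : is_derive x 1 (fun x => sin x - x * cos x) (x * sin x).
    by apply: is_derive_eq; rewrite /GRing.scale/=; ring.
  have cS : continuous (fun x : R => x * sin x).
    by move=> x; apply: cvgM; [exact: cvg_id|exact: continuous_sin].
  have := rint_FTC cS dS v0; rewrite mul0r sin0 !subr0 => h.
  rewrite -subr_ge0 -h; apply: rint_ge0 => t /andP[t0 tv]; rewrite mulr_ge0//.
  by rewrite sin_ge0_pi// t0 (le_trans tv).
pose v := s / 4; have sE : s = v *+ 2 *+ 2 by rewrite -mulrnA -mulr_natr divfK// pnatr_eq0.
have v0 : 0 <= v by rewrite divr_ge0.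
have vE : v *+ 2 = v + v by exact: mulr2n.
have vp : v *+ 2 <= pi / 2.
  by move: spi; rewrite sE; move: (v *+ 2) (pi : R) => w P; rewrite mulr2n; clear; lra.
have vpi : v <= pi by move: vp v0 p0; rewrite vE; move: (pi : R); clear; move=> P; lra.
have c2 : 0 <= cos (v *+ 2).
  apply: cos_ge0_pihalf; rewrite vp andbT; move: v0 p0; rewrite vE; move: (pi : R); clear.
  by move=> P; lra.
have cv0 : 0 <= cos v.
  apply: cos_ge0_pihalf; apply/andP; split; move: vp v0 p0; rewrite vE; move: (pi : R); clear;
    by move=> P; lra.
have hv : v * cos v <= sin v by apply: vc; rewrite v0.
rewrite sE cos_mulr2n.
have cs := cos2Dsin2 v.
have c2E : cos (v *+ 2) = 2 * cos v ^+ 2 - 1 by rewrite cos_mulr2n; ring.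
have h1 : 1 <= 2 * cos v ^+ 2 by move: c2; rewrite c2E; clear; lra.
have h2 : v <= sin v *+ 2 * cos v.
  move: hv cv0 h1 v0; move: (cos v) (sin v) => c q; rewrite mulr2n; clear => hv c0 h1 v0.
  have : v * c * c <= q * c by rewrite ler_wpM2r.
  by move: (ler_wpM2l v0 h1); rewrite expr2; lra.
have cs2 := cos2Dsin2 (v *+ 2); rewrite sin_mulr2n in cs2.
move: cs2 h2; rewrite !mulr2n; move: (cos (v + v)) (cos v) (sin v) v0 => x c q v0; clear -v0.
move=> cs2 h2; have : v ^+ 2 <= ((q + q) * c) ^+ 2 by rewrite ler_pXn2r// nnegrE (le_trans v0).
move: cs2 v0; nra.
Qed.

(** The right side is (1 - r)^2 + 2 r (1 - cos s), and 2 r >= 1. *)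
Lemma poisson_den (r s : R) : 2^-1 <= r <= 1 -> - pi <= s <= pi ->
  (1 - r) ^+ 2 + (s / 3) ^+ 2 <= cabs (1 - r%:C * cexpi s) ^+ 2.
Proof.
move=> /andP[r0 r1] /andP[s0 s1].
have h : s ^+ 2 / 9 <= 1 - cos s.
  have [sp|sn] := leP 0 s; first by apply: one_sub_cos_ge; rewrite sp.
  have := @one_sub_cos_ge (- s); rewrite sqrrN cosN; apply.
  by rewrite oppr_ge0 (ltW sn) lerNl.
have c1 := cos_le1 s; have cs := cos2Dsin2 s.
rewrite sqr_cabs /cexpi /=; move: h c1 cs; move: (cos s) (sin s) => c q h c1 cs.
have -> : (1 - (r * c - 0 * q)) ^+ 2 + (0 - (r * q + 0 * c)) ^+ 2 =
  1 - 2 * r * c + r ^+ 2 * (c ^+ 2 + q ^+ 2) by ring.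
by rewrite cs; nra.
Qed.

(* Integration by parts against the decreasing majorant [kap] of the kernel. *)
Lemma poisson_max (h : R -> R) (x r M : R) : continuous h -> (forall t, 0 <= h t) ->
  (forall t, h (t + 2 * pi) = h t) -> 2^-1 <= r < 1 ->
  (forall s, 0 < s <= pi -> rint (x - s) (x + s) h <= 2 * s * M) ->
  (1 - r ^+ 2) * rmean (fun t => h t * cabs (ker (zc r x) (zc 1 t)) ^+ 2) <= 3 * M.
Proof.
move=> ch h0 hp /andP[r0 r1] HM; have p0 := pi_gt0 R.
have rp : 0 < r by apply: lt_le_trans r0; rewrite invr_gt0.
pose e := 1 - r; have e0 : 0 < e by rewrite subr_gt0.
(* Even, decreasing in |s|, and by [poisson_den] a majorant of |1 - r e^(is)|^(-2) on [- pi, pi]. *)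
pose kap (s : R) := (e ^+ 2 + (s / 3) ^+ 2)^-1.
have den0 s : 0 < e ^+ 2 + (s / 3) ^+ 2 by rewrite ltr_wpDr ?sqr_ge0// exprn_gt0.
have kap0 s : 0 < kap s by rewrite invr_gt0.
pose Q (s : R) := e ^+ 2 + (s / 3) ^+ 2.
have Qn s : Q s != 0 by exact: lt0r_neq0 (den0 s).
have dQ (s : R) : is_derive s 1 Q (2 * s / 9).
  by apply: is_derive_eq; rewrite /GRing.scale/=; field.
have dkap (s : R) : is_derive s 1 kap (- (2 * s / 9) * kap s ^+ 2).
  apply: (is_derive_val (is_deriveV (Qn s) (dQ s))).
  by rewrite /GRing.scale/= /kap exprVn; ring.
have der_cont (g g' : R -> R) : (forall x : R, is_derive x 1 g (g' x)) -> continuous g.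
  by move=> dg y; apply: differentiable_continuous; apply/derivable1_diffP; case: (dg y).
have ckap := der_cont _ _ dkap.
pose Kp (s : R) := 3 / e * atan (s / (3 * e)).
have dKp (s : R) : is_derive s 1 Kp (kap s).
  have d1 : is_derive s 1 (fun s => s / (3 * e)) (3 * e)^-1.
    by apply: is_derive_eq; rewrite /GRing.scale/=; field; rewrite lt0r_neq0.
  apply: (is_derive_val (is_derive_cM (3 / e) (@is_derive1_comp _ (@atan R) _ s _ _ (is_derive1_atan _) d1))).
  have en := lt0r_neq0 e0; rewrite /kap.
  have -> : e ^+ 2 + (s / 3) ^+ 2 = e ^+ 2 * (1 + (s / (3 * e)) ^+ 2) by field.
  have : 1 + (s / (3 * e)) ^+ 2 != 0 by rewrite lt0r_neq0// ltr_wpDr ?sqr_ge0.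
  by move: (1 + _) => Z Zn; rewrite !invfM; field; rewrite Zn en.
have [H dH HE] := antiderivative ch.
have ckx : continuous (fun t => kap (t - x)).
  move=> t; apply: (continuous_comp (f := fun t => t - x)); last exact: ckap.
  by apply: cvgB; [exact: cvg_id|exact: cvg_cst].
have chk : continuous (fun t => h t * kap (t - x)).
  by move=> t; apply: cvgM; [exact: ch|exact: ckx].
have [A dA AE] := antiderivative chk.
have dp (s : R) : is_derive s 1 (fun s => x + s) 1.
  by apply: (is_derive_val (is_deriveD (is_derive_cst x s (1 : R)) (is_derive_id s (1 : R))));
    rewrite add0r.
have dm (s : R) : is_derive s 1 (fun s => x - s) (- 1).
  by apply: (is_derive_val (is_deriveB (is_derive_cst x s (1 : R)) (is_derive_id s (1 : R))));
    rewrite sub0r.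
pose U (s : R) := H (x + s) - H (x - s); pose u (s : R) := h (x + s) + h (x - s).
have dU (s : R) : is_derive s 1 U (u s).
  apply: (is_derive_val (is_deriveB (@is_derive1_comp _ H _ s _ _ (dH _) (dp s))
    (@is_derive1_comp _ H _ s _ _ (dH _) (dm s)))).
  by rewrite /u; ring.
pose W (s : R) := A (x + s) - A (x - s).
have dW (s : R) : is_derive s 1 W (u s * kap s).
  apply: (is_derive_val (is_deriveB (@is_derive1_comp _ A _ s _ _ (dA _) (dp s))
    (@is_derive1_comp _ A _ s _ _ (dA _) (dm s)))).
  have -> : x + s - x = s by ring. have -> : x - s - x = - s by ring.
  have -> : kap (- s) = kap s by rewrite /kap mulNr sqrrN.
  by rewrite /u; ring.
(* The hypothesis on the averages of h says exactly that D is nonpositive on [0, pi]. *)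
pose D (s : R) := U s - 2 * M * s.
have dD (s : R) : is_derive s 1 D (u s - 2 * M).
  apply: (is_derive_val (is_deriveB (dU s) (is_derive_cM (2 * M) (is_derive_id s (1 : R))))).
  by rewrite mulr1.
have D0 s : 0 <= s <= pi -> D s <= 0.
  move=> /andP[s0 sp]; rewrite /D /U; move: s0; rewrite le_eqVlt => /predU1P[<-|s0].
    by rewrite addr0 subr0 subrr mulr0 subr0.
  have := HM s; rewrite s0 sp => /(_ isT); rewrite HE; last by move: s0; clear; lra.
  by rewrite subr_le0 [2 * s * M]mulrAC.
(* Its derivative is D times kap', a product of nonpositive factors, so 0 = Psi(0) <= Psi(pi). This
   bounds W(pi) by 2 M Kp(pi), and Kp(pi) by (3 / e) (pi / 2). *)
pose Psi (s : R) := 2 * M * Kp s + D s * kap s - W s.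
have dPsi (s : R) : is_derive s 1 Psi (D s * (- (2 * s / 9) * kap s ^+ 2)).
  apply: (is_derive_val (is_deriveB (is_deriveD (is_derive_cM (2 * M) (dKp s))
    (is_deriveM (dD s) (dkap s))) (dW s))).
  by rewrite /GRing.scale/=; ring.
have cPsi : continuous (fun s => D s * (- (2 * s / 9) * kap s ^+ 2)).
  have cD := der_cont _ _ dD.
  move=> s; apply: cvgM; first exact: cD.
  apply: cvgM; last exact: (sqr_cont ckap).
  apply: cvgN; apply: cvgM; last exact: cvg_cst.
  by apply: cvgM; [exact: cvg_cst|exact: cvg_id].
have h1 : 0 <= Psi pi - Psi 0.
  rewrite -(rint_FTC cPsi dPsi (ltW p0)); apply: rint_ge0 => s s01.
  rewrite mulNr mulrN -mulNr mulr_ge0 ?oppr_ge0 ?D0//.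
  case/andP: s01 => s0 _; rewrite mulr_ge0 ?sqr_ge0// divr_ge0// mulr_ge0//.
have Psi0 : Psi 0 = 0.
  by rewrite /Psi /Kp /D /U /W ?mul0r atan0 ?addr0 ?subr0 ?subrr ?mulr0 ?subr0 ?subrr ?mul0r ?addr0.
have Kpi : Kp pi <= 3 / e * (pi / 2).
  by rewrite /Kp ler_wpM2l ?divr_ge0 ?ltW// atan_ltpi2.
have M0 : 0 <= M.
  have := HM pi; rewrite p0 lexx => /(_ isT) hh.
  have : 0 <= 2 * pi * M by apply: le_trans hh; apply: rint_ge0 => t _.
  by rewrite pmulr_rge0// twopi_gt0.
have Wpi : W pi <= 3 * pi * M / e.
  have Dk : D pi * kap pi <= 0 by rewrite mulr_le0_ge0 ?D0 ?(ltW p0) ?lexx// ltW.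
  have MK : 2 * M * Kp pi <= 2 * M * (3 / e * (pi / 2)) by rewrite ler_wpM2l// mulr_ge0.
  have -> : 3 * pi * M / e = 2 * M * (3 / e * (pi / 2)) by field; rewrite lt0r_neq0.
  by move: h1; rewrite Psi0 subr0 /Psi; move: Dk MK; clear; lra.
have kE t : cabs (ker (zc r x) (zc 1 t)) ^+ 2 = (cabs (1 - r%:C * cexpi (t - x)) ^+ 2)^-1.
  rewrite /ker cabsV exprVn; congr ((cabs (1 - _) ^+ 2)^-1).
  have cr (y : R) : cj y%:C = y%:C by apply: complex_eq => //=; rewrite oppr0.
  by rewrite zc1 /zc cconjM cr -cexpiN cexpiD [cexpi t * _]mulrC mulrA.
have zr : cabs (zc r x) * 1 < 1 by rewrite cabs_zc gtr0_norm// mulr1.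
have ck := rcont_ker zr ler01.
have chk2 : continuous (fun t => h t * cabs (ker (zc r x) (zc 1 t)) ^+ 2).
  by move=> t; apply: cvgM; [exact: ch|exact: (continuous_m2 ck)].
have pp t : h (t + 2 * pi) * cabs (ker (zc r x) (zc 1 (t + 2 * pi))) ^+ 2 =
    h t * cabs (ker (zc r x) (zc 1 t)) ^+ 2 by rewrite hp zc_period.
have I1 : rint 0 (2 * pi) (fun t => h t * cabs (ker (zc r x) (zc 1 t)) ^+ 2) <= W pi.
  rewrite -(rint_period (x - pi) chk2 (twopi_ge0 R) pp).
  have -> : x - pi + 2 * pi = x + pi by ring.
  rewrite /W -AE; last by move: p0; clear; lra.
  apply: rint_le => // t /andP[t1 t2]; apply: ler_wpM2l => //.
  rewrite kE /kap lef_pV2 ?posrE//.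
    by apply: poisson_den; rewrite ?r0 ?(ltW r1)// ?lerBrDr ?lerBlDr; apply/andP; split;
      move: t1 t2; clear; lra.
  have pd := @poisson_den r (t - x); apply: (lt_le_trans (den0 (t - x))); apply: pd.
    by rewrite r0 ltW.
  by apply/andP; split; move: t1 t2; clear; lra.
rewrite /rmean mulrCA.
apply: (@le_trans _ _ ((2 * pi)^-1 * ((1 - r ^+ 2) * (3 * pi * M / e)))).
  rewrite ler_wpM2l ?invr_ge0 ?twopi_ge0//; apply: ler_wpM2l.
    by rewrite subr_ge0 exprn_ile1 ?ltW.
  exact: le_trans Wpi.
have -> : (2 * pi)^-1 * ((1 - r ^+ 2) * (3 * pi * M / e)) = (1 + r) / 2 * (3 * M).
  rewrite /e; have e1 : 1 - r != 0 by rewrite lt0r_neq0.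
  by move: (pi : R) p0 => P P0; field; rewrite e1 lt0r_neq0.
apply: ler_piMl; first by rewrite mulr_ge0.
by move: r1; clear; lra.
Qed.

(** The covering set is where the maximal function of |E|^2 on the circle of radius rho exceeds c;
    off it the averages are at most c, and [poisson_max] with [sub_poisson] bounds |E|^2 by 3 c
    along the radius. *)
Lemma maximal_cover E (V x0 c rho : R) : holoD 1 E -> (forall r, 0 < r < 1 -> m2 E r <= V) ->
  0 < c -> 0 < rho < 1 -> exists W : set R, [/\ measurable W, (mu W <= (12 * pi * V / c)%:E)%E &
    forall x r, x0 <= x <= x0 + 2 * pi -> 2^-1 <= r < 1 ->
      3 * c < cabs (E (zc (rho * r) x)) ^+ 2 -> W x].
Proof.
move=> hE HV c0 rho01; have /andP[rho0 rho1] := rho01; have p0 := pi_gt0 R.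
pose h t := cabs (E (zc rho t)) ^+ 2.
have ch : continuous h by apply: continuous_m2; exact: (rcont_circle hE (ltW rho0) rho1).
have h0 t : 0 <= h t by exact: sqr_ge0.
have hp t : h (t + 2 * pi) = h t by rewrite /h zc_period.
(* Balls of radius at most pi about points of [x0, x0 + 2 pi] stay in J, whose length is two
   periods; times the factor 3 of the maximal inequality this gives 12 pi. *)
pose J := `[x0 - pi, x0 + 3 * pi]%classic.
pose f : R -> R := h \_ J.
have fE x : J x -> f x = h x by move=> Jx; rewrite /f patchE mem_set.
have f0 x : 0 <= f x by rewrite /f patchE; case: ifP.
have fint : mu.-integrable setT (EFin \o f).
  have mJ : measurable (J : set (measurableTypeR R)) by exact: measurable_itv.
  by rewrite /f -restrict_EFin; apply: (proj1 (integrable_mkcond _ mJ)); exact: cont_integrable.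
have floc : locally_integrable setT f by apply: open_integrable_locally => //; exact: openT.
exists [set x | (HL_maximal f x > c%:E)%E]; split.
- rewrite -[X in measurable X]setTI; apply: emeasurable_fun_o_infty => //.
  exact: measurable_HL_maximal.
- apply: le_trans (maximal_inequality floc c0) _.
  have -> : (\int[mu]_y `|(f y)%:E| = (4 * pi * m2 E rho)%:E)%E.
    transitivity (\int[mu]_(y in J) (h y)%:E)%E.
      rewrite [RHS]integral_mkcond; apply: eq_integral => y _.
      by rewrite /f !patchE; case: ifP => _; rewrite /= ?normr0// ger0_norm.
    rewrite integral_rint//; congr (_%:E).
    have -> : x0 + 3 * pi = x0 + pi + 2 * pi by ring.
    rewrite (rint_split (b := x0 + pi) ch); [|by move: p0; clear; lra|by rewrite lerDl twopi_ge0].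
    rewrite (rint_period _ ch (twopi_ge0 R) hp).
    have -> : x0 + pi = x0 - pi + 2 * pi by ring.
    rewrite (rint_period _ ch (twopi_ge0 R) hp) /m2 /rmean -/h.
    have : 2 * pi != 0 :> R by exact: lt0r_neq0 (twopi_gt0 R).
    have -> : 4 * pi = 2 * (2 * pi) :> R by ring.
    by move: (2 * pi) => P Pn; field.
  rewrite -EFinM lee_fin.
  have -> : 12 * pi * V / c = 3 / c * (4 * pi * V) by ring.
  by apply: ler_wpM2l; [rewrite divr_ge0// ltW|apply: ler_wpM2l; [rewrite mulr_ge0// ltW|exact: HV]].
move=> x r xI r01; apply: contraTT => /negP; rewrite -leNgt => Wx.
have {}Wx : (HL_maximal f x <= c%:E)%E by rewrite leNgt; apply/negP.
have HM s : 0 < s <= pi -> rint (x - s) (x + s) h <= 2 * s * c.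
  move=> /andP[s0 sp].
  have h1 : (iavg f (ball x s) <= c%:E)%E.
    by apply: le_trans Wx; apply: ereal_sup_ubound; exists s => //=; rewrite in_itv/= s0.
  have h2 : (\int[mu]_(y in ball x s) `|(f y)%:E| = (rint (x - s) (x + s) h)%:E)%E.
    rewrite -integral_rint// ball_itv (integral_itv_bndoo true false); last first.
      by apply: measurable_funTS; apply/measurable_EFinP; exact: continuous_measurable_fun.
    apply: eq_integral => y; rewrite inE/= in_itv/= => /andP[y1 y2].
    rewrite /= fE ?ger0_norm//= /J/= in_itv/=; case/andP: xI => x1 x2.
    by apply/andP; split; move: y1 y2 x1 x2 s0 sp; clear; lra.
  move: h1; rewrite /iavg h2 lebesgue_measure_ball ?(ltW s0)// inver.
  have s2 : 0 < s *+ 2 by rewrite mulrn_wgt0.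
  rewrite gt_eqF// -EFinM lee_fin mulrC ler_pdivrMr// => h1.
  by apply: le_trans h1 _; rewrite mulrC mulr2n le_eqVlt; apply/orP; left; apply/eqP; ring.
have H := poisson_max ch h0 hp r01 HM.
apply: le_trans H.
have /andP[r0 r1] := r01; have rp : 0 < r by apply: lt_le_trans r0; rewrite invr_gt0.
have sC : cabs rho%:C * rho^-1 <= 1 :> R by rewrite cabsR gtr0_norm// divff// gt_eqF.
have hs := holoD_dilate hE sC.
have a1 : cabs (zc r x) < 1 by rewrite cabs_zc gtr0_norm.
have rr1 : 1 < rho^-1 by rewrite invf_gt1.
have := sub_poisson rr1 hs a1; rewrite cabs_zc (gtr0_norm rp).
have zE (u t : R) : rho%:C * zc u t = zc (rho * u) t :> C by rewrite /zc rmorphM/= mulrA.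
rewrite zE (_ : (fun t : R => cabs (E (rho%:C * zc 1 t)) ^+ 2 * _) =
  (fun t => h t * cabs (ker (zc r x) (zc 1 t)) ^+ 2))//.
by apply/funext => t; rewrite zE mulr1.
Qed.

(** The intersections over n >= m increase with m, and each lies in some [B n] of measure at most
    c. *)
Lemma mu_liminf (B : nat -> set R) (c : \bar R) : (forall n, measurable (B n)) ->
  (forall m, exists2 n, (m <= n)%N & (mu (B n) <= c)%E) ->
  measurable (\bigcup_m \bigcap_(n in [set n | (m <= n)%N]) B n) /\
  (mu (\bigcup_m \bigcap_(n in [set n | (m <= n)%N]) B n) <= c)%E.
Proof.
move=> mB HB; pose D m := \bigcap_(n in [set n | (m <= n)%N]) B n.
have mD m : measurable (D m) by apply: bigcap_measurable => [|n _]; [exists m => /=|exact: mB].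
have mU : measurable (\bigcup_m D m) by exact: bigcup_measurable.
split => //.
have nd : nondecreasing_seq D.
  move=> m n mn; apply/subsetPset => x Dx k /= nk; apply: Dx => /=; exact: leq_trans nk.
have cv := @nondecreasing_cvg_mu _ _ _ mu D mD mU nd.
rewrite -(cvg_lim _ cv)//; apply: lime_le; first by apply/cvg_ex; eexists; exact: cv.
apply: nearW => m /=; have [n mn h] := HB m; apply: le_trans h.
have sub : D m `<=` B n by move=> x; apply.
by apply: le_measure => //; rewrite inE; [exact: mD|exact: mB].
Qed.

(** Let rho tend to 1: a point at radius r is at radius r / rho_n relative to the circle of radius
    rho_n, so a bad x lies in all late covering sets, hence in their lower limit, whose measure
    obeys the same bound. *)
Lemma maximal_cover_disc E (V x0 c : R) : holoD 1 E -> (forall r, 0 < r < 1 -> m2 E r <= V) ->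
  0 < c -> exists W : set R, [/\ measurable W, (mu W <= (12 * pi * V / c)%:E)%E &
    forall x r, x0 <= x <= x0 + 2 * pi -> 2^-1 < r < 1 -> 3 * c < cabs (E (zc r x)) ^+ 2 -> W x].
Proof.
move=> hE HV c0.
pose rho n : R := 1 - n.+2%:R^-1.
have rho01 n : 0 < rho n < 1.
  by rewrite /rho subr_gt0 ltrBlDr ltrDl invr_gt0 ltr0n andbT invf_lt1// ltr1n.
have /choice[W HW] := fun n => maximal_cover x0 hE HV c0 (rho01 n).
have [mW lW] := @mu_liminf W (12 * pi * V / c)%:E (fun n => let: And3 h _ _ := HW n in h)
  (fun m => ex_intro2 _ _ m (leqnn m) (let: And3 _ h _ := HW m in h)).
exists (\bigcup_m \bigcap_(n in [set n | (m <= n)%N]) W n); split => // x r xI /andP[r0 r1] hx.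
have e0 : 0 < 1 - r by rewrite subr_gt0.
have [m _ Hm] := near_infty_natSinv_lt (PosNum e0).
exists m => // n /= mn; have [_ _ /(_ x (r / rho n) xI)] := HW n; apply; last first.
  rewrite [rho n * _]mulrC divfK; first exact: hx.
  by case/andP: (rho01 n) => h _; rewrite gt_eqF.
have /andP[h1 h2] := rho01 n.
have rn : r < rho n.
  rewrite /rho ltrBrDr -ltrBrDl; apply: le_lt_trans (Hm n mn).
  by rewrite lef_pV2 ?posrE// ler_nat.
rewrite ltr_pdivrMr// mul1r rn andbT ler_pdivlMr//.
by apply: le_trans (ltW r0); rewrite ler_piMr ?invr_ge0// ltW.
Qed.

(** The bounded partial sums of |b_n|^2 come within e of their supremum; the rest is the squared
    mean of the Taylor remainder. *)
Lemma coef_tail_small b F (V e : R) : pser b F 1 -> (forall r, 0 < r < 1 -> m2 F r <= V) -> 0 < e ->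
  exists N, forall r, 0 < r < 1 -> m2 (fun z => F z - csums b z N) r <= e.
Proof.
move=> bF HV e0.
pose S N := \sum_(n < N) cabs (b n) ^+ 2.
have SV N : S N <= V := sum_coef_le N bF HV.
have hs : has_sup (range S).
  by split; [exists (S 0%N), 0%N|exists V => _ [n _ <-]].
have [_ [N _ <-] HN] := sup_adherent e0 hs.
exists N => r /andP[r0 r1].
pose b' n := if (n < N)%N then 0 else b n.
have csE z M : (N <= M)%N -> csums b' z M = csums b z M - csums b z N.
  move=> NM; rewrite /csums -!(big_mkord predT (fun n => _ n * z ^+ n)).
  rewrite (big_cat_nat (leq0n N) NM)//= [X in X + _ = _]big1_seq ?add0r; last first.
    by move=> n /=; rewrite mem_index_iota => /andP[_ nN]; rewrite /b' nN mul0r.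
  rewrite [in RHS](big_cat_nat (leq0n N) NM)//= addrAC subrr add0r.
  by apply: eq_big_nat => n /andP[Nn _]; rewrite /b' ltnNge Nn.
have bE : pser b' (fun z => F z - csums b z N) 1.
  move=> z z1 e1 e10; have [M HM] := bF z z1 e1 e10.
  exists (maxn M N) => n; rewrite geq_max => /andP[Mn Nn].
  rewrite csE//; have := HM n Mn; congr (cabs _ < _); ring.
apply: (m2_le_ps2 bE (ltW r0) r1) => M.
apply: le_trans (ps2_mono _ _ (ltW r0) (ltW r1)) _; rewrite ps2_at1.
have [MN|NM] := leqP M N.
  rewrite big1 ?ltW// => n _; rewrite /b' (leq_trans (ltn_ord n) MN) cabs0 expr0n//.
have SM : S M <= sup (range S) by apply: ub_le_sup; [exact: hs.2|exists M].
have : \sum_(n < M) cabs (b' n) ^+ 2 = S M - S N.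
  rewrite /S -!(big_mkord predT (fun n => cabs (_ n) ^+ 2)).
  rewrite (big_cat_nat (leq0n N) (ltnW NM))//= [X in X + _ = _]big1_seq ?add0r; last first.
    by move=> n /=; rewrite mem_index_iota => /andP[_ nN]; rewrite /b' nN cabs0 expr0n.
  rewrite [X in _ = X - _](big_cat_nat (leq0n N) (ltnW NM))//= addrAC subrr add0r.
  by apply: eq_big_nat => n /andP[Nn _]; rewrite /b' ltnNge Nn.
by move=> ->; move: SM HN; clear; lra.
Qed.

(** Off a set of small measure F stays, along the whole radius, close to a Taylor polynomial, which
    is continuous up to the circle. The exceptional set is the lower limit of these sets: a point
    outside it escapes infinitely many of them, and its measure is 0 because theirs tend to 0. *)
Lemma radial_cauchy b F (V x0 : R) : pser b F 1 -> (forall r, 0 < r < 1 -> m2 F r <= V) ->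
  exists N : set R, [/\ measurable N, mu N = 0%E &
    forall x, x0 <= x <= x0 + 2 * pi -> ~ N x -> forall e, 0 < e ->
      exists2 r0, r0 < 1 & forall r s, r0 < r < 1 -> r0 < s < 1 -> cabs (F (zc r x) - F (zc s x)) < e].
Proof.
move=> bF HV; have hF := pser_holoD bF.
pose ep k : R := k.+1%:R^-1.
have ep0 k : 0 < ep k by rewrite invr_gt0.
have cov k : exists W : set R, [/\ measurable W, (mu W <= (12 * pi * ep k)%:E)%E &
    forall x, x0 <= x <= x0 + 2 * pi -> ~ W x -> exists N, forall r, 2^-1 < r < 1 ->
      cabs (F (zc r x) - csums b (zc r x) N) ^+ 2 <= 3 * ep k].
  (* A remainder of squared mean ep^2, covered at level ep, leaves a set of measure at most 12 pi
     ep. *)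
  have [N HN] := coef_tail_small bF HV (mulr_gt0 (ep0 k) (ep0 k)).
  have hE : holoD 1 (fun z => F z - csums b z N).
    apply: holoDB => // z _; case: N {HN} => [|N].
      by exists 0; apply: (has_cderiv_ext _ (has_cderiv_cst 0 z)) => w; rewrite /csums big_ord0.
    by eexists; exact: has_cderiv_csums.
  have [W [mW lW HW]] := maximal_cover_disc x0 hE HN (ep0 k).
  exists W; split => //.
    apply: le_trans lW _; rewrite lee_fin mulrA mulfK// gt_eqF//.
  move=> x xI Wx; exists N => r r01; rewrite leNgt; apply/negP => h; apply: Wx.
  exact: HW xI r01 h.
have /choice[W HW] := cov.
have e_small (e : R) : 0 < e -> exists m, forall k, (m <= k)%N -> ep k < e.
  by move=> e0; have [m _ Hm] := near_infty_natSinv_lt (PosNum e0); exists m => k mk; exact: Hm.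
have mW n : measurable (W n) by case: (HW n).
have lim0 (e : R) : 0 < e -> forall m, exists2 n, (m <= n)%N & (mu (W n) <= e%:E)%E.
  move=> e0 m; have p0 := pi_gt0 R.
  have e1 : 0 < e / (12 * pi) by rewrite divr_gt0// mulr_gt0.
  have [m' Hm'] := e_small _ e1; exists (maxn m m'); first exact: leq_maxl.
  have [_ lW _] := HW (maxn m m'); apply: le_trans lW _; rewrite lee_fin.
  by rewrite -ler_pdivlMl ?mulr_gt0// mulrC ltW// Hm'// leq_maxr.
exists (\bigcup_m \bigcap_(n in [set n | (m <= n)%N]) W n); split.
- by have [] := mu_liminf mW (lim0 1 ltr01).
- apply/eqP; rewrite eq_le measure_ge0 andbT; apply/lee_addgt0Pr => e e0; rewrite add0e.
  by have [] := mu_liminf mW (lim0 e e0).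
move=> x xI Nx e e0.
(* Makes 3 ep k < (e/4)^2, so that F and the polynomial differ by at most e/4; the polynomial varies
   by less than e/8 on either side of its boundary value. *)
pose e4 := (e / 4) ^+ 2 / 3.
have e40 : 0 < e4 by rewrite divr_gt0// exprn_gt0// divr_gt0.
have [m Hm] := e_small _ e40.
have [k mk Wk] : exists2 k, (m <= k)%N & ~ W k x.
  apply: contrapT => h; apply: Nx; exists m => // k /= mk.
  by apply: contrapT => Wk; apply: h; exists k.
have [_ _ /(_ x xI Wk)[N HN]] := HW k.
have {}HN r : 2^-1 < r < 1 -> cabs (F (zc r x) - csums b (zc r x) N) <= e / 4.
  move=> /HN h; have h2 : cabs (F (zc r x) - csums b (zc r x) N) ^+ 2 <= (e / 4) ^+ 2.
    apply: le_trans h _; have := Hm k mk; rewrite /e4; move: ((e / 4) ^+ 2) => q; clear; lra.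
  by rewrite -(@ler_pXn2r _ 2)// nnegrE// divr_ge0// ltW.
have cc : rcont (fun r => csums b (zc r x) N).
  apply: (rcont_comp (h := fun r => zc r x) (f := fun z => csums b z N)).
    by apply: rcontM; [apply: rcont_real => y; exact: cvg_id|exact: rcont_cst].
  move=> r; case: N {HN} => [|N]; last exact: has_cderiv_continuous (has_cderiv_csums _ _ _).
  by rewrite (_ : (fun w => _) = fun=> 0); [exact: ccont_cst|apply/funext => w; rewrite /csums big_ord0].
have e8 : 0 < e / 8 by rewrite divr_gt0.
have := (rcontP _).1 cc 1 _ e8; move=> /nbhs_ballP[d /= d0 Hd].
exists (Num.max 2^-1 (1 - d)).
  by rewrite gt_max invf_lt1// ltr1n/= ltrBlDr ltrDl.
have nr r : Num.max 2^-1 (1 - d) < r < 1 -> 2^-1 < r < 1 /\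
    cabs (csums b (zc r x) N - csums b (zc 1 x) N) < e / 8.
  rewrite gt_max => /andP[/andP[r2 rd] r1]; split; first by rewrite r2.
  apply: Hd; rewrite /ball/= ger0_norm ?subr_ge0 ?ltW//.
  by move: rd; clear; lra.
move=> r s /nr[/HN hr1 hr2] /nr[/HN hs1 hs2].
move: hr1 hr2 hs1 hs2.
move: (csums b (zc r x) N) (csums b (zc s x) N) (csums b (zc 1 x) N) (F (zc r x)) (F (zc s x)).
clear -e0 => p q o u v hr1 hr2 hs1 hs2.
have -> : u - v = (u - p) + ((p - o) + ((o - q) + (q - v))) by rewrite !addrA !subrK.
rewrite cabsB in hs1; rewrite cabsB in hs2.
apply: le_lt_trans (cabsD _ _) _; apply: le_lt_trans (lerD (lexx _) (cabsD _ _)) _.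
apply: le_lt_trans (lerD (lexx _) (lerD (lexx _) (cabsD _ _))) _.
move: hr1 hr2 hs1 hs2; move: (cabs (u - p)) (cabs (p - o)) (cabs (o - q)) (cabs (q - v)).
by clear -e0 => A B D E; lra.
Qed.

End RadialMaximal.

(** * Boundary values *)

Section BoundaryValues.
Variable R : realType.
Local Notation C := R[i].
Local Notation mu := (@lebesgue_measure R).
Implicit Types (E F : C -> C) (b : nat -> C).

(** Radii increasing to 1 from 1/2: Fatou's lemma asks for a sequence, whereas [bval] is a limit
    along a filter. *)
Definition sq (n : nat) : R := 1 - n.+2%:R^-1.

Lemma sq01 n : 0 < sq n < 1.
Proof. by rewrite /sq subr_gt0 ltrBlDr ltrDl invr_gt0 ltr0n andbT invf_lt1// ltr1n. Qed.

Lemma sq_near (d : R) : 0 < d -> \forall n \near \oo, 1 - d < sq n.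
Proof.
move=> d0; have [m _ Hm] := near_infty_natSinv_lt (PosNum d0).
exists m => // n /= mn; rewrite /sq ltrD2l ltrN2; apply: le_lt_trans (Hm n mn).
by rewrite lef_pV2 ?posrE// ler_nat.
Qed.

Lemma lim_left_sq (h : R -> R) :
  (forall e, 0 < e -> exists2 r0, r0 < 1 &
     forall r s, r0 < r < 1 -> r0 < s < 1 -> `|h r - h s| < e) ->
  (fun n => h (sq n)) @ \oo --> lim (h @ at_left (1 : R)).
Proof.
move=> H.
have cv : cvg (h @ at_left (1 : R)).
  apply: cauchy_cvg; apply: cauchy_exP => e e0; have [r0 r01 Hr] := H e e0.
  exists (h ((r0 + 1) / 2)).
  suff : \forall r \near at_left (1 : R), `|h ((r0 + 1) / 2) - h r| < e by [].
  have := nbhs_left_gt r01; apply: filterS2 (nbhs_left_lt 1) => r r2 r1.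
  apply: Hr; last by rewrite r1.
  by apply/andP; split; move: r01; clear; lra.
apply/cvgrPdist_lt => e e0; have := (proj1 (cvgrPdist_lt _ _) cv) e e0.
move=> [d /= d0 Hd]; have := sq_near d0; apply: filterS => n nd.
have /andP[s0 s1] := sq01 n.
apply: Hd => //=; rewrite ger0_norm ?subr_ge0 ?ltW//.
by move: nd; clear; lra.
Qed.

Lemma bval_cvg F (x : R) :
  (forall e, 0 < e -> exists2 r0, r0 < 1 &
     forall r s, r0 < r < 1 -> r0 < s < 1 -> cabs (F (zc r x) - F (zc s x)) < e) ->
  ((fun n => complex.Re (F (zc (sq n) x))) @ \oo --> complex.Re (bval F (cexpi x))) /\
  ((fun n => complex.Im (F (zc (sq n) x))) @ \oo --> complex.Im (bval F (cexpi x))).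
Proof.
move=> H; split.
  apply: (@lim_left_sq (fun r => complex.Re (F (zc r x)))) => e e0.
  have [r0 r01 Hr] := H e e0; exists r0 => // r s hr hs; apply: le_lt_trans (Hr r s hr hs).
  by rewrite -raddfB; exact: Re_le_cabs.
apply: (@lim_left_sq (fun r => complex.Im (F (zc r x)))) => e e0.
have [r0 r01 Hr] := H e e0; exists r0 => // r s hr hs; apply: le_lt_trans (Hr r s hr hs).
by rewrite -raddfB; exact: Im_le_cabs.
Qed.

(** |y| <= y^2 / (2 T) + T / 2 with T = sqrt A0 does the work of Cauchy-Schwarz, and its right side
    also provides the integrability of h. *)
Lemma mean_dist (al l c A0 : R) (h : R -> R) : 0 < l -> 0 < A0 ->
  measurable_fun `[al, al + l] h ->
  (\int[mu]_(t in `[al, (al + l)%R]) ((h t - c) ^+ 2)%:E <= (l * A0)%:E)%E ->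
  (l^-1 * rint al (al + l) h - c) ^+ 2 <= A0.
Proof.
move=> l0 A00 mh Hh; set D := `[al, al + l]%classic.
have mD : measurable (D : set (measurableTypeR R)) by exact: measurable_itv.
have muD : (mu D = l%:E)%E.
  by rewrite /D lebesgue_measure_itv/= lte_fin ltrDl l0 -EFinD addrAC subrr add0r.
have icst (k : R) : mu.-integrable D (EFin \o cst k).
  by apply: cont_integrable; exact: cst_continuous.
pose T := Num.sqrt A0; have T0 : 0 < T by rewrite sqrtr_gt0.
have TT : T ^+ 2 = A0 by rewrite sqr_sqrtr// ltW.
have mhc : measurable_fun D (fun t => h t - c) by apply: measurable_funB.
have msq : measurable_fun D (fun t => (h t - c) ^+ 2) by exact: measurable_funX.
have isq : mu.-integrable D (EFin \o (fun t => (h t - c) ^+ 2)).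
  apply/integrableP; split; first exact/measurable_EFinP.
  apply: le_lt_trans (ltry (l * A0)); apply: le_trans Hh.
  by apply: integral_mono => t _; rewrite ?abse_ge0//= ger0_norm ?sqr_ge0.
pose q t := (2 * T)^-1 * (h t - c) ^+ 2 + T / 2.
have iq : mu.-integrable D (EFin \o q).
  have := integrableD mD (integrableZl mD (2 * T)^-1 isq) (icst (T / 2)).
  by apply: eq_integrable => // t _; rewrite /= EFinD EFinM.
have hq t : `|h t - c| <= q t.
  rewrite /q -(real_normK (num_real (h t - c))); move: `|_| => y.
  rewrite -subr_ge0 (_ : _ - _ = (2 * T)^-1 * (y - T) ^+ 2).
    by rewrite mulr_ge0 ?sqr_ge0// invr_ge0 mulr_ge0// ltW.
  by field; exact: lt0r_neq0.
have ihc : mu.-integrable D (EFin \o (fun t => h t - c)).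
  apply: le_integrable iq => //; first exact/measurable_EFinP.
  by move=> t _; rewrite /= lee_fin; apply: le_trans (hq t) (ler_norm _).
have ih : mu.-integrable D (EFin \o h).
  have := integrableD mD ihc (icst c).
  by apply: eq_integrable => // t _; rewrite /= -EFinD subrK.
have Rc (k : R) : Rintegral mu D (cst k) = k * l.
  have := @rint_cst _ al (al + l) k; rewrite lerDl (ltW l0) => /(_ isT).
  by rewrite [al + l - al]addrAC subrr add0r.
have E1 : rint al (al + l) h - l * c = Rintegral mu D (fun t => h t - c).
  by rewrite (RintegralB mD ih (icst c)) Rc [l * c]mulrC.
have E2 : `|rint al (al + l) h - l * c| <= l * T.
  rewrite E1; apply: le_trans (le_normr_Rintegral mD ihc) _.
  apply: (@le_trans _ _ (Rintegral mu D q)).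
    apply: le_Rintegral => //.
    by have := integrable_norm ihc; apply: eq_integrable.
  rewrite /q (RintegralD mD (integrableZl mD (2 * T)^-1 isq) (icst (T / 2))) Rc.
  rewrite RintegralZl//.
  have : Rintegral mu D (fun t => (h t - c) ^+ 2) <= l * A0.
    rewrite /Rintegral -lee_fin fineK//; exact: integrable_fin_num isq.
  rewrite -TT => hh.
  have : (2 * T)^-1 * Rintegral mu D (fun t => (h t - c) ^+ 2) <= (2 * T)^-1 * (l * T ^+ 2).
    by rewrite ler_wpM2l// invr_ge0 mulr_ge0// ltW.
  have -> : (2 * T)^-1 * (l * T ^+ 2) = l * T / 2 by field; exact: lt0r_neq0.
  move: (_ * Rintegral _ _ _) => X hX; have -> : T / 2 * l = l * T / 2 by ring.
  by move: hX; move: (l * T) => Y; clear; lra.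
have -> : l^-1 * rint al (al + l) h - c = l^-1 * (rint al (al + l) h - l * c).
  by rewrite mulrBr mulKf ?gt_eqF.
rewrite -TT -(real_normK (num_real (_ * _))) ler_pXn2r ?nnegrE//; last exact: ltW.
by rewrite normrM gtr0_norm ?invr_gt0// ler_pdivrMl.
Qed.

(** Meant for [bval], which is arbitrary on a null set and equals a measurable function off it;
    measurability is asked of g alone. *)
Lemma ge0_integral_eq_off (D N : set R) (f g : R -> \bar R) : measurable D -> measurable N ->
  mu N = 0%E -> measurable_fun D g -> (forall x, 0 <= f x)%E -> (forall x, 0 <= g x)%E ->
  (forall x, D x -> ~ N x -> f x = g x) ->
  (\int[mu]_(x in D) f x = \int[mu]_(x in D) g x)%E.
Proof.
move=> mD mN N0 mg f0 g0 fg; apply/eqP; rewrite eq_le; apply/andP; split.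
  apply: integral_mono_ae => //; exists N; split => // x /= h.
  by apply: contrapT => Nx; apply: h => Dx; rewrite fg.
rewrite (@ge0_negligible_integral _ _ _ mu D N)//.
apply: integral_mono_restrict => // x; rewrite !patchE.
case: ifPn => [/set_mem[Dx Nx]|_]; first by rewrite mem_set// fg.
by case: ifP.
Qed.

Lemma integral_eq_off (D N : set R) (f g : R -> \bar R) : measurable D -> measurable N ->
  mu N = 0%E -> measurable_fun D g -> (forall x, D x -> ~ N x -> f x = g x) ->
  (\int[mu]_(x in D) f x = \int[mu]_(x in D) g x)%E.
Proof.
move=> mD mN N0 mg fg; rewrite integralE [RHS]integralE; congr (_ - _)%E.
  apply: (ge0_integral_eq_off (N := N)) => //; first exact: measurable_funepos.
  by move=> x Dx Nx; rewrite !funeposE fg.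
apply: (ge0_integral_eq_off (N := N)) => //; first exact: measurable_funeneg.
by move=> x Dx Nx; rewrite !funenegE fg.
Qed.

Lemma arc_lenM_avg (I : Defs.arc R) (h : C -> C) : arc_avg I h =
  ((arc_len I)^-1 * rint (arc_start I) (arc_start I + arc_len I) (fun t => complex.Re (bval h (cexpi t)))) +i*
  ((arc_len I)^-1 * rint (arc_start I) (arc_start I + arc_len I) (fun t => complex.Im (bval h (cexpi t)))).
Proof.
have p0 := lt0r_neq0 (twopi_gt0 R); have l0 := lt0r_neq0 (arc_len_gt0 I).
rewrite /arc_avg /arc_cint mulrA -rmorphM/=.
have -> : (arc_size I)^-1 * (2 * pi)^-1 = (arc_len I)^-1.
  by rewrite /arc_size; move: (2 * pi) p0 => P p0; field; rewrite p0 l0.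
by apply: complex_eq; rewrite ?cReM ?cImM /cint/= mul0r ?subr0 ?addr0.
Qed.

Lemma limn_einf_le (u : nat -> \bar R) (B : \bar R) : (forall n, u n <= B)%E -> (limn_einf u <= B)%E.
Proof.
move=> uB; rewrite limn_einf_lim; apply: lime_le; first exact: is_cvg_einfs.
apply: nearW => n; apply: le_trans (uB n).
by apply: ereal_inf_lbound; exists n => /=.
Qed.

(** Fatou along the radii [sq] n carries the oscillation about cs n to the oscillation of the
    boundary values about c; replacing c by the arc average costs a constant factor. *)
Lemma arc_bval_osc b F (V A0 : R) (c : C) (cs : nat -> C) (I : Defs.arc R) : pser b F 1 ->
  (forall r, 0 < r < 1 -> m2 F r <= V) -> 0 < A0 ->
  ((fun n => complex.Re (cs n)) @ \oo --> complex.Re c) ->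
  ((fun n => complex.Im (cs n)) @ \oo --> complex.Im c) ->
  (forall n, rint (arc_start I) (arc_start I + arc_len I)
     (fun t => cabs (F (zc (sq n) t) - cs n) ^+ 2) <= arc_len I * A0) ->
  (\int[mu]_(t in `[arc_start I, (arc_start I + arc_len I)%R])
     (cabs (bval F (cexpi t) - arc_avg I F) ^+ 2)%:E <= (6 * (arc_len I * A0))%:E)%E.
Proof.
move=> bF HV A00 csR csI HI; have hF := pser_holoD bF.
have l0 := arc_len_gt0 I; have ll := arc_len_le I.
set al := arc_start I in HI *; set l := arc_len I in HI l0 ll *.
have [N [mN N0 HN]] := radial_cauchy al bF HV.
set D := `[al, al + l]%classic.
have mD : measurable (D : set (measurableTypeR R)) by exact: measurable_itv.
have cvb t : D t -> ~ N t ->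
  ((fun n => complex.Re (F (zc (sq n) t))) @ \oo --> complex.Re (bval F (cexpi t))) /\
  ((fun n => complex.Im (F (zc (sq n) t))) @ \oo --> complex.Im (bval F (cexpi t))).
  rewrite /D/= in_itv/= => /andP[t1 t2] Nt; apply: bval_cvg => e e0; apply: (HN t _ Nt e e0).
  by rewrite t1 (le_trans t2)// lerD2l.
have cF n : rcont (fun t => F (zc (sq n) t)).
  by have /andP[s0 s1] := sq01 n; exact: (rcont_circle hF (ltW s0) s1).
have mI : measurable_fun setT (fun t : R => 1 - \1_N t : R).
  by apply: measurable_funB => //; exact: measurable_indic.
(* The boundary values set to 0 on the null set: a pointwise limit of continuous functions times an
   indicator, hence measurable. *)
pose bt (p : C -> R) t := (1 - \1_N t) * p (bval F (cexpi t)).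
have btE p t : ~ N t -> bt p t = p (bval F (cexpi t)).
  by move=> Nt; rewrite /bt indicE memNset// subr0 mul1r.
have mbt p : (forall n, continuous (fun t => p (F (zc (sq n) t)))) ->
    (forall t, D t -> ~ N t -> (fun n => p (F (zc (sq n) t))) @ \oo --> p (bval F (cexpi t))) ->
    measurable_fun D (bt p).
  move=> cp cvp; apply: (@measurable_fun_cvg _ _ _ D (fun n t => (1 - \1_N t) * p (F (zc (sq n) t)))).
    move=> n; apply: measurable_funTS; apply: measurable_funM => //.
    by apply: continuous_measurable_fun; exact: cp.
  move=> t Dt; have [Nt|Nt] := pselect (N t).
    by rewrite /bt indicE mem_set// subrr mul0r; under eq_fun do rewrite mul0r; exact: cvg_cst.
  by apply: cvgM; [exact: cvg_cst|exact: cvp].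
have mR : measurable_fun D (bt (@complex.Re R)).
  by apply: mbt => [n|t Dt Nt]; [exact: (cF n).1|exact: (cvb t Dt Nt).1].
have mIm : measurable_fun D (bt (@complex.Im R)).
  by apply: mbt => [n|t Dt Nt]; [exact: (cF n).2|exact: (cvb t Dt Nt).2].
pose q t := (bt (@complex.Re R) t - complex.Re c) ^+ 2 + (bt (@complex.Im R) t - complex.Im c) ^+ 2.
have mq : measurable_fun D q.
  by apply: measurable_funD; apply: measurable_funX; apply: measurable_funB.
have q0 t : 0 <= q t by rewrite addr_ge0 ?sqr_ge0.
pose k n t := (cabs (F (zc (sq n) t) - cs n) ^+ 2)%:E.
have mk n : measurable_fun D (k n).
  apply: measurable_funTS; apply/measurable_EFinP; apply: continuous_measurable_fun.
  by apply: continuous_m2; apply: rcontB; [exact: cF|exact: rcont_cst].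
have k0 n t : (0 <= k n t)%E by rewrite lee_fin sqr_ge0.
have Hq : (\int[mu]_(t in D) (q t)%:E <= (l * A0)%:E)%E.
  apply: (@le_trans _ _ (\int[mu]_(t in D) limn_einf (k ^~ t))%E).
    apply: integral_mono_ae => //.
    - apply: (emeasurable_fun_cvg (fun n t => einfs (k ^~ t) n)) => [n|t Dt].
        exact: measurable_fun_einfs.
      by rewrite limn_einf_lim; exact: is_cvg_einfs.
    - by move=> t _; rewrite lee_fin.
    - move=> t _; rewrite limn_einf_lim; apply: lime_ge; first exact: is_cvg_einfs.
      by apply: nearW => n; apply: le_ereal_inf_tmp => _ [m _ <-].
    exists N; split => // t /= h; apply: contrapT => Nt; apply: h => Dt.
    have [c1 c2] := cvb t Dt Nt.
    have ck : k ^~ t @ \oo --> (q t)%:E.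
      apply: cvg_EFin; first exact: nearW.
      rewrite (_ : _ \o _ = fun n => (complex.Re (F (zc (sq n) t)) - complex.Re (cs n)) ^+ 2 +
        (complex.Im (F (zc (sq n) t)) - complex.Im (cs n)) ^+ 2); last first.
        by apply/funext => n; rewrite /k/= sqr_cabs !raddfB.
      rewrite /q !btE//; apply: cvgD; under eq_fun do rewrite expr2; rewrite expr2;
        by apply: cvgM; exact: cvgB.
    by have [-> _] := cvg_limn_einf_sup ck.
  apply: le_trans (@fatou _ _ _ mu D mD k mk (fun n t _ => k0 n t)) _.
  apply: limn_einf_le => n; rewrite integral_rint ?lee_fin; first exact: HI.
  by apply: continuous_m2; apply: rcontB; [exact: cF|exact: rcont_cst].
have comp p (cp : R) : measurable_fun D (bt p) -> (forall t, (bt p t - cp) ^+ 2 <= q t) ->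
    (l^-1 * rint al (al + l) (fun t => p (bval F (cexpi t))) - cp) ^+ 2 <= A0.
  move=> mp hp; have := mean_dist (c := cp) l0 A00 mp.
  have -> : rint al (al + l) (bt p) = rint al (al + l) (fun t => p (bval F (cexpi t))).
    rewrite /rint; congr fine; apply/esym/(integral_eq_off (N := N)) => //.
      exact/measurable_EFinP.
    by move=> t _ Nt; rewrite btE.
  apply; apply: le_trans Hq; apply: integral_mono => t _; first by rewrite lee_fin sqr_ge0.
  by rewrite lee_fin.
set m := arc_avg I F.
have hm : cabs (m - c) ^+ 2 <= 2 * A0.
  rewrite sqr_cabs !raddfB /m arc_lenM_avg/= -/al -/l (_ : 2 * A0 = A0 + A0); last by ring.
  apply: lerD.
    by apply: (comp (@complex.Re R) (complex.Re c) mR) => t; rewrite /q lerDl sqr_ge0.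
  by apply: (comp (@complex.Im R) (complex.Im c) mIm) => t; rewrite /q lerDr sqr_ge0.
(* |w - m|^2 <= 2 |w - c|^2 + 2 |m - c|^2 with |m - c|^2 <= 2 A0, one A0 for each of the real and
   imaginary parts; integrated over the arc this gives the factor 2 + 4 = 6. *)
pose G t : R := 2 * q t + 4 * A0.
have mG : measurable_fun D (fun t => (G t)%:E).
  apply/measurable_EFinP; apply: measurable_funD => //.
  by apply: measurable_funM.
apply: (@le_trans _ _ (\int[mu]_(t in D) (G t)%:E)%E).
  apply: integral_mono_ae => //.
  - by move=> t _; rewrite lee_fin sqr_ge0.
  - by move=> t _; rewrite lee_fin /G addr_ge0// mulr_ge0// ltW.
  exists N; split => // t /= h; apply: contrapT => Nt; apply: h => Dt.
  rewrite lee_fin /G; set w := bval F (cexpi t).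
  have qE : q t = cabs (w - c) ^+ 2 by rewrite /q !btE// sqr_cabs !raddfB.
  rewrite qE.
  have tri : cabs (w - m) <= cabs (w - c) + cabs (m - c).
    by rewrite [cabs (m - c)]cabsB; apply: le_trans (cabsD _ _); rewrite addrA subrK.
  have : cabs (w - m) ^+ 2 <= (cabs (w - c) + cabs (m - c)) ^+ 2.
    by rewrite ler_pXn2r ?nnegrE ?addr_ge0.
  have := sqr_ge0 (cabs (w - c) - cabs (m - c)).
  move: hm; move: (cabs (w - m)) (cabs (w - c)) (cabs (m - c)) => x y z.
  by rewrite sqrrB sqrrD; clear; lra.
rewrite /G; under eq_integral do rewrite EFinD EFinM.
rewrite ge0_integralD//; last 3 first.
- by move=> t _; rewrite -EFinM lee_fin mulr_ge0.
- by apply: emeasurable_funM => //; exact/measurable_EFinP.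
- by move=> t _; rewrite lee_fin mulr_ge0// ltW.
rewrite ge0_integralZl_EFin//; last 2 first.
- by move=> t _; rewrite lee_fin.
- exact/measurable_EFinP.
have -> : (\int[mu]_(t in D) (4 * A0)%:E = (4 * A0 * l)%:E)%E.
  have cc : continuous (fun _ : R => 4 * A0) by move=> t; exact: cvg_cst.
  rewrite (integral_rint al (al + l) cc) rint_cst; last by rewrite lerDl; exact: ltW.
  by rewrite [al + l - al]addrAC subrr add0r.
apply: le_trans (leeD (lee_wpmul2l _ Hq) (lexx _)) _; first by rewrite lee_fin.
by rewrite -EFinM -EFinD lee_fin le_eqVlt; apply/orP; left; apply/eqP; ring.
Qed.

Lemma in_Morrey_of_wbound f F (G K V lam : R) : holo f -> holo F -> 0 <= K -> wbound f K lam ->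
  (forall z, cabs z < 1 -> cabs (cderiv F z) <= G * cabs (cderiv f z)) ->
  in_Hp 2%:E F -> (forall r, 0 < r < 1 -> m2 F r <= V) -> in_Morrey lam F.
Proof.
move=> hf hF K0 wf fF HF HV; split => //.
have {}hf : holoD 1 f by []. have {}hF : holoD 1 F by [].
have p0 := pi_gt0 R.
(* The 1 makes the bound strictly positive, as [mean_dist] requires. *)
pose K' := 4 * pi * (2 + 2 * pi) ^+ 2 * G ^+ 2 * K + 1.
have K'0 : 0 < K'.
  rewrite /K' ltr_wpDl//; apply: mulr_ge0 => //; apply: mulr_ge0; last exact: sqr_ge0.
  apply: mulr_ge0; last exact: sqr_ge0.
  by apply: mulr_ge0 => //; exact: ltW.
pose B : \bar R := poweR ((2 * pi)^-1 * (6 * K'))%:E 2^-1.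
have B1 : (B < +oo)%E by rewrite /B /= ltry.
apply: le_lt_trans B1; apply: ge_ereal_sup => _ [I _ <-].
have [b bF] := holoD_pser ltr01 hF.
have d0 := arc_size_gt0 I; have l0 := arc_len_gt0 I; have d1 := arc_size_le1 I.
set d := arc_size I in d0 d1 *; set a := box_pt I.
have dl : 0 < d `^ lam by exact: powR_gt0.
have A00 : 0 < K' * d `^ lam / arc_len I by rewrite divr_gt0// mulr_gt0.
have lA : arc_len I * (K' * d `^ lam / arc_len I) = K' * d `^ lam.
  by rewrite mulrC divfK// lt0r_neq0.
have HI n : rint (arc_start I) (arc_start I + arc_len I)
     (fun t => cabs (F (zc (sq n) t) - F ((sq n)%:C * a)) ^+ 2) <=
     arc_len I * (K' * d `^ lam / arc_len I).
  rewrite lA; apply: le_trans (arc_osc I hf hF wf fF (sq01 n)) _.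
  by apply: ler_wpM2r; [exact: ltW|rewrite /K' lerDl].
have a1 : cabs a < 1 by rewrite cabs_box_pt ltrBlDr ltrDl.
have cvF (p : C -> R) : (forall z w, `|p z - p w| <= cabs (z - w)) ->
    (fun n => p (F ((sq n)%:C * a))) @ \oo --> p (F a).
  move=> pl; apply/cvgrPdist_lt => e e0.
  have [dd dd0 Hd] := holoD_continuous hF a1 e0.
  have := sq_near dd0; apply: filterS => n nd; have /andP[s0 s1] := sq01 n.
  apply: le_lt_trans (pl _ _) _; rewrite cabsB; apply: Hd.
  have gen (u : R) : u%:C * a - a = - ((1 - u)%:C * a) by rewrite rmorphB/= rmorph1; ring.
  rewrite gen.
  rewrite cabsN cabsM cabsR ger0_norm ?subr_ge0 ?ltW//.
  apply: (@le_lt_trans _ _ (1 - sq n)); first by rewrite ler_piMr ?subr_ge0 ?(ltW s1) ?(ltW a1).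
  by move: nd; clear; lra.
have cR := cvF (@complex.Re R) (fun z w => ltac:(rewrite -raddfB; exact: Re_le_cabs)).
have cI := cvF (@complex.Im R) (fun z w => ltac:(rewrite -raddfB; exact: Im_le_cabs)).
have H := arc_bval_osc bF HV A00 cR cI HI; rewrite lA in H.
apply: gt0_ler_poweR; first by rewrite invr_ge0.
- rewrite in_itv/= leey andbT mule_ge0 ?lee_fin ?powR_ge0// /arc_rint mule_ge0 ?lee_fin ?invr_ge0 ?twopi_ge0//.
  by apply: integral_ge0 => t _; rewrite lee_fin sqr_ge0.
- by rewrite in_itv/= leey andbT lee_fin mulr_ge0 ?invr_ge0 ?twopi_ge0// mulr_ge0// ltW.
rewrite /arc_rint.
have H2 : (((2 * pi)^-1)%:E * \int[mu]_(t in `[arc_start I, (arc_start I + arc_len I)%R])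
     (cabs (bval F (cexpi t) - arc_avg I F) ^+ 2)%:E <= ((2 * pi)^-1 * (6 * (K' * d `^ lam)))%:E)%E.
  rewrite [leRHS]EFinM; apply: lee_wpmul2l H; rewrite lee_fin invr_ge0; exact: twopi_ge0.
apply: le_trans (lee_wpmul2l _ H2) _; first by rewrite lee_fin powR_ge0.
rewrite -EFinM lee_fin powRN le_eqVlt; apply/orP; left; apply/eqP.
have p2 := lt0r_neq0 (twopi_gt0 R); have dn := lt0r_neq0 dl.
by move: (2 * pi) (d `^ lam) p2 dn => P L p2 dn; field; rewrite p2 dn.
Qed.

End BoundaryValues.

(** * The lower bound *)

Section LowerBound.
Variable R : realType.
Local Notation C := R[i].
Local Notation cj := (@conjc R).
Local Notation mu := (@lebesgue_measure R).
Implicit Types (a z : C) (f g u : C -> C).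

Lemma atan_le (x : R) : 0 <= x -> atan x <= x.
Proof.
move=> x0; pose k (t : R) := 1 - (1 + t ^+ 2)^-1.
have den (t : R) : 0 < 1 + t ^+ 2 by rewrite ltr_wpDr ?sqr_ge0.
have dk (t : R) : is_derive t 1 (fun t => t - atan t) (k t).
  exact: (is_deriveB (is_derive_id t (1 : R)) (is_derive1_atan t)).
have ck : continuous k.
  move=> t; apply: cvgB; first exact: cvg_cst.
  apply: cvgV; first by rewrite lt0r_neq0.
  by apply: cvgD; [exact: cvg_cst|exact: exprn_continuous].
have := rint_FTC ck dk x0; rewrite atan0 !subr0 => h.
rewrite -subr_ge0 -h; apply: rint_ge0 => t _.
by rewrite subr_ge0 invf_le1// lerDl sqr_ge0.
Qed.

Lemma polar_right (z : C) : 0 < complex.Re z ->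
  z = zc (cabs z) (atan (complex.Im z / complex.Re z)).
Proof.
case: z => x y /= x0; set w := cabs _; set th := atan _.
have xn := lt0r_neq0 x0.
have wE : w ^+ 2 = x ^+ 2 + y ^+ 2 by rewrite /w sqr_cabs.
have w0 : 0 < w by rewrite /w cabs_gt0; apply/eqP => -[/eqP]; rewrite (negPf xn).
have c0 : 0 < cos th by rewrite cos_gt0_pihalf// atan_gtNpi2 atan_ltpi2.
have cE : w * cos th = x.
  apply/eqP; rewrite -(@eqrXn2 _ 2)//; [|by rewrite mulr_ge0 ?ltW|exact: ltW].
  rewrite exprMn wE cos_atan_sqr.
  have n0 : x ^+ 2 + y ^+ 2 != 0 by rewrite lt0r_neq0// ltr_wpDr ?sqr_ge0// exprn_gt0.
  have -> : 1 + (y / x) ^+ 2 = (x ^+ 2 + y ^+ 2) / x ^+ 2 by field.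
  by rewrite invf_div mulrCA divff// mulr1.
rewrite zcE cE sin_atan -/th mulrCA cE; congr (_ +i* _).
by rewrite divfK.
Qed.

Lemma has_arg (z : C) : z != 0 -> exists al, z = zc (cabs z) al.
Proof.
have pE : cexpi (pi : R) = -1 :> C by apply: complex_eq; rewrite /cexpi/= ?cospi ?sinpi ?oppr0.
move=> z0; have [x0|x0|x0] := ltgtP 0 (complex.Re z).
- by eexists; exact: polar_right.
- have h : 0 < complex.Re (- z) by rewrite raddfN oppr_gt0.
  exists (atan (complex.Im (- z) / complex.Re (- z)) + pi).
  set th := atan _.
  have -> : zc (cabs z) (th + pi) = - zc (cabs (- z)) th :> C.
    by rewrite cabsN /zc (cexpiD th) pE mulrN1 mulrN.
  by rewrite -(polar_right h) opprK.
- have yz : z = 'i * (complex.Im z)%:C by case: z z0 x0 => x y z0 /= <-; apply: complex_eq;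
  rewrite /=; ring.
  have cz : cabs z = `|complex.Im z|.
    by apply/eqP; rewrite -(@eqrXn2 _ 2)// sqr_cabs -x0 expr0n/= add0r real_normK ?num_real.
  have [y0|y0] := leP 0 (complex.Im z).
    exists (pi / 2); rewrite zcE cos_pihalf sin_pihalf cz ger0_norm//.
    by case: z x0 {z0 yz cz y0} => x y /= <-; rewrite mulr0 mulr1.
  exists (- (pi / 2)); rewrite zcE cosN sinN cos_pihalf sin_pihalf cz ltr0_norm//.
  by case: z x0 {z0 yz cz y0} => x y /= <-; rewrite mulr0 mulrN1 opprK.
Qed.

Lemma carc_gt0 (d : R) : 0 < d -> 0 < 4 * pi * d.
Proof. by move=> d0; rewrite mulr_gt0// mulr_gt0// pi_gt0. Qed.

Lemma carc_le (d : R) : d <= 2^-1 -> 4 * pi * d <= 2 * pi.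
Proof.
move=> d1; have p0 := pi_gt0 R; have -> : 2 * pi = 4 * pi * 2^-1 :> R by move: (pi : R) => P; field.
by apply: ler_wpM2l => //; apply: mulr_ge0 => //; exact: ltW.
Qed.

(** Centred at angle al; the length 4 pi d makes the normalized size 2 d, so the box reaches down to
    radius 1 - 2 d. *)
Definition carc (al d : R) (d0 : 0 < d) (d1 : d <= 2^-1) : Defs.arc R :=
  Arc (al - 2 * pi * d) (carc_gt0 d0) (carc_le d1).

Lemma carc_size al d d0 d1 : arc_size (@carc al d d0 d1) = 2 * d.
Proof.
rewrite /arc_size/=; have p0 := lt0r_neq0 (pi_gt0 R); move: (pi : R) p0 => P p0; by field.
Qed.

(** After rotating the centre to the positive axis, Re w >= 1 - 3 d / 2 >= 1/4 and |Im w| <= d / 2,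
    so the argument is at most 2 d in modulus, within the half length 2 pi d of the arc. *)
Lemma box_near al d d0 d1 z : cabs (z - zc (1 - d) al) <= d / 2 ->
  carleson_box (@carc al d d0 d1) z.
Proof.
move=> zd; have p0 := pi_gt0 R.
pose w := z * cexpi (- al).
have zE : z = w * cexpi al by rewrite /w -mulrA -cexpiD addNr cexpi0 mulr1.
have wa : cabs (w - (1 - d)%:C) <= d / 2.
  have -> : w - (1 - d)%:C = (z - zc (1 - d) al) * cexpi (- al).
    by rewrite /w /zc mulrBl -[_ * cexpi al * _]mulrA -cexpiD subrr cexpi0 mulr1.
  by rewrite cabsM cabs_cexpi mulr1.
have cw : cabs w = cabs z by rewrite /w cabsM cabs_cexpi mulr1.
have xr := le_trans (Re_le_cabs _) wa; have yr := le_trans (Im_le_cabs _) wa.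
rewrite raddfB/= in xr; rewrite raddfB/= subr0 in yr.
have x14 : 4^-1 <= complex.Re w.
  by move: xr; rewrite ler_norml => /andP[+ _]; move: d1; clear; lra.
have x0 : 0 < complex.Re w by apply: lt_le_trans x14; rewrite invr_gt0.
have wP := polar_right x0; set th := atan _ in wP.
have thd : `|th| <= 2 * pi * d.
  have uu : `|complex.Im w / complex.Re w| <= 2 * d.
    rewrite normrM normfV (gtr0_norm x0) ler_pdivrMr//; apply: le_trans yr _.
    by move: x14 d0; clear; nra.
  have th1 : `|th| <= `|complex.Im w / complex.Re w|.
    rewrite /th; case: (ger0P (complex.Im w / complex.Re w)) => u0.
      by rewrite ger0_norm ?atan_le// -(@atan0 R) le_atan.
    have h := @atan_le (- (complex.Im w / complex.Re w)); rewrite atanN in h.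
    by rewrite ltr0_norm ?h ?oppr_ge0 ?(ltW u0)// -(@atan0 R) lt_atan.
  apply: le_trans th1 _; apply: le_trans uu _; rewrite ler_pM2r//.
  by rewrite ler_peMr// (le_trans _ (pi_ge2 R))// ler1n.
split.
  rewrite carc_size.
  have h1 := cabs_triB (zc (1 - d) al) (zc (1 - d) al - z).
  have h2 := cabs_triB z (zc (1 - d) al).
  rewrite subKr [cabs (_ - z)]cabsB in h1.
  rewrite cabs_zc ger0_norm in h1 h2; last by move: d1; clear; lra.
  by apply/andP; split; move: zd h1 h2 d0; clear; lra.
have z0 : cabs z != 0 by rewrite -cw cabs_eq0; apply/eqP => w0; move: x0; rewrite w0 ltxx.
exists (al + th) => /=.
  move: thd; rewrite ler_norml in_itv/= => /andP[t1 t2].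
  have -> : 4 * pi * d = 2 * pi * d + 2 * pi * d by move: (pi : R) => P; ring.
  by apply/andP; split; move: t1 t2; move: (2 * pi * d) => P; clear; lra.
have zz : z = (cabs z)%:C * cexpi (al + th).
  by rewrite [al + th]addrC cexpiD mulrA -[_ * cexpi th]/(zc (cabs z) th) -cw -wP -zE.
have czn : (cabs z)%:C != 0 :> C by rewrite -cabsE normr_eq0 -cabs_eq0.
by rewrite cabsE [X in X / _]zz mulrAC divff// mul1r.
Qed.

(** The sub-mean value property of |u|^2 on every circle about a, integrated over the radii in polar
    coordinates centred at a. *)
Lemma disc_lower u a rho : holoD 1 u -> 0 < rho -> cabs a + rho < 1 ->
  measurable_fun setT (fun xy : R * R => \1_(`]-oo, (rho ^+ 2)%R]%classic) (cabs (xy.1 +i* xy.2 - a) ^+ 2) *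
     cabs (u (xy.1 +i* xy.2)) ^+ 2) /\
  ((pi * rho ^+ 2 * cabs (u a) ^+ 2)%:E <=
   \int[(mu \x mu)%E]_xy (\1_(`]-oo, (rho ^+ 2)%R]%classic) (cabs (xy.1 +i* xy.2 - a) ^+ 2) *
     cabs (u (xy.1 +i* xy.2)) ^+ 2)%:E)%E.
Proof.
move=> hu r0 ar; set w := \1_ _; have p0 := pi_gt0 R.
have [c cu] := holoD_pser ltr01 hu.
have mw : measurable_fun setT w by exact: measurable_indic.
have w0 x : 0 <= w x by rewrite /w indicE.
have wE x : w x = (x <= rho ^+ 2)%R%:R by rewrite /w indicE mem_setE in_itv.
pose k x y := w (cabs (x +i* y - a) ^+ 2) * cabs (u (x +i* y)) ^+ 2.
have k0 x y : 0 <= k x y by rewrite mulr_ge0// sqr_ge0.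
have mk : measurable_fun setT (fun xy : R * R => k xy.1 xy.2).
  apply: (measurable_weight (w := fun xy => w (cabs (xy.1 +i* xy.2 - a) ^+ 2)) cu) => [|xy h].
    apply: (measurableT_comp mw); apply: (cmeas_cabs (h := fun xy : R * R => xy.1 +i* xy.2 - a)).
    by apply: cmeasD; [exact: cmeas_pair|exact: cmeas_cst].
  rewrite wE leNgt; case: ltP => //= h2; exfalso.
  have : cabs (xy.1 +i* xy.2 - a) <= rho by rewrite -(@ler_pXn2r _ 2)// nnegrE// ltW.
  have := cabs_triB (xy.1 +i* xy.2) a; move: h ar; clear; lra.
pose v z := u (a + z).
have hv : holoD (1 - cabs a) v.
  move=> z za; have az : cabs (a + z) < 1.
    by apply: le_lt_trans (cabsD _ _) _; move: za; clear; lra.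
  have [l hl] := hu _ az; exists (l * (0 + 1)).
  apply: (has_cderiv_comp (f := fun z => a + z) _ hl).
  exact: has_cderivD (has_cderiv_cst a z) (has_cderiv_id z).
have kE r : (fun t => k (complex.Re a + r * cos t) (complex.Im a + r * sin t)) =
    (fun t => w (r ^+ 2) * cabs (v (zc r t)) ^+ 2).
  apply/funext => t.
  have E : (complex.Re a + r * cos t) +i* (complex.Im a + r * sin t) = a + zc r t.
    by rewrite zcE; case: (a).
  by rewrite /k E [a + _ - a]addrAC subrr add0r cabs_zc /v real_normK ?num_real.
have ck r : 0 < r -> continuous (fun t => k (complex.Re a + r * cos t) (complex.Im a + r * sin t)).
  move=> rp; rewrite kE; have [rr|rr] := leP r rho.
    have cc : rcont (fun t => v (zc r t)).
      by apply: (rcont_circle hv (ltW rp)); move: ar rr; clear; lra.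
    by move=> t; apply: cvgM; [exact: cvg_cst|exact: (continuous_m2 cc)].
  have -> : w (r ^+ 2) = 0 by rewrite wE leNgt ltr_pXn2r ?nnegrE ?(ltW r0) ?(ltW rp)// rr.
  by under eq_fun do rewrite mul0r; move=> t; exact: cvg_cst.
have [_ hp] := polar_center mk k0 ck.
split; first exact: mk.
rewrite [leRHS]hp.
pose c0 : R := 2 * pi * cabs (u a) ^+ 2.
have cl : continuous (fun r : R => c0 * r) by move=> r; apply: cvgM; [exact: cvg_cst|exact: cvg_id].
have dl (r : R) : is_derive r 1 (fun r => c0 / 2 * r ^+ 2) (c0 * r).
  apply: (is_derive_val (is_derive_cM (c0 / 2) (is_derive_pow 2 r))).
  by rewrite expr1; field.
have <- : (\int[mu]_(r in `[0%R, rho]) (c0 * r)%:E = (pi * rho ^+ 2 * cabs (u a) ^+ 2)%:E)%E.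
  rewrite integral_rint// (rint_FTC cl dl (ltW r0)) expr0n/= mulr0 subr0; congr (_%:E).
  by rewrite /c0; move: (pi : R) => P; field.
have c00 : 0 <= c0 by rewrite mulr_ge0 ?sqr_ge0// mulr_ge0// ltW.
apply: integral_mono_restrict => [r|r _|r].
- by rewrite /= in_itv/= => /andP[rp _]; rewrite lee_fin mulr_ge0.
- by rewrite lee_fin mulr_ge0 ?pos_mul_ge0// rint_ge0.
rewrite patch_setT patchE; case: ifPn => [/set_mem|_]; last first.
  by rewrite lee_fin mulr_ge0 ?pos_mul_ge0// rint_ge0.
rewrite /= in_itv/= => /andP[]; rewrite le_eqVlt => /predU1P[<-|rp] rr.
  by rewrite mulr0 lee_fin mulr0 mul0r.
rewrite lee_fin posE rp mul1r mulrC ler_pM2l// kE.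
have -> : w (r ^+ 2) = 1 by rewrite wE ler_pXn2r ?nnegrE ?(ltW r0) ?(ltW rp)// rr.
under [X in _ <= rint _ _ X]eq_fun do rewrite mul1r.
have ra : r < 1 - cabs a by move: ar rr; clear; lra.
have := @point_bound _ v (1 - cabs a) r 0 (lt_trans rp ra) hv rp ra.
rewrite cabs0 => /(_ rp); rewrite mul0r expr0n/= subr0 mulr1 /v addr0 => hm.
have -> : rint 0 (2 * pi) (fun t => cabs (v (zc r t)) ^+ 2) = 2 * pi * m2 v r.
  have p2 := lt0r_neq0 (twopi_gt0 R).
  by rewrite /m2 /rmean mulrA divff// mul1r.
by rewrite /c0; apply: ler_wpM2l; first exact: twopi_ge0.
Qed.

(** |k|^q <= d^(2 - q) |k|^2 and the mean of |k|^2 is at most 1/d, so the q-th means are at most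
    d^(1 - q); the q-th root has exponent - (1 - 1/q), which is - (1 + lam) / 2. *)
Lemma hnorm_ker (p : \bar R) a (d : R) : (2%:E < p)%E -> 0 < d -> cabs a = 1 - d ->
  (hnorm p (ker a) <= (d `^ (- ((1 + lam_of p) / 2)))%:E)%E.
Proof.
move=> p2 d0 ad.
have a1 : cabs a < 1 by rewrite ad ltrBlDr ltrDl.
have kz z : cabs z < 1 -> cabs (ker a z) <= d^-1.
  by move=> z1; apply: cabs_ker_le => //; rewrite -ad ler_piMr// ltW.
case: p p2 => [q||]//= q2; last first.
  apply: ge_ereal_sup => _ [z /= z1 <-]; rewrite lee_fin.
  have -> : - ((1 + 1) / 2) = -1 :> R by field.
  by rewrite (powR_inv1 (ltW d0)); exact: kz.
rewrite lte_fin in q2; have q0 : 0 < q by apply: lt_trans q2.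
have hk : holo (ker a) by apply: holoD_ker; rewrite mulr1 ltW.
have S : (ereal_sup [set hmean q (ker a) r | r in `]0%R, 1%R[] <= (d `^ (1 - q))%:E)%E.
  apply: ge_ereal_sup => _ [r /= r01 <-]; rewrite in_itv/= in r01; have /andP[r0 r1] := r01.
  rewrite hmeanE//; last by rewrite ltW.
  have ck : rcont (fun t => ker a (zc r t)) := rcont_circle (hk : holoD 1 _) (ltW r0) r1.
  have c2 := continuous_m2 ck.
  rewrite lee_fin; apply: (@le_trans _ _ (rmean (fun t => d `^ (2 - q) * cabs (ker a (zc r t)) ^+ 2))).
    apply: rmean_le => [||t _].
    - by apply: continuous_powR_comp => //; exact: rcont_cabs.
    - by move=> t; apply: cvgM; [exact: cvg_cst|exact: c2].
    have z1 : cabs (zc r t) < 1 by rewrite cabs_zc gtr0_norm.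
    have kp : 0 < cabs (ker a (zc r t)).
      rewrite cabs_gt0 invr_eq0; apply: ker_den_neq0.
      by apply: le_lt_trans z1; rewrite ler_piMl// ltW.
    have := kz _ z1; move: kp; move: (cabs (ker a _)) => x x0 xd.
    have -> : x `^ q = x `^ (q - 2) * x ^+ 2.
      by rewrite -(powR_mulrn 2 (ltW x0)) -powRD ?subrK// (gt_eqF x0) implybT.
    apply: ler_wpM2r; first exact: sqr_ge0.
    have -> : d `^ (2 - q) = d^-1 `^ (q - 2) by rewrite -(powR_inv1 (ltW d0)) -powRrM mulN1r opprB.
    apply: ge0_ler_powR => //; rewrite ?nnegrE ?invr_ge0 ?subr_ge0; exact: ltW.
  rewrite rmeanZ//.
  have hm : rmean (fun t => cabs (ker a (zc r t)) ^+ 2) <= d^-1.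
    have ra : cabs (r%:C * a) <= 1 - d.
      by rewrite cabsM cabsR gtr0_norm// -ad ler_piMl// ltW.
    have := m2_ker d0 ra; rewrite /m2; congr (rmean _ <= _).
    by apply/funext => t; rewrite -ker_zc.
  apply: le_trans (ler_wpM2l (powR_ge0 _ _) hm) _.
  have -> : 1 - q = (2 - q) + (-1) by ring.
  by rewrite -(powR_inv1 (ltW d0)) -powRD// (gt_eqF d0) implybT.
have -> : (d `^ (- ((1 + (1 - 2 / q)) / 2)))%:E = poweR ((d `^ (1 - q))%:E) q^-1.
  rewrite poweR_EFin -powRrM; congr (_ `^ _)%:E; field; exact: lt0r_neq0.
apply: gt0_ler_poweR S; rewrite ?invr_ge0 ?(ltW q0)//; last by rewrite in_itv/= leey lee_fin powR_ge0.
rewrite in_itv/= leey andbT; apply: (@le_trans _ _ (hmean q (ker a) 2^-1)).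
  rewrite hmeanE// ?lee_fin; last by rewrite invr_ge0 ler0n/= invf_lt1// ltr1n.
  by apply: rmean_ge0 => t; exact: powR_ge0.
apply: ereal_sup_ubound; exists 2^-1 => //=.
by rewrite in_itv/= invr_gt0 ltr0n/= invf_lt1// ltr1n.
Qed.

Lemma poweR_half_le (X : \bar R) (B : R) : (0 <= X)%E -> (poweR X 2^-1 <= B%:E)%E ->
  (X <= (B ^+ 2)%:E)%E.
Proof.
case: X => [x x0|_|//]; last by rewrite poweRyr// invr_neq0// pnatr_eq0.
rewrite lee_fin in x0; rewrite poweR_EFin !lee_fin powR12_sqrt// => h.
by rewrite -(sqr_sqrtr x0) ler_pXn2r ?nnegrE// ?sqrtr_ge0// (le_trans (sqrtr_ge0 x)).
Qed.

(** The box expression for [ker a] is at least a multiple of d^(- lam) d^3 d^(-4) |g(a)|^2, and the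
    hypothesis bounds it by M^2 d^(-1 - lam): the powers of d cancel. *)
Lemma ge1_bound (p : \bar R) g (M : R) a : (2%:E < p)%E -> holo g -> Ig_bound p g M ->
  2^-1 <= cabs a < 1 -> 0 <= M /\ cabs (g a) <= 32 * M.
Proof.
move=> p2 hg HM /andP[a2 a1]; have p0 := pi_gt0 R.
pose d := 1 - cabs a; have d0 : 0 < d by rewrite subr_gt0.
have d2 : d <= 2^-1 by move: a2; rewrite /d; clear; lra.
have ad : cabs a = 1 - d by rewrite /d subKr.
set lam := lam_of p.
have lam1 : lam <= 1.
  rewrite /lam; case: p p2 {HM lam} => [q||]//= q2; rewrite lerBlDr lerDl divr_ge0// ltW//.
  by rewrite lte_fin in q2; apply: lt_trans q2.
have hN := hnorm_ker p2 d0 ad; set N := d `^ _ in hN.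
have N0 : 0 < N by exact: powR_gt0.
have hk : holo (ker a) by apply: holoD_ker; rewrite mulr1 ltW.
have Hp : in_Hp p (ker a) by split => //; apply: le_lt_trans hN _; exact: ltry.
have [_ HI] := HM _ Hp.
have [c [hc _ dc]] := Ig_pser hk hg; set F := Ig g (ker a) in hc dc HI.
have hF' := pser_holoD (pser_cderiv hc).
have [al aE] : exists al, a = zc (cabs a) al.
  by apply: has_arg; rewrite -cabs_gt0; apply: lt_le_trans a2.
rewrite ad in aE.
pose I := carc al d0 d2; have dI : arc_size I = 2 * d by exact: carc_size.
set X := (((arc_size I `^ (- lam))%:E * area_int (carleson_box I)
   (fun z => cabs (cderiv F z) ^+ 2 * (1 - cabs z ^+ 2))%R)%E).
have X0 : (0 <= X)%E.
  rewrite mule_ge0 ?lee_fin ?powR_ge0// mule_ge0 ?lee_fin ?invr_ge0 ?(ltW p0)//.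
  apply: integral_ge0 => xy /= [/andP[_ z1] _]; rewrite lee_fin.
  by rewrite mulr_ge0 ?sqr_ge0// subr_ge0 exprn_ile1//; exact: ltW.
have hX : (poweR X 2^-1 <= M%:E * hnorm p (ker a))%E.
  apply: le_trans HI; rewrite /morrey_norm -[leLHS]add0e; apply: leeD; first by rewrite lee_fin.
  by apply: ereal_sup_ubound; exists I.
(* Strict positivity of the norm is what turns 0 <= M times the norm into 0 <= M. On the circle of
   radius 1/2 the kernel is at least 1/2. *)
have n0 : (0 < hnorm p (ker a))%E.
  have k0 : cabs (ker a 0) = 1 by rewrite /ker mulr0 subr0 invr1 cabs1.
  case: p p2 {HM lam lam1 hN N N0 Hp HI hX X X0} => [q||]//= q2; last first.
    apply: (@lt_le_trans _ _ 1%:E); first by rewrite lte_fin.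
    by apply: ereal_sup_ubound; exists 0; rewrite /disc/= ?cabs0 ?k0.
  rewrite lte_fin in q2; have q0 : 0 < q by apply: lt_trans q2.
  apply: poweR_gt0; apply: (@lt_le_trans _ _ (hmean q (ker a) 2^-1)); last first.
    by apply: ereal_sup_ubound; exists 2^-1 => //=; rewrite in_itv/= invr_gt0 ltr0n/= invf_lt1// ltr1n.
  have r01 : 0 < (2^-1 : R) < 1 by rewrite invr_gt0 ltr0n/= invf_lt1// ltr1n.
  have /andP[r0 r1] := r01.
  rewrite hmeanE//; last by rewrite ltW.
  rewrite lte_fin; apply: (@lt_le_trans _ _ (rmean (fun=> 2^-1 `^ q))).
    by rewrite rmean_cst powR_gt0// invr_gt0.
  apply: rmean_le => [t||t _]; first exact: cvg_cst.
    apply: continuous_powR_comp => //; apply: rcont_cabs.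
    exact: (rcont_circle (hk : holoD 1 _) (ltW r0) r1).
  apply: ge0_ler_powR; rewrite ?nnegrE ?invr_ge0//; first exact: ltW.
  rewrite /ker cabsV lef_pV2 ?posrE//.
    apply: le_trans (cabsD _ _) _; rewrite cabs1 cabsN cabsM cabs_conj cabs_zc gtr0_norm//.
    by move: a1 (cabs_ge0 a) r1 r0; clear; nra.
  by rewrite cabs_gt0 ker_den_neq0// cabs_zc gtr0_norm// (le_lt_trans _ r1)// ler_piMl// ltW.
have M0 : 0 <= M.
  have : (0 <= M%:E * hnorm p (ker a))%E by apply: le_trans hX; exact: poweR_ge0.
  by rewrite pmule_lge0.
split => //.
have hX2 : (X <= ((M * N) ^+ 2)%:E)%E.
  apply: poweR_half_le => //; apply: le_trans hX _; rewrite EFinM.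
  by apply: lee_wpmul2l => //; rewrite lee_fin.
have Ld : 0 < arc_size I `^ (- lam) by rewrite powR_gt0// dI mulr_gt0.
(* The disc of radius d/2 about a has normalized area (d/2)^2, and the weight 1 - |z|^2 is at least
   d/2 on it. *)
have fa : (((d / 2) * (d / 2) ^+ 2 * cabs (cderiv F a) ^+ 2)%:E <=
    area_int (carleson_box I) (fun z => cabs (cderiv F z) ^+ 2 * (1 - cabs z ^+ 2))%R)%E.
  have rho0 : 0 < d / 2 by rewrite divr_gt0.
  have ar : cabs a + d / 2 < 1 by rewrite ad; have := d0; clear; lra.
  have [mk H] := disc_lower hF' rho0 ar.
  rewrite /area_int.
  have -> : (d / 2) * (d / 2) ^+ 2 * cabs (cderiv F a) ^+ 2 =
      pi^-1 * ((d / 2) * (pi * (d / 2) ^+ 2 * cabs (cderiv F a) ^+ 2)).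
    by move: (pi : R) p0 => P P0; field; exact: lt0r_neq0.
  rewrite EFinM; apply: lee_wpmul2l; first by rewrite lee_fin invr_ge0 ltW.
  rewrite EFinM; apply: le_trans (lee_wpmul2l _ H) _; first by rewrite lee_fin ltW.
  pose k (xy : R * R) := \1_(`]-oo, ((d / 2) ^+ 2)%R]%classic) (cabs (xy.1 +i* xy.2 - a) ^+ 2) *
    cabs (cderiv F (xy.1 +i* xy.2)) ^+ 2.
  rewrite -[X in (_ * X <= _)%E]/(\int[(mu \x mu)%E]_xy (k xy)%:E)%E.
  have k0 xy : 0 <= k xy by rewrite /k indicE mulr_ge0 ?sqr_ge0.
  rewrite -ge0_integralZl_EFin//; last 3 first.
  - by move=> xy _; rewrite lee_fin.
  - exact/measurable_EFinP.
  - exact: ltW.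
  apply: integral_mono_restrict => [xy _|xy /= [/andP[_ z1] _]|[x y]].
  - by rewrite -EFinM lee_fin mulr_ge0// ltW.
  - by rewrite lee_fin mulr_ge0 ?sqr_ge0// subr_ge0 exprn_ile1//; exact: ltW.
  rewrite patch_setT /k/= -EFinM indicE mem_setE in_itv/=; set z := x +i* y.
  have [zd|zd] := leP (cabs (z - a) ^+ 2) ((d / 2) ^+ 2); last first.
    rewrite mul0r mulr0 patchE; case: ifPn => [/set_mem/= [/andP[_ z1] _]|_]//.
    by rewrite lee_fin mulr_ge0 ?sqr_ge0// subr_ge0 exprn_ile1//; exact: ltW.
  have {}zd : cabs (z - a) <= d / 2.
    by rewrite -(@ler_pXn2r _ 2)// nnegrE// ltW.
  have zI : carleson_box I z by apply: box_near; rewrite -aE.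
  rewrite patchE mem_set// lee_fin mul1r mulrC; apply: ler_wpM2l; first exact: sqr_ge0.
  rewrite -/z; have zz : cabs z <= 1 - d / 2.
    by have := cabs_triB z a; rewrite ad; move: zd; clear; lra.
  by have := d0; have := cabs_ge0 z; move: zz; clear; nra.
(* At a the derivative of the kernel is conj(a) times its square, with |a| >= 1/2 and |ker a a| >= 1
   / (2 d); hence 1 / (8 d^2). *)
have Fa : cabs (cderiv F a) >= cabs (g a) / (8 * d ^+ 2).
  have aa : cabs a * cabs a < 1 by rewrite mulr_ilt1.
  rewrite dc// (cderivE (has_cderiv_ker aa)) cabsM [cabs (cj a * _)]cabsM cabs_conj cabsX.
  have ck : (2 * d)^-1 <= cabs (ker a a).
    have den : cabs (1 - cj a * a) <= 2 * d.
      have -> : 1 - cj a * a = (1 - cabs a ^+ 2)%:C.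
        by rewrite mulrC mul_conj rmorphB/= rmorph1.
      rewrite cabsR ger0_norm ?subr_ge0 ?exprn_ile1 ?(ltW a1)// ad.
      by have := d0; clear; nra.
    by rewrite /ker cabsV lef_pV2 ?posrE ?mulr_gt0// cabs_gt0 ker_den_neq0.
  have -> : cabs (g a) / (8 * d ^+ 2) = 2^-1 * (2 * d)^-1 ^+ 2 * cabs (g a).
    by field; exact: lt0r_neq0.
  apply: ler_wpM2r => //; apply: ler_pM => //; first by rewrite exprn_ge0// invr_ge0 mulr_ge0// ltW.
  by rewrite ler_pXn2r ?nnegrE// invr_ge0 mulr_ge0// ltW.
have H1 : (2 * d) `^ (- lam) * ((d / 2) * (d / 2) ^+ 2 * cabs (cderiv F a) ^+ 2) <= (M * N) ^+ 2.
  rewrite -lee_fin; apply: le_trans hX2; rewrite EFinM /X -dI.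
  by apply: lee_wpmul2l => //; rewrite lee_fin ltW.
have NN : N ^+ 2 = d `^ (- lam) * d^-1.
  rewrite /N -powR_mulrn ?powR_ge0// -powRrM -(powR_inv1 (ltW d0)) -powRD ?(gt_eqF d0) ?implybT//.
  by rewrite -/lam mulNr divfK ?pnatr_eq0// opprD [- 1 - lam]addrC.
have E2 : (2 * d) `^ (- lam) = 2 `^ (- lam) * d `^ (- lam) by rewrite powRM// ltW.
have t2 : 2^-1 <= 2 `^ (- lam).
  rewrite -(powR_inv1 (ler0n R 2)); apply: ler_powR; first by rewrite ler1n.
  by rewrite lerN2.
have Dl : 0 < d `^ (- lam) by exact: powR_gt0.
have F2 : (cabs (g a) / (8 * d ^+ 2)) ^+ 2 <= cabs (cderiv F a) ^+ 2.
  by rewrite ler_pXn2r ?nnegrE// divr_ge0// mulr_ge0// sqr_ge0.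
rewrite [(M * N) ^+ 2]exprMn NN E2 in H1.
have H3 : 2^-1 * ((d / 2) * (d / 2) ^+ 2 * (cabs (g a) / (8 * d ^+ 2)) ^+ 2) <= M ^+ 2 * d^-1.
  rewrite -(ler_pM2l Dl); apply: le_trans (_ : _ <= M ^+ 2 * (d `^ (- lam) / d)) _; last first.
    by rewrite mulrCA.
  apply: le_trans H1; rewrite [leRHS]mulrAC [leRHS]mulrC; apply: ler_wpM2l; first exact: ltW.
  apply: ler_pM => //.
  - apply: mulr_ge0; last exact: sqr_ge0.
    by apply: mulr_ge0; [rewrite divr_ge0// ltW|exact: sqr_ge0].
  - by apply: ler_wpM2l => //; apply: mulr_ge0; [rewrite divr_ge0// ltW|exact: sqr_ge0].
(* The factors 2 from [t2], 8 from (d/2)^3 and 64 from the squared derivative multiply to 1024 =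
   32^2. *)
have H4 : cabs (g a) ^+ 2 <= (32 * M) ^+ 2.
  move: H3; have -> : 2^-1 * ((d / 2) * (d / 2) ^+ 2 * (cabs (g a) / (8 * d ^+ 2)) ^+ 2) =
     cabs (g a) ^+ 2 / 32 ^+ 2 * d^-1 by field; exact: lt0r_neq0.
  have c32 : 0 < 32 ^+ 2 :> R by apply: exprn_gt0.
  have di : 0 < d^-1 by rewrite invr_gt0.
  by rewrite (ler_pM2r di) (ler_pdivrMr _ _ c32) [(32 * M) ^+ 2]exprMn [32 ^+ 2 * _]mulrC.
by move: H4; rewrite ler_pXn2r ?nnegrE// mulr_ge0.
Qed.

(** For |z| < 1/2 the point bound from the circle of radius 3/4 applies with |z| / (3/4) <= 2/3;
    this costs a factor 9/5 in the square, and 64 = 2 times 32 leaves room for 4. *)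
Lemma Ig_bound_sup (p : \bar R) g (M : R) : (2%:E < p)%E -> holo g -> Ig_bound p g M ->
  forall z, cabs z < 1 -> cabs (g z) <= 64 * M.
Proof.
move=> p2 hg HM z z1; have [z2|z2] := leP 2^-1 (cabs z).
  have [|M0 h] := ge1_bound p2 hg HM (a := z); first by rewrite z2.
  by apply: le_trans h _; rewrite ler_wpM2r// ler_nat.
have r0 : 0 < 3 / 4 :> R by rewrite divr_gt0.
have r1 : 3 / 4 < 1 :> R by rewrite ltr_pdivrMr// mul1r ltr_nat.
have r2 : 2^-1 <= 3 / 4 :> R by lra.
have gc t : 0 <= M /\ cabs (g (zc (3 / 4) t)) <= 32 * M.
  by apply: (ge1_bound p2 hg HM); rewrite cabs_zc gtr0_norm// r2.
have M0 : 0 <= M by have [] := gc 0.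
have zr : cabs z < 3 / 4 by move: z2; lra.
have cg : rcont (fun t => g (zc (3 / 4) t)) := rcont_circle (hg : holoD 1 g) (ltW r0) r1.
have hb := point_bound ltr01 (hg : holoD 1 g) r0 r1 zr.
have hm : m2 g (3 / 4) <= (32 * M) ^+ 2.
  rewrite -[leRHS]rmean_cst; apply: rmean_le => [||t _]; first exact: continuous_m2.
    by move=> t; exact: cvg_cst.
  by have [_ h] := gc t; rewrite ler_pXn2r ?nnegrE// mulr_ge0.
have zq : (cabs z / (3 / 4)) ^+ 2 <= 4 / 9.
  have h : cabs z / (3 / 4) <= 2 / 3 by rewrite ler_pdivrMr//; move: z2; clear; lra.
  have -> : 4 / 9 = (2 / 3) ^+ 2 :> R by field.
  by rewrite ler_pXn2r ?nnegrE// ?divr_ge0// ltW.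
have h1 : cabs (g z) ^+ 2 * (5 / 9) <= (32 * M) ^+ 2.
  apply: le_trans hm; apply: le_trans hb; apply: ler_wpM2l; first exact: sqr_ge0.
  by move: zq; move: (_ ^+ 2) => x; clear; lra.
have : cabs (g z) ^+ 2 <= (64 * M) ^+ 2.
  have -> : (64 * M) ^+ 2 = 4 * (32 * M) ^+ 2 by ring.
  move: h1; have := sqr_ge0 (32 * M); move: (cabs _ ^+ 2) ((32 * M) ^+ 2) => x y; clear; lra.
by rewrite ler_pXn2r ?nnegrE// mulr_ge0.
Qed.

End LowerBound.

(** * The upper bound *)

Section UpperBound.
Variable R : realType.
Local Notation C := R[i].
Implicit Types f g : C -> C.

Lemma hnorm_ge0 (p : \bar R) f : (2%:E < p)%E -> (0 <= hnorm p f)%E.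
Proof.
case: p => [q||]//= _; first exact: poweR_ge0.
by apply: (@le_trans _ _ (cabs (f 0))%:E); [rewrite lee_fin|apply: ereal_sup_ubound; exists 0;
  rewrite /disc/= ?cabs0].
Qed.

Lemma Ig_bound_upper (p : \bar R) g (G : R) : (2%:E < p)%E -> holo g ->
  (forall z, cabs z < 1 -> cabs (g z) <= G) -> Ig_bound p g (5 * (2 + 2 * pi) * G).
Proof.
move=> p2 hg HG f [hf fin].
have G0 : 0 <= G by apply: le_trans (HG 0 _); rewrite ?cabs0.
have [c [hc F0 dc]] := Ig_pser hf hg; set F := Ig g f in hc F0 dc *.
have hF : holo F by exact: (pser_holoD hc).
have fF z : cabs z < 1 -> cabs (cderiv F z) <= G * cabs (cderiv f z).
  by move=> z1; rewrite dc// cabsM mulrC ler_wpM2r ?HG.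
have hn0 := hnorm_ge0 f p2.
set n := fine (hnorm p f).
have nE : hnorm p f = n%:E by rewrite /n fineK// ge0_fin_numE.
have n0 : 0 <= n by rewrite -lee_fin -nE.
set lam := lam_of p.
have wN N : n < N -> wbound f (2 * N ^+ 2) lam.
  move=> nN; have N0 := le_lt_trans n0 nN; apply: hp_le_wbound => //.
  by apply: hnorm_hp_le => //; rewrite nE lee_fin ltW.
split.
  (* For membership any N above the norm will do. *)
  have wf := wN (n + 1) (ltr_pwDr ltr01 (lexx n)).
  have HV := fun r (h : 0 < r < 1) => wbound_m2_le wf h.
  have H2 := Ig_in_H2 hf hg HG HV.
  have H2V : exists V, forall r, 0 < r < 1 -> m2 F r <= V.
    exists (2 * G ^+ 2 * (2 * (n + 1) ^+ 2)) => r /andP[r0 r1].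
    have [a af] := holoD_pser ltr01 (hf : holoD 1 f).
    apply: (m2_le_ps2 hc (ltW r0) r1) => N.
    apply: le_trans (ps2_mono _ _ (ltW r0) (ltW r1)) _; rewrite ps2_at1.
    case: N => [|N].
      by rewrite big_ord0; apply: mulr_ge0; apply: mulr_ge0 => //; exact: sqr_ge0.
    rewrite big_ord_recl/= cabs0 expr0n/= add0r.
    exact: (lp_compare hc af fF HV).
  have [V hV] := H2V.
  apply: (in_Morrey_of_wbound (K := 2 * (n + 1) ^+ 2) hf hF _ wf fF H2 hV).
  by apply: mulr_ge0 => //; exact: sqr_ge0.
rewrite /morrey_norm F0 cabs0 add0e nE -EFinM.
set c2 := 5 * (2 + 2 * pi) * G.
have p0 := pi_gt0 R.
have P0 : 0 <= 2 + 2 * pi :> R by rewrite addr_ge0// mulr_ge0// ltW.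
have c20 : 0 <= c2 by rewrite mulr_ge0// mulr_ge0.
apply: ge_ereal_sup => _ [I _ <-].
apply/lee_addgt0Pr => e e0; rewrite -EFinD.
(* [wbound] is available for N strictly above the norm, which may be 0; the excess is chosen so that
   c2 N exceeds c2 n by at most e. *)
pose N := n + e / (c2 + 1); have c21 : 0 < c2 + 1 by rewrite ltr_wpDl.
have nN : n < N by rewrite ltrDl divr_gt0.
have N0 := le_lt_trans n0 nN.
have K0 : 0 <= 2 * N ^+ 2 by apply: mulr_ge0 => //; exact: sqr_ge0.
have H := carleson_upper I (hf : holoD 1 f) K0 (wN N nN) fF.
have Ld : 0 < arc_size I `^ lam by rewrite powR_gt0// arc_size_gt0.
set A := area_int _ _ in H *.
have A0 : (0 <= A)%E.
  rewrite /A mule_ge0 ?lee_fin ?invr_ge0 ?(ltW p0)//; apply: integral_ge0 => xy /= [/andP[_ z1] _].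
  by rewrite lee_fin mulr_ge0 ?sqr_ge0// subr_ge0 exprn_ile1//; exact: ltW.
have HX : (((arc_size I `^ (- lam))%:E * A) <= ((c2 * N) ^+ 2)%:E)%E.
  apply: le_trans (lee_wpmul2l _ H) _; first by rewrite lee_fin powR_ge0.
  rewrite -EFinM lee_fin powRN /c2.
  (* With K = 2 N^2 the factor 10 becomes 20, rounded up to 25 = 5^2; this is the 5 of the upper
     constant. *)
  have -> : (arc_size I `^ lam)^-1 * (10 * (2 + 2 * pi) ^+ 2 * G ^+ 2 * (2 * N ^+ 2) * arc_size I `^ lam) =
      20 * ((2 + 2 * pi) * G * N) ^+ 2.
    by move: (2 + 2 * pi) (_ `^ _) Ld => P L L0; field; exact: lt0r_neq0.
  have -> : (5 * (2 + 2 * pi) * G * N) ^+ 2 = 25 * ((2 + 2 * pi) * G * N) ^+ 2 by ring.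
  by apply: ler_wpM2r; [exact: sqr_ge0|rewrite ler_nat].
have X0 : (0 <= (arc_size I `^ (- lam))%:E * A)%E by rewrite mule_ge0// lee_fin powR_ge0.
apply: (@le_trans _ _ (c2 * N)%:E); last first.
  rewrite lee_fin /N mulrDr lerD2l mulrCA ler_piMr ?(ltW e0)// ler_pdivrMr// mul1r lerDl.
  exact: ler01.
have cN0 : 0 <= c2 * N by rewrite mulr_ge0// ltW.
move: X0 HX; move: (_ * A)%E => [x||]//; rewrite !lee_fin => x0 xc.
rewrite powR12_sqrt// -(ger0_norm cN0) -sqrtr_sqr.
by apply: ler_wsqrtr.
Qed.

Lemma le_sup_norm g z : in_Hp +oo%E g -> cabs z < 1 -> cabs (g z) <= fine (sup_norm g).
Proof.
move=> [hg /= fin] z1.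
have ub w : cabs w < 1 -> ((cabs (g w))%:E <= sup_norm g)%E.
  by move=> w1; apply: ereal_sup_ubound; exists w.
rewrite -lee_fin fineK; first exact: ub.
rewrite ge0_fin_numE//; apply: le_trans (ub 0 _); first by rewrite lee_fin.
by rewrite cabs0.
Qed.

End UpperBound.

Theorem theorem3 (R : realType) (p : \bar R) : (2%:E < p)%E ->
  exists c1 c2 : R, 0 < c1 /\ 0 < c2 /\
  forall g : R[i] -> R[i], holo g ->
    (Ig_bounded p g <-> in_Hp +oo%E g) /\
    (in_Hp +oo%E g ->
       (forall M : R, Ig_bound p g M -> (c1%:E * sup_norm g <= M%:E)%E) /\
       Ig_bound p g (c2 * fine (sup_norm g))).
Proof.
move=> p2; exists 64^-1, (5 * (2 + 2 * pi)); split; first by rewrite invr_gt0.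
have p0 := pi_gt0 R.
split; first by rewrite mulr_gt0// addr_gt0// mulr_gt0.
move=> g hg.
have upper : in_Hp +oo%E g -> Ig_bound p g (5 * (2 + 2 * pi) * fine (sup_norm g)).
  by move=> Hg; apply: Ig_bound_upper => // z; exact: le_sup_norm.
have lower M : Ig_bound p g M -> (sup_norm g <= (64 * M)%:E)%E.
  by move=> HM; apply: ge_ereal_sup => _ [z /= z1 <-]; rewrite lee_fin; exact: (Ig_bound_sup p2 hg HM).
split; last first.
  move=> Hg; split; last exact: upper.
  move=> M /lower h.
  have -> : M = 64^-1 * (64 * M) by rewrite mulKf// pnatr_eq0.
  by rewrite EFinM; apply: lee_wpmul2l h; rewrite lee_fin invr_ge0.
split=> [[M HM]|Hg]; last by eexists; exact: upper.
by split => //=; apply: le_lt_trans (lower M HM) _; exact: ltry.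
Qed.
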